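(* Let $(R,\mathfrak m)$ be an excellent local Noetherian domain of prime characteristic $p$, and let $I$ be a parameter ideal of $R$. Then for all $n\ge 0$, $$I^n\cap (I^{n+1})^*=I^nI^*.$$
   Context: For a Noetherian ring $R$ of prime characteristic $p$, $R^0$ denotes the set of elements of $R$ not contained in any minimal prime of $R$. For an ideal $J=(a_1,\dots,a_r)$ and $q=p^s$, put $J^{[q]}=(a_1^q,\dots,a_r^q)$. The tight closure $J^*$ of $J$ is the ideal of all $x\in R$ for which there is $c\in R^0$ with $cx^q\in J^{[q]}$ for all sufficiently large $q=p^s$. A parameter ideal is an ideal that can be written $(x_1,\dots,x_h)$ with $\operatorname{ht}(x_1,\dots,x_h)=h$. By convention $I^0=R$. *)

(* Defs.v *)
From HB Require Import structures.
From mathcomp Require Import all_boot all_order all_algebra.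
From mathcomp Require Import boolp classical_sets.

Set Implicit Arguments.
Unset Strict Implicit.
Unset Printing Implicit Defensive.

Import GRing.Theory.
Local Open Scope classical_set_scope.
Local Open Scope ring_scope.

(* Rings are [comPzRingType], so that the zero ring, which does occur as a
   formal fibre, is allowed; it has no prime ideals. *)

Section Ideals.
Variable R : comPzRingType.
Implicit Types (I J P Q : set R) (A : set R) (n h : nat).

Definition is_ideal I : Prop :=
  I 0 /\ forall a x y, I x -> I y -> I (a * x + y).

Definition is_prime P : Prop :=
  [/\ is_ideal P, ~ P 1 & forall x y, P (x * y) -> P x \/ P y].

Definition is_maximal I : Prop :=
  [/\ is_ideal I, ~ I 1 & forall J, is_ideal J -> ~ J 1 -> I `<=` J -> J = I].

Definition idl A : set R := smallest is_ideal A.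

Definition ideal_mul I J : set R := idl [set x * y | x in I & y in J].

Definition ideal_pow I n : set R := iter n (ideal_mul I) setT.

Definition minimal_prime P : Prop :=
  is_prime P /\ forall Q, is_prime Q -> Q `<=` P -> Q = P.

(* The set $R^0$. *)
Definition off_minimal_primes : set R :=
  [set c | forall P, minimal_prime P -> ~ P c].

(* [c 0 < c 1 < ... < c n] is a strictly increasing chain of primes; the values
   of [c] beyond [n] are irrelevant. *)
Definition prime_chain n (c : nat -> set R) : Prop :=
  (forall i, (i <= n)%N -> is_prime (c i)) /\
  (forall i, (i < n)%N -> c i `<` c i.+1).

(* For [P] prime: the height of [P] is at least [n]. *)
Definition height_ge P n : Prop := exists2 c, prime_chain n c & c n = P.

(* The height of an ideal is the minimum of the heights of the primes that
   contain it. In particular the unit ideal has no height in [nat]. *)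
Definition has_height I h : Prop :=
  (forall P, is_prime P -> I `<=` P -> height_ge P h) /\
  (exists P, [/\ is_prime P, I `<=` P & ~ height_ge P h.+1]).

Definition has_krull_dim n : Prop :=
  (exists c, prime_chain n c) /\ ~ (exists c, prime_chain n.+1 c).

Definition is_parameter_ideal I : Prop :=
  exists2 s : seq R, I = idl [set` s] & has_height I (size s).

(* $J^{[q]}$, computed from any finite system of generators of [J]; the choice
   does not matter, see [frob_powE]. *)
Definition frob_pow q J : set R :=
  [set y | exists2 s : seq R,
     J = idl [set` s] & idl [set x ^+ q | x in [set` s]] y].

Definition tight_closure (p : nat) J : set R :=
  [set x | exists2 c, off_minimal_primes c &
     exists e0, forall e, (e0 <= e)%N -> frob_pow (p ^ e) J (c * x ^+ (p ^ e))].

Definition saturated_chain P Q n : Prop :=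
  exists c, [/\ prime_chain n c, c 0%N = P, c n = Q &
    forall i, (i < n)%N ->
      ~ exists P', [/\ is_prime P', c i `<` P' & P' `<` c i.+1]].

End Ideals.

Arguments has_krull_dim : clear implicits.

Section RingProperties.
Variable R : comPzRingType.

Definition noetherian : Prop :=
  forall I : set R, is_ideal I -> exists s : seq R, I = idl [set` s].

Definition local_with (m : set R) : Prop :=
  is_maximal m /\ forall m', is_maximal m' -> m' = m.

Definition regular_local : Prop :=
  noetherian /\ exists2 m : set R, local_with m &
    exists2 s : seq R, m = idl [set` s] & has_krull_dim R (size s).

Definition catenary : Prop :=
  forall P Q : set R, is_prime P -> is_prime Q -> P `<=` Q ->
    exists! n, saturated_chain P Q n.

End RingProperties.

Arguments noetherian : clear implicits.
Arguments regular_local : clear implicits.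
Arguments catenary : clear implicits.

(* Localizations, completions and tensor products are described up to unique
   isomorphism by predicates on their structure morphisms. *)

(* [f] exhibits [T] as the ring of fractions of [R] with denominators in [S]. *)
Definition is_localization (R T : comPzRingType) (S : set R)
    (f : {rmorphism R -> T}) : Prop :=
  [/\ forall s, S s -> exists u, f s * u = 1,
      forall t, exists a s, S s /\ t * f s = f a
    & forall a, f a = 0 -> exists2 s, S s & s * a = 0].

Definition regular_at (R : comPzRingType) (P : set R) : Prop :=
  exists (T : comPzRingType) (f : {rmorphism R -> T}),
    is_localization (~` P) f /\ regular_local T.

Definition regular_ring (R : comPzRingType) : Prop :=
  noetherian R /\ forall P : set R, is_prime P -> regular_at P.

Definition of_finite_type (R S : comPzRingType) (f : {rmorphism R -> S}) : Prop :=
  exists s : seq S,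
    smallest (fun T : set S => subring_closed (mem T))
      (range f `|` [set` s]) = setT.

(* [g] exhibits [B] as the [m]-adic completion of [A], for [m] finitely
   generated: [B] is separated and complete for the filtration [m ^ n * B], and
   [A / m ^ n -> B / m ^ n * B] is surjective and injective for all [n]. *)
Definition is_completion (A B : comPzRingType) (m : set A)
    (g : {rmorphism A -> B}) : Prop :=
  let mB n := idl (g @` ideal_pow m n) in
  [/\ \bigcap_n mB n = [set 0],
      forall x : nat -> B, (forall n, mB n (x n.+1 - x n)) ->
        exists y, forall n, mB n (y - x n),
      forall n b, exists a, mB n (b - g a)
    & forall n a, mB n (g a) -> ideal_pow m n a].

(* The commutative square formed by [g], [h], [i] and [j] is cocartesian, that
   is, [T] is the tensor product of [B] and [C] over [A]. *)
Definition is_tensor_product (A B C T : comPzRingType)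
    (g : {rmorphism A -> B}) (h : {rmorphism A -> C})
    (i : {rmorphism B -> T}) (j : {rmorphism C -> T}) : Prop :=
  i \o g =1 j \o h /\
  forall (D : comPzRingType) (u : {rmorphism B -> D}) (v : {rmorphism C -> D}),
    u \o g =1 v \o h ->
    (exists w : {rmorphism T -> D}, w \o i =1 u /\ w \o j =1 v) /\
    (forall w w' : {rmorphism T -> D},
       w \o i =1 w' \o i -> w \o j =1 w' \o j -> w =1 w').

(* A morphism [h] from [A] to a field [L] amounts to a prime [q := ker h] of [A]
   and a field extension [L] of the residue field of [q], whose image in [L]
   consists of the fractions [h a / h b]. This says that [L] is a finite
   extension of it. *)
Definition finite_over_residue_field (A : comPzRingType) (L : fieldType)
    (h : {rmorphism A -> L}) : Prop :=
  exists s : seq L, forall x, exists c : nat -> L,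
    (forall k, exists a b, c k = h a / h b) /\
    x = \sum_(k < size s) c k * s`_k.

(* [T] is the base change to [L] of the fibre of [g] over the prime [ker h]. *)
Definition geometrically_regular_fibres (A B : comPzRingType)
    (g : {rmorphism A -> B}) : Prop :=
  forall (L : fieldType) (h : {rmorphism A -> L}),
    finite_over_residue_field h ->
    exists (T : comPzRingType) (i : {rmorphism B -> T}) (j : {rmorphism L -> T}),
      is_tensor_product g h i j /\ regular_ring T.

(* Flatness of [A -> B] is not required separately: it is automatic for the
   completion of a Noetherian local ring. *)
Definition G_ring (R : comPzRingType) : Prop :=
  forall P : set R, is_prime P ->
    exists (A : comPzRingType) (f : {rmorphism R -> A}) (m : set A)
           (B : comPzRingType) (g : {rmorphism A -> B}),
      [/\ is_localization (~` P) f, local_with m, is_completion m g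
        & geometrically_regular_fibres g].

Definition universally_catenary (R : comPzRingType) : Prop :=
  forall (S : comPzRingType) (f : {rmorphism R -> S}),
    of_finite_type f -> catenary S.

(* The regular locus of [Spec S] is the complement of the closed set [V(E)]. *)
Definition J_2 (R : comPzRingType) : Prop :=
  forall (S : comPzRingType) (f : {rmorphism R -> S}), of_finite_type f ->
    exists E : set S, forall P, is_prime P -> (regular_at P <-> ~ E `<=` P).

Definition excellent (R : comPzRingType) : Prop :=
  [/\ noetherian R, universally_catenary R, G_ring R & J_2 R].

Lemma idl_ideal (R : comPzRingType) (A : set R) : is_ideal (idl A).
Proof.
split=> [J [[J0 _] _] //|a x y Ix Iy J [JI AJ]].
by apply: JI.2; [exact: Ix | exact: Iy].
Qed.

Lemma idl_sub (R : comPzRingType) (A : set R) : A `<=` idl A.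
Proof. by move=> x Ax J [_]; apply. Qed.

Lemma idl_min (R : comPzRingType) (A J : set R) :
  is_ideal J -> A `<=` J -> idl A `<=` J.
Proof. by move=> JI AJ x; apply. Qed.

Lemma frob_powE (R : comNzRingType) (p e : nat) (s : seq R) :
  p \in [pchar R] ->
  frob_pow (p ^ e) (idl [set` s]) = idl [set x ^+ (p ^ e) | x in [set` s]].
Proof.
move=> charRp; apply/seteqP; split=> [y [t st]|y ys]; last by exists s.
apply: idl_min; first exact: idl_ideal.
move=> _ [x xt <-].
set J := idl [set x ^+ _ | x in [set` s]].
have [J0 JD] : is_ideal J by exact: idl_ideal.
suff : idl [set` s] `<=` [set z | J (z ^+ (p ^ e))].
  by apply; rewrite st; exact: idl_sub.
apply: idl_min; last by move=> z sz; apply: idl_sub; exists z.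
split=> [|a u v Ju Jv] /=.
  by rewrite expr0n expn_eq0 eqn0Ngt prime_gt0 ?(pcharf_prime charRp).
rewrite exprDn_pchar; first by rewrite exprMn; exact: JD.
by rewrite pnatX (eq_pnat _ (pcharf_eq charRp)) pnat_id ?(pcharf_prime charRp).
Qed.

(* Main.v *)
Require Import Defs.
From HB Require Import structures.
From mathcomp Require Import all_boot all_order all_algebra.
From mathcomp Require Import boolp classical_sets.
From mathcomp Require Import ring zify.

(** Let [B] be the completion of [R]. All the Koszul homology of the powers of a system of
    parameters [x] of [R], with values in [B], is killed by one nonzero [c] in [R]
    ([parameter_colon_killer]), so that [c] kills the colons
    [(x_j ^ t_j, j != i) : x_i ^ k] modulo [(x_j ^ t_j, j != i)] in [R]. If
    [x = \sum_u r_u s ^ u], over the monomials of degree [n] in the generators [s] of [I],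
    is in the tight closure of [I ^ n.+1], these colons allow one to cancel the monomials and
    to find a multiple of [r_u ^ q] in the Frobenius power of [I], whence [r_u] is in the
    tight closure of [I].

    To find [c] it is enough, for every prime [Q] of [B] with [Q \cap R = 0], to kill the
    homology by an element outside [Q]. Modulo [Q] itself this comes from finiteness of [B / Q]
    over a power series ring, in the degrees above [dim R - dim B / Q]. This is at most
    [ht Q], because [R] is formally equidimensional (Ratliff's theorem, from universal
    catenarity). Modulo a sequence that is regular at [Q], the element is found by descending
    induction on the length of the sequence: either the sequence can be extended inside [Q],
    or [Q] is an associated prime of it. In the second case regularity of the generic formal
    fibre bounds [ht Q] by the length of the sequence. Ideals and their localizations and
    quotients are handled throughout through subsets of the ambient ring. *)

Set Implicit Arguments.
Unset Strict Implicit.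
Unset Printing Implicit Defensive.

Import GRing.Theory.
Local Open Scope classical_set_scope.
Local Open Scope ring_scope.

#[local] Hint Resolve subset_refl : core.

(** * Ideals *)

(** The exponents [q u_i + q] of the generators grow with [q], while tight closure grants a single
    multiplier for all [q]. This is why annihilators are sought for the homology of all powers
    [x ^ t] at once. Uniformity in [t] originates in one place: over [B / Q], the element attached
    to a system of parameters [z] of [B / Q] serves for all powers of [z] simultaneously. Whatever
    [t] is, some power of [z] lies in [(x ^ t)], and it does not matter how high that power is.

    The uniform annihilators form an ideal of [B]. If it missed the image of [R \ 0], it would lie
    in a prime avoiding that image, so that a local statement at each such prime already places [c]
    in [R].

    The passage from primes to [B] must not lose a degree, and this is what the height bounds are
    for: in the associated case they force the prime to be minimal over the sequence, so that a
    filtration with prime quotients needs only the primes themselves, up to a multiplier outside. In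
    the other case the element that extends the sequence has to be an annihilator as well, and
    therefore the prime is taken minimal over the ideal of annihilators. *)

Section IdealBasics.
Variable R : comPzRingType.
Implicit Types (I J K P Q : set R) (s t : seq R) (a b c x y z u f g r : R).

Lemma ideal0 I : is_ideal I -> I 0. Proof. by case. Qed.

Lemma idealD I x y : is_ideal I -> I x -> I y -> I (x + y).
Proof. by move=> [_ h] Ix Iy; rewrite -[x]mul1r; apply: h. Qed.

Lemma idealMl I a x : is_ideal I -> I x -> I (a * x).
Proof. by move=> [I0 h] Ix; rewrite -[a * x]addr0; apply: h. Qed.

Lemma idealMr I a x : is_ideal I -> I x -> I (x * a).
Proof. by rewrite mulrC; apply: idealMl. Qed.

Lemma idealN I x : is_ideal I -> I x -> I (- x).
Proof. by rewrite -mulN1r; apply: idealMl. Qed.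

Lemma idealB I x y : is_ideal I -> I x -> I y -> I (x - y).
Proof. by move=> hI Ix Iy; apply: idealD => //; apply: idealN. Qed.

Lemma idealDl I x y : is_ideal I -> I x -> I (x + y) -> I y.
Proof. by move=> hI Ix Ixy; rewrite -(addKr x y) addrC; apply: idealB. Qed.

Lemma idealDr I x y : is_ideal I -> I y -> I (x + y) -> I x.
Proof. by rewrite addrC; apply: idealDl. Qed.

Lemma ideal_sum I (T : Type) (l : seq T) (p : pred T) (F : T -> R) :
  is_ideal I -> (forall i, p i -> I (F i)) -> I (\sum_(i <- l | p i) F i).
Proof.
move=> hI hF; elim/big_rec: _ => [|i x pi Ix]; first exact: ideal0.
by apply: idealD => //; exact: hF.
Qed.

Lemma ideal_full I x : is_ideal I -> I 1 -> I x.
Proof. by move=> hI I1; rewrite -[x]mulr1; apply: idealMl. Qed.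

Lemma ideal_setT : is_ideal [set: R]. Proof. by []. Qed.

Lemma ideal_set0 : is_ideal [set 0 : R].
Proof. by split=> // a x y /= -> ->; rewrite mulr0 addr0. Qed.

Lemma prime_ideal P : is_prime P -> is_ideal P. Proof. by case. Qed.

Lemma primeN1 P : is_prime P -> ~ P 1. Proof. by case. Qed.

Lemma primeM P x y : is_prime P -> P (x * y) -> P x \/ P y.
Proof. by case=> _ _; apply. Qed.

Lemma primeMl P x y : is_prime P -> ~ P x -> P (x * y) -> P y.
Proof. by move=> hP nPx /(primeM hP)[]. Qed.

Lemma primeX P x n : is_prime P -> P (x ^+ n) -> P x.
Proof.
move=> hP; elim: n => [|n IHn]; first by rewrite expr0 => /(primeN1 hP).
by rewrite exprS => /(primeM hP)[].
Qed.

Lemma primeNM P x y : is_prime P -> ~ P x -> ~ P y -> ~ P (x * y).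
Proof. by move=> hP nx ny /(primeM hP)[]. Qed.

Lemma primeNX P x n : is_prime P -> ~ P x -> ~ P (x ^+ n).
Proof. by move=> hP nx /(primeX hP). Qed.

(** The ideal [I + (x)], given by its elements and not as a generated ideal, so that each use of
    membership yields a coefficient of [x]. Iterated, it stands for successive quotients of
    [R / I]. *)
Definition addx I x : set R := [set y | exists2 r, I (y - r * x) & True].

Definition adj I s : set R := foldl addx I s.

Lemma addx_ideal I x : is_ideal I -> is_ideal (addx I x).
Proof.
move=> hI; split; first by exists 0; rewrite // mul0r subr0; apply: ideal0.
move=> a u v [r hr _] [r' hr' _]; exists (a * r + r') => //.
have -> : a * u + v - (a * r + r') * x = a * (u - r * x) + (v - r' * x) by ring.
exact: hI.2.
Qed.

Lemma addx_self I x : is_ideal I -> addx I x x.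
Proof. by move=> hI; exists 1; rewrite // mul1r subrr; apply: ideal0. Qed.

Lemma addx_sub I x : is_ideal I -> I `<=` addx I x.
Proof. by move=> hI y Iy; exists 0; rewrite // mul0r subr0. Qed.

Lemma addx_min I J x : is_ideal J -> I `<=` J -> J x -> addx I x `<=` J.
Proof.
move=> hJ IJ Jx y [r hr _]; rewrite -(subrK (r * x) y).
by apply: idealD => //; [exact: IJ | exact: idealMl].
Qed.

Lemma adj_ideal I s : is_ideal I -> is_ideal (adj I s).
Proof. by elim: s I => //= x s IHs I hI; apply/IHs/addx_ideal. Qed.

Lemma adj_sub I s : is_ideal I -> I `<=` adj I s.
Proof.
elim: s I => [|x s IHs] I hI y Iy //=.
by apply: IHs; [exact: addx_ideal | exact: addx_sub].
Qed.

Lemma adj_mem I s x : is_ideal I -> x \in s -> adj I s x.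
Proof.
elim: s I => //= y s IHs I hI; rewrite inE => /orP[/eqP ->|xs].
  by apply: adj_sub; [exact: addx_ideal | exact: addx_self].
by apply: IHs => //; exact: addx_ideal.
Qed.

Lemma adj_min I J s : is_ideal J -> I `<=` J -> (forall x, x \in s -> J x) ->
  adj I s `<=` J.
Proof.
elim: s I => //= x s IHs I hJ IJ sJ; apply: IHs => //.
  by apply: addx_min => //; apply: sJ; rewrite mem_head.
by move=> y ys; apply: sJ; rewrite inE ys orbT.
Qed.

Lemma adj_idl s : idl [set` s] = adj [set 0] s.
Proof.
apply/seteqP; split.
  apply: idl_min; first exact/adj_ideal/ideal_set0.
  by move=> x /= xs; apply: adj_mem => //; exact: ideal_set0.
apply: adj_min; first exact: idl_ideal.
  by move=> _ /= ->; exact: (ideal0 (idl_ideal _)).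
by move=> x xs; apply: idl_sub.
Qed.

Lemma adj_cat I s t : adj I (s ++ t) = adj (adj I s) t.
Proof. exact: foldl_cat. Qed.

Lemma adj_rcons I s x : adj I (rcons s x) = addx (adj I s) x.
Proof. by rewrite -cats1 adj_cat. Qed.

Lemma adj_subset I J s t : is_ideal I -> is_ideal J -> I `<=` J ->
  {subset s <= t} -> adj I s `<=` adj J t.
Proof.
move=> hI hJ IJ st; apply: adj_min; first exact: adj_ideal.
  by move=> x /IJ; exact: adj_sub.
by move=> x /st; exact: adj_mem.
Qed.

Lemma eq_adj I s t : is_ideal I -> s =i t -> adj I s = adj I t.
Proof.
by move=> hI st; apply/seteqP; split; apply: adj_subset => // x; rewrite st.
Qed.

Definition colon I x : set R := [set r | I (r * x)].

Lemma colon_ideal I x : is_ideal I -> is_ideal (colon I x).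
Proof.
move=> hI; split; first by rewrite /colon /= mul0r; exact: ideal0.
by move=> a u v Iu Iv; rewrite /colon /= mulrDl -mulrA; exact: hI.2.
Qed.

Lemma colon_sub I x : is_ideal I -> I `<=` colon I x.
Proof. by move=> hI y Iy; exact: idealMr. Qed.

Lemma setI_ideal I J : is_ideal I -> is_ideal J -> is_ideal (I `&` J).
Proof.
move=> hI hJ; split; first by split; exact: ideal0.
by move=> a x y [Ix Jx] [Iy Jy]; split; [exact: hI.2 | exact: hJ.2].
Qed.

Lemma ideal_mul_ideal I J : is_ideal (ideal_mul I J). Proof. exact: idl_ideal. Qed.

Lemma ideal_mulM I J x y : I x -> J y -> ideal_mul I J (x * y).
Proof. by move=> Ix Jy; apply: idl_sub; exists x => //; exists y. Qed.

Lemma ideal_mul_min I J K : is_ideal K -> (forall x y, I x -> J y -> K (x * y)) ->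
  ideal_mul I J `<=` K.
Proof. by move=> hK h; apply: idl_min => // _ [x Ix [y Jy <-]]; exact: h. Qed.

Lemma ideal_mul_subr I J : is_ideal J -> ideal_mul I J `<=` J.
Proof. by move=> hJ; apply: ideal_mul_min => // x y _; exact: idealMl. Qed.

Lemma ideal_mul_subl I J : is_ideal I -> ideal_mul I J `<=` I.
Proof. by move=> hJ; apply: ideal_mul_min => // x y hx _; exact: idealMr. Qed.

Lemma ideal_pow_ideal I n : is_ideal (ideal_pow I n).
Proof. by case: n => [|n]; [exact: ideal_setT | exact: idl_ideal]. Qed.

Lemma ideal_powM I m n x y :
  ideal_pow I m x -> ideal_pow I n y -> ideal_pow I (m + n) (x * y).
Proof.
move=> + hy; elim: m x => [|m IHm] x.
  by move=> _; apply: idealMl => //; exact: ideal_pow_ideal.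
pose K := colon (ideal_pow I (m.+1 + n)) y.
suff: ideal_pow I m.+1 `<=` K by apply.
apply: ideal_mul_min; first by apply: colon_ideal; exact: ideal_pow_ideal.
by move=> a b Ia hb; rewrite /K /colon /= -mulrA; apply: ideal_mulM => //; exact: IHm.
Qed.

Lemma ideal_pow1 I : is_ideal I -> ideal_pow I 1 = I.
Proof.
move=> hI; apply/seteqP; split; first exact: ideal_mul_subl.
by move=> x Ix; rewrite -[x]mulr1; apply: ideal_mulM.
Qed.

Lemma ideal_powX I n x : I x -> ideal_pow I n (x ^+ n).
Proof.
by move=> Ix; elim: n => [|n IHn] //; rewrite exprS; apply: ideal_mulM.
Qed.

Lemma ideal_pow_le I m n : (m <= n)%N -> ideal_pow I n `<=` ideal_pow I m.
Proof.
move=> mn; rewrite -(subnK mn); elim: (n - m)%N => // k IHk x hx.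
by apply: IHk; apply: ideal_mul_subr hx; exact: ideal_pow_ideal.
Qed.

Lemma ideal_mulS I I' J J' : I `<=` I' -> J `<=` J' ->
  ideal_mul I J `<=` ideal_mul I' J'.
Proof.
move=> hI hJ; apply: ideal_mul_min; first exact: idl_ideal.
by move=> x y /hI Ix /hJ Jy; exact: ideal_mulM.
Qed.

Lemma ideal_powS_sub I J n : I `<=` J -> ideal_pow I n `<=` ideal_pow J n.
Proof. by move=> IJ; elim: n => // n IHn; apply: ideal_mulS. Qed.

Lemma ideal_pow_prime P I n : is_prime P -> ideal_pow I n `<=` P -> I `<=` P.
Proof. by move=> hP h x Ix; apply: (@primeX _ _ n) => //; apply/h/ideal_powX. Qed.

Lemma bigcup_chain_ideal (F : nat -> set R) : (forall i, is_ideal (F i)) ->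
  (forall i, F i `<=` F i.+1) -> is_ideal (\bigcup_i F i).
Proof.
move=> hF FS; have mono i j : (i <= j)%N -> F i `<=` F j.
  by move=> ij; rewrite -(subnK ij); elim: (j - i)%N => // k IHk x /IHk /FS.
split; first by exists 0%N => //; exact: ideal0.
move=> a x y [i _ hx] [j _ hy]; exists (maxn i j) => //; apply: (hF _).2.
  exact: mono (leq_maxl _ _) _ hx.
exact: mono (leq_maxr _ _) _ hy.
Qed.

End IdealBasics.

#[local] Hint Resolve ideal_setT ideal_set0 ideal_pow_ideal ideal_mul_ideal : core.
#[local] Hint Resolve adj_ideal addx_ideal colon_ideal prime_ideal : core.

(** * Noetherian rings *)

Section Noetherian.
Variables (R : comPzRingType) (noethR : noetherian R).
Implicit Types (I J K P Q : set R) (s t : seq R) (a b c x y z u f g r : R).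

Lemma noeth_fg I : is_ideal I -> exists s, I = adj [set 0] s.
Proof. by move=> /noethR[s ->]; exists s; rewrite adj_idl. Qed.

Lemma noeth_chain (F : nat -> set R) : (forall i, is_ideal (F i)) ->
  (forall i, F i `<=` F i.+1) -> exists n, forall k, F (n + k)%N `<=` F n.
Proof.
move=> hF FS; have mono i j : (i <= j)%N -> F i `<=` F j.
  by move=> ij; rewrite -(subnK ij); elim: (j - i)%N => // k IHk x /IHk /FS.
have hU := bigcup_chain_ideal hF FS.
have [s Es] := noeth_fg hU.
have [n hn] : exists n, forall x, x \in s -> F n x.
  have : forall x, x \in s -> exists i, F i x.
    move=> x xs; have : (\bigcup_i F i) x by rewrite Es; apply: adj_mem.
    by case=> i _ ?; exists i.
  elim: {Es} s => [|x s IHs] hs; first by exists 0%N.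
  have [i hi] := hs x (mem_head _ _).
  have [|n hn] := IHs; first by move=> y ys; apply: hs; rewrite inE ys orbT.
  exists (maxn i n) => y; rewrite inE => /orP[/eqP -> |/hn].
    exact: mono (leq_maxl _ _) _ hi.
  exact: mono (leq_maxr _ _) _.
exists n => k x hx.
have : (\bigcup_i F i) x by exists (n + k)%N.
by rewrite Es; apply: adj_min => // y /= ->; exact: ideal0.
Qed.

Lemma noeth_ind (A : set R -> Prop) :
  (forall I, is_ideal I ->
     (forall J, is_ideal J -> I `<=` J -> ~ J `<=` I -> A J) -> A I) ->
  forall I, is_ideal I -> A I.
Proof.
move=> step I hI; apply: contrapT => nA.
pose T := {J : set R | is_ideal J /\ ~ A J}.
have nxt (J : T) : exists J' : T, sval J `<=` sval J' /\ ~ sval J' `<=` sval J.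
  case: J => J [hJ nAJ] /=; apply: contrapT => nex.
  apply: nAJ; apply: step => // J' hJ' JJ' nJ'.
  by apply: contrapT => nAJ'; apply: nex; exists (exist _ J' (conj hJ' nAJ')).
have [F HF] := choice nxt.
pose G n := iter n F (exist _ I (conj hI nA)).
have [n hn] := @noeth_chain (fun n => sval (G n))
   (fun i => (svalP (G i)).1) (fun i => (HF (G i)).1).
by apply: (HF (G n)).2; have := hn 1%N; rewrite addn1.
Qed.

Lemma noeth_max (A : set R -> Prop) I : is_ideal I -> A I ->
  exists J, [/\ is_ideal J, A J, I `<=` J &
    forall K, is_ideal K -> A K -> J `<=` K -> K `<=` J].
Proof.
move=> hI; elim/noeth_ind: I / hI => I hI IH AI.
have [[J [hJ IJ nJI AJ]]|no] := EM (exists J, [/\ is_ideal J, I `<=` J, ~ J `<=` I & A J]).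
  have [K [hK AK JK max]] := IH J hJ IJ nJI AJ; exists K; split=> //.
  exact: subset_trans JK.
exists I; split=> // K hK AK IK; apply: contrapT => nKI.
by apply: no; exists K.
Qed.

Lemma prime_avoiding I (S : set R) : is_ideal I -> S 1 ->
  (forall x y, S x -> S y -> S (x * y)) -> (forall x, I x -> ~ S x) ->
  exists P, [/\ is_prime P, I `<=` P & forall x, P x -> ~ S x].
Proof.
move=> hI S1 SM IS.
have [P [hP PS IP max]] := noeth_max (A := fun J => forall x, J x -> ~ S x) hI IS.
exists P; split=> //; split=> //.
  by move/PS.
have big z : ~ P z -> exists2 s, S s & addx P z s.
  move=> nPz; apply: contrapT => no; apply: nPz.
  apply: (max (addx P z)); [by auto | | exact: addx_sub | exact: addx_self].
  by move=> w hw Sw; apply: no; exists w.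
move=> x y Pxy; apply: contrapT => /not_orP[/big[s Ss [r hr _]] /big[s' Ss' [r' hr' _]]].
apply: (PS (s * s')); last exact: SM.
have -> : s * s' = (s - r * x) * s' + r * x * (s' - r' * y) + r * r' * (x * y) by ring.
by do ?apply: idealD => //; [exact: idealMr | exact: idealMl | exact: idealMl].
Qed.

Definition minover I P := [/\ is_prime P, I `<=` P &
  forall Q, is_prime Q -> I `<=` Q -> Q `<=` P -> P `<=` Q].

Definition iprod (ps : seq (set R)) : set R := foldr (@ideal_mul R) setT ps.

(** By Noetherian induction: if [a * b] is in [I] and neither factor is, then [(I + a)(I + b)] is
    contained in [I], and the lists of the two larger ideals are concatenated. *)
Lemma finite_primes I : is_ideal I -> exists ps : seq (set R),
  (forall P, P \in ps -> is_prime P /\ I `<=` P) /\ iprod ps `<=` I.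
Proof.
move=> hI; elim/noeth_ind: I / hI => I hI IH.
have [I1|nI1] := EM (I 1); first by exists [::]; split=> [P|x _] //; exact: ideal_full.
have [pI|] := EM (is_prime I).
  exists [:: I]; split=> [P|]; first by rewrite inE => /eqP ->.
  exact: (@ideal_mul_subl _ I setT).
move=> nP; have [a [b [Iab nIa nIb]]] : exists a b, [/\ I (a * b), ~ I a & ~ I b].
  apply: contrapT => no; apply: nP; split=> // x y Ixy.
  by apply: contrapT => /not_orP[nx ny]; apply: no; exists x, y.
have grow z : ~ I z -> exists ps : seq (set R),
    (forall P, P \in ps -> is_prime P /\ I `<=` P) /\ iprod ps `<=` addx I z.
  move=> nz; have [||ps [h1 h2]] := IH (addx I z) _ (@addx_sub _ I z hI); auto.
    by apply: contra_not nz; apply; exact: addx_self.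
  exists ps; split=> // P /h1[pP sub]; split=> //; apply: subset_trans sub.
  exact: addx_sub.
have [ps [h1 h2]] := grow a nIa; have [qs [k1 k2]] := grow b nIb.
exists (ps ++ qs); split=> [P|]; first by rewrite mem_cat => /orP[/h1|/k1].
suff sub : iprod (ps ++ qs) `<=` ideal_mul (iprod ps) (iprod qs).
  apply: subset_trans sub _; apply: ideal_mul_min => // x y /h2[r hr _] /k2[r' hr' _].
  have -> : x * y = (x - r * a) * y + r * a * (y - r' * b) + r * r' * (a * b) by ring.
  by do ?apply: idealD => //; [exact: idealMr | exact: idealMl | exact: idealMl].
elim: ps {h1 h2} => [|P ps IHps] /=.
  by move=> x hx; rewrite -[x]mul1r; exact: ideal_mulM.
apply: ideal_mul_min => // x y Px /IHps hy.
have : colon (ideal_mul (ideal_mul P (iprod ps)) (iprod qs)) x y; last by rewrite /colon /= mulrC.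
apply: ideal_mul_min hy; auto => u v hu hv; rewrite /colon /= mulrC mulrA.
by apply: ideal_mulM => //; exact: ideal_mulM.
Qed.

Lemma iprod_prime ps P : is_prime P -> iprod ps `<=` P ->
  exists2 Q, Q \in ps & Q `<=` P.
Proof.
move=> hP; elim: ps => [|Q ps IHps] /= h; first by case: (primeN1 hP); exact: h.
have [QP|/nonsubset[q [Qq nPq]]] := EM (Q `<=` P); first by exists Q; rewrite ?mem_head.
have [|Q' Q'ps Q'P] := IHps; last by exists Q'; rewrite // inE Q'ps orbT.
by move=> x hx; apply: (@primeMl _ _ q) => //; apply: h; exact: ideal_mulM.
Qed.

(** The descent through smaller and smaller primes stops because it is measured in the finite list
    of [finite_primes]: each new prime contains fewer members of that list. *)
Lemma minover_exists I Q : is_ideal I -> is_prime Q -> I `<=` Q ->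
  exists2 P, minover I P & P `<=` Q.
Proof.
move=> hI; have [ps [h1 h2]] := finite_primes hI.
have [n] := ubnP (count (fun P => `[< P `<=` Q >]) ps).
elim: n Q => // n IHn Q cQ pQ IQ.
have [P Pps PQ] := iprod_prime pQ (subset_trans h2 IQ).
have [pP IP] := h1 _ Pps.
have [min|nmin] := EM (minover I P); first by exists P.
have [Q' [pQ' IQ' Q'P nPQ']] :
    exists Q', [/\ is_prime Q', I `<=` Q', Q' `<=` P & ~ P `<=` Q'].
  apply: contrapT => no; apply: nmin; split=> // Q' p1 p2 p3.
  by apply: contrapT => p4; apply: no; exists Q'.
have [|P' mP' P'Q'] := IHn Q' _ pQ' IQ'; last first.
  by exists P' => //; apply: subset_trans PQ; apply: subset_trans Q'P.
rewrite -ltnS; apply: leq_trans cQ; rewrite ltnS.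
rewrite [X in (X < _)%N](permP (perm_to_rem Pps)) [X in (_ < X)%N](permP (perm_to_rem Pps)) /=.
rewrite asboolF // asboolT // add0n add1n ltnS; apply: sub_count => X /asboolP hX.
by apply/asboolP; apply: subset_trans PQ; apply: subset_trans Q'P.
Qed.

Lemma finite_minover I : is_ideal I -> exists ps : seq (set R),
  (forall P, P \in ps -> is_prime P /\ I `<=` P) /\
  (forall P, minover I P -> P \in ps).
Proof.
move=> /[dup] hI /finite_primes[ps [h1 h2]]; exists ps; split=> // P [pP IP mP].
have [Q Qps QP] := iprod_prime pP (subset_trans h2 IP).
have [pQ IQ] := h1 _ Qps; suff -> : P = Q by [].
by apply/seteqP; split=> //; exact: mP.
Qed.

(** In a product of primes contained in [I], a factor inside [P] equals [P] by minimality, and any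
    other factor has an element outside [P]; these elements multiply to [c]. Thus [I] contains a
    power of [P] after localization at [P]. *)
Lemma minover_pow I P : is_ideal I -> minover I P ->
  exists c n, ~ P c /\ forall x, ideal_pow P n x -> I (c * x).
Proof.
move=> hI [pP IP mP]; have [ps [h1 h2]] := finite_primes hI.
suff [s [n [nPs h]]] : exists c n, ~ P c /\ forall x, ideal_pow P n x -> iprod ps (c * x).
  by exists s, n; split=> // x /h /h2.
elim: ps h1 {h2} => [|Q ps IHps] h1; first by exists 1, 0%N; split=> //; exact: primeN1.
have [|s [n [nPs h]]] := IHps; first by move=> X Xps; apply: h1; rewrite inE Xps orbT.
have [pQ IQ] := h1 Q (mem_head _ _).
have [QP|/nonsubset[q [Qq nPq]]] := EM (Q `<=` P).
  exists s, n.+1; split=> // x.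
  suff : ideal_pow P n.+1 `<=` colon (ideal_mul Q (iprod ps)) s.
    by move=> /[apply]; rewrite /colon /= mulrC.
  apply: ideal_mul_min; first by auto.
  move=> u v Pu hv; rewrite /colon /= -mulrA; apply: ideal_mulM; first exact: mP Pu.
  by rewrite mulrC; exact: h.
exists (q * s), n; split; first exact: primeNM.
by move=> x hx; rewrite -mulrA; apply: ideal_mulM => //; exact: h.
Qed.

(** One member [I] of the cover is arbitrary; [reg_prime] takes [a + n ^ 2] for it. In an
    irredundant cover some [x0] lies in [P] alone. Adding to it an element of [J], of [I] and of all
    the other primes, but not of [P], gives an element of [J] that is not covered. *)
Lemma prime_cover J I (ps : seq (set R)) : is_ideal J -> is_ideal I ->
  (forall P, P \in ps -> is_prime P) ->
  (forall x, J x -> I x \/ exists2 P, P \in ps & P x) ->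
  J `<=` I \/ exists2 P, P \in ps & J `<=` P.
Proof.
move=> hJ; have [n] := ubnP (size ps).
elim: n ps I => // n IHn [|P ps] I; first by move=> _ hI _ h; left => x /h[|[]].
rewrite /= ltnS => sz hI hps cov.
have pP : is_prime P by apply: hps; rewrite mem_head.
have hps' Q : Q \in ps -> is_prime Q by move=> Qps; apply: hps; rewrite inE Qps orbT.
have [cov'|] := EM (forall x, J x -> I x \/ exists2 P, P \in ps & P x).
  have [|[Q Qps JQ]] := IHn ps I sz hI hps' cov'; first by left.
  by right; exists Q; rewrite // inE Qps orbT.
move=> /existsNP[x0 /not_implyP[Jx0 /not_orP[nIx0 nps]]].
have [JP|/nonsubset[j [Jj nPj]]] := EM (J `<=` P); first by right; exists P; rewrite ?mem_head.
have [IP|/nonsubset[i [Ii nPi]]] := EM (I `<=` P).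
  have [||JP'|[Q Qps JQ]] := IHn ps P sz _ hps'; first by auto.
  - move=> x /cov[/IP|[Q]]; first by left.
    by rewrite inE => /orP[/eqP -> |Qps Qx]; [left | right; exists Q].
  - by right; exists P; rewrite ?mem_head.
  - by right; exists Q; rewrite // inE Qps orbT.
have [[Q Qps QP]|nsub] := EM (exists2 Q, Q \in ps & Q `<=` P).
  have [|||JI|[Q' Q'ps JQ']] := IHn (P :: rem Q ps) I _ hI.
  - by rewrite /= size_rem //; case: (ps) Qps sz.
  - move=> X; rewrite inE => /orP[/eqP -> //|/mem_rem]; exact: hps'.
  - move=> x /cov[Ix|[X + Xx]]; first by left.
    rewrite inE => /orP[/eqP XP|Xps].
      by right; exists P; rewrite ?mem_head // -XP.
    have := Xps; rewrite (perm_mem (perm_to_rem Qps)) inE => /orP[/eqP XQ|Xr].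
      by right; exists P; rewrite ?mem_head //; apply: QP; rewrite -XQ.
    by right; exists X; rewrite // inE Xr orbT.
  - by left.
  - right; exists Q' => //; move: Q'ps; rewrite !inE => /orP[->//|/mem_rem ->].
    by rewrite orbT.
have [q [qps nPq]] : exists q, (forall Q, Q \in ps -> Q q) /\ ~ P q.
  elim: (ps) hps' nsub => [|Q qs IHqs] hqs nsub; first by exists 1; split=> //; exact: primeN1.
  have [||q [h1 h2]] := IHqs.
  - by move=> X Xqs; apply: hqs; rewrite inE Xqs orbT.
  - by move=> [X Xqs XP]; apply: nsub; exists X; rewrite // inE Xqs orbT.
  have [QP|/nonsubset[w [Qw nPw]]] := EM (Q `<=` P).
    by case: nsub; exists Q; rewrite ?mem_head.
  exists (w * q); split; last exact: primeNM.
  move=> X; rewrite inE => /orP[/eqP ->|Xqs].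
    by apply: idealMr => //; apply: prime_ideal; apply: hqs; rewrite mem_head.
  by apply: idealMl; [apply: prime_ideal; apply: hqs; rewrite inE Xqs orbT | exact: h1].
exfalso; pose y := j * (i * q).
have nPy : ~ P y by do 2!apply: primeNM => //.
have Jxy : J (x0 + y) by apply: idealD => //; apply: idealMr.
have nI : ~ I (x0 + y).
  move=> h; apply: nIx0; apply: idealDr h => //.
  by apply: idealMl => //; exact: idealMr.
have nQ Q : Q \in ps -> ~ Q (x0 + y).
  move=> Qps h; apply: nps; exists Q => //; have hQ := prime_ideal (hps' _ Qps).
  by apply: idealDr h => //; do 2!apply: idealMl => //; exact: qps.
have Px0 : P x0.
  case: (cov _ Jx0) => // -[Q]; rewrite inE => /orP[/eqP -> //|Qps Qx].
  by case: nps; exists Q.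
case: (cov _ Jxy) => // -[Q]; rewrite inE => /orP[/eqP -> h|Qps]; last exact: nQ.
by apply: nPy; apply: idealDl h => //; auto.
Qed.

Lemma prime_avoid J I (ps : seq (set R)) : is_ideal J -> is_ideal I ->
  ~ J `<=` I -> (forall P, P \in ps -> is_prime P /\ ~ J `<=` P) ->
  exists x, [/\ J x, ~ I x & forall P, P \in ps -> ~ P x].
Proof.
move=> hJ hI nJI hps; apply: contrapT => no.
have [|||[P Pps JP]] := @prime_cover J I ps hJ hI; last 2 first.
- by [].
- by case: (hps _ Pps).2.
  by move=> P /hps[].
move=> x Jx; apply: contrapT => /not_orP[nIx nps]; apply: no; exists x; split=> //.
by move=> P Pps Px; apply: nps; exists P.
Qed.

Lemma prime_avoid0 J (ps : seq (set R)) : is_ideal J ->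
  (forall P, P \in ps -> is_prime P /\ ~ J `<=` P) ->
  exists x, J x /\ forall P, P \in ps -> ~ P x.
Proof.
move=> hJ; case: ps => [|P ps] hps; first by exists 0; split=> //; exact: ideal0.
have [pP nP] := hps P (mem_head _ _).
have [||x [Jx nPx h]] := @prime_avoid J P ps hJ _ nP; first by auto.
  by move=> Q Qps; apply: hps; rewrite inE Qps orbT.
by exists x; split=> // Q; rewrite inE => /orP[/eqP ->|/h].
Qed.

End Noetherian.

(** * Sums of ideals, saturation at a prime, local rings *)

Section IdealSums.
Variable R : comPzRingType.
Implicit Types (I J K P Q : set R) (s t w : seq R) (a b c x y z u f g r : R).

Definition isum I J : set R := [set x | exists2 j, I j & J (x - j)].

Lemma isum_ideal I J : is_ideal I -> is_ideal J -> is_ideal (isum I J).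
Proof.
move=> hI hJ; split; first by exists 0; rewrite ?subr0; exact: ideal0.
move=> a x y [j Ij Jj] [j' Ij' Jj']; exists (a * j + j'); first exact: hI.2.
have -> : a * x + y - (a * j + j') = a * (x - j) + (y - j') by ring.
exact: hJ.2.
Qed.

Lemma isum_l I J : is_ideal J -> I `<=` isum I J.
Proof. by move=> hJ x Ix; exists x; rewrite // subrr; exact: ideal0. Qed.

Lemma isum_r I J : is_ideal I -> J `<=` isum I J.
Proof. by move=> hJ x Ix; exists 0; rewrite ?subr0 //; exact: ideal0. Qed.

Lemma isum_min I J K : is_ideal K -> I `<=` K -> J `<=` K -> isum I J `<=` K.
Proof.
move=> hK IK JK x [j /IK Kj /JK Kxj].
by rewrite -(subrK j x); apply: idealD.
Qed.

Lemma isumS I I' J J' : I `<=` I' -> J `<=` J' -> isum I J `<=` isum I' J'.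
Proof. by move=> hI hJ x [j /hI ? /hJ ?]; exists j. Qed.

Lemma adj_addx I s x : is_ideal I -> adj (addx I x) s = addx (adj I s) x.
Proof. by move=> hI; rewrite -adj_rcons -(@eq_adj _ I (x :: s)) // => y; rewrite mem_rcons. Qed.

(* The contraction to [R] of the extension of [I] to the localization at [P]. *)
Definition satc P I : set R := [set f | exists2 c, ~ P c & I (c * f)].

Lemma satc_ideal P I : is_prime P -> is_ideal I -> is_ideal (satc P I).
Proof.
move=> hP hI; split; first by exists 1; [exact: primeN1 | rewrite mulr0; exact: ideal0].
move=> a x y [c nc hc] [d nd hd]; exists (c * d); first exact: primeNM.
have -> : c * d * (a * x + y) = d * a * (c * x) + c * (d * y) by ring.
by apply: idealD => //; exact: idealMl.
Qed.

Lemma satc_sub P I : is_prime P -> I `<=` satc P I.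
Proof. by move=> hP x Ix; exists 1; [exact: primeN1 | rewrite mul1r]. Qed.

Lemma satcK P I c f : is_prime P -> ~ P c -> satc P I (c * f) -> satc P I f.
Proof.
by move=> hP nc [d nd h]; exists (d * c); [exact: primeNM | rewrite -mulrA].
Qed.

Lemma satcS P I J : I `<=` J -> satc P I `<=` satc P J.
Proof. by move=> IJ x [c nc hc]; exists c => //; exact: IJ. Qed.

Lemma common_denominator P I s : is_prime P -> is_ideal I ->
  (forall x, x \in s -> satc P I x) ->
  exists2 c, ~ P c & forall x, adj [set 0] s x -> I (c * x).
Proof.
move=> hP hI; suff h : (forall x, x \in s -> satc P I x) ->
    exists2 c, ~ P c & forall x, x \in s -> I (c * x).
  move=> /h[c nc hc]; exists c => // x.
  have : adj [set 0] s `<=` colon I c.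
    apply: adj_min; [by auto | move=> _ /= ->; exact: ideal0 (colon_ideal _ hI) |].
    by move=> y /hc; rewrite /colon /= mulrC.
  by move=> /[apply]; rewrite /colon /= mulrC.
elim: s => [|x s IHs] hs; first by exists 1; [exact: primeN1 |].
have [|c nc hc] := IHs; first by move=> y ys; apply: hs; rewrite inE ys orbT.
have [d nd hd] := hs x (mem_head _ _).
exists (c * d); first exact: primeNM.
move=> y; rewrite inE => /orP[/eqP -> |/hc h].
  by rewrite -mulrA; exact: idealMl.
by rewrite mulrAC; exact: idealMr.
Qed.

Definition loc (n : set R) :=
  [/\ is_ideal n, ~ n 1 & forall x, ~ n x -> exists y, x * y = 1].

Lemma loc_sub n I : loc n -> is_ideal I -> ~ I 1 -> I `<=` n.
Proof.
move=> [_ _ h] hI nI1 x Ix; apply: contrapT => /h[y xy].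
by apply: nI1; rewrite -xy; exact: idealMr.
Qed.

Lemma loc_prime n : loc n -> is_prime n.
Proof.
move=> [hn n1 h]; split=> // x y nxy.
have [nx|/h[u xu]] := EM (n x); [by left | right].
by rewrite -[y]mul1r -xu mulrAC; exact: idealMr.
Qed.

Lemma prime_sub_loc n P : loc n -> is_prime P -> P `<=` n.
Proof. by move=> hn hP; apply: loc_sub hn _ _ => //; [auto | exact: primeN1]. Qed.

Lemma loc_sat n I c f : loc n -> is_ideal I -> ~ n c -> I (c * f) -> I f.
Proof.
move=> [_ _ h] hI /h[d cd] hc; rewrite -[f]mul1r -cd mulrAC.
exact: idealMr.
Qed.

End IdealSums.

#[local] Hint Resolve isum_ideal satc_ideal loc_prime : core.

(** * Nakayama's lemma and Krull's intersection theorem *)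

Section Nakayama.
Variables (R : comPzRingType) (noethR : noetherian R).
Implicit Types (I J K N P Q : set R) (s t w : seq R) (a b c x y z u f g r : R).

Lemma ideal_mul_cons P x t z : is_ideal P ->
  ideal_mul P (adj [set 0] (x :: t)) z ->
  exists2 p, P p & ideal_mul P (adj [set 0] t) (z - p * x).
Proof.
move=> hP; pose K := [set z | exists2 p, P p & ideal_mul P (adj [set 0] t) (z - p * x)].
suff : ideal_mul P (adj [set 0] (x :: t)) `<=` K by apply.
apply: ideal_mul_min.
  split; first by exists 0; rewrite ?mul0r ?subr0; apply: ideal0; auto.
  move=> a u v [p Pp hp] [q Pq hq]; exists (a * p + q); first exact: hP.2.
  have -> : a * u + v - (a * p + q) * x = a * (u - p * x) + (v - q * x) by ring.
  exact: (ideal_mul_ideal _ _).2.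
move=> p y Pp; rewrite /= adj_addx // => -[r hr _].
exists (p * r); first exact: idealMr.
have -> : p * y - p * r * x = p * (y - r * x) by ring.
exact: ideal_mulM.
Qed.

(** Gaussian elimination in place of determinants. The relation for [x] has the coefficient [c - p],
    still outside [P]; multiplying the other relations by it allows one to substitute for [x] in
    them. *)
Lemma nakayama_seq P J t c : is_prime P -> is_ideal J -> ~ P c ->
  (forall x, x \in t -> exists2 j, J j & ideal_mul P (adj [set 0] t) (c * x - j)) ->
  exists2 d, ~ P d & forall x, x \in t -> J (d * x).
Proof.
move=> hP hJ; elim: t c => [|x t IHt] c nc h; first by exists 1; [exact: primeN1|].
have hI : is_ideal P by auto.
have [j Jj /(ideal_mul_cons hI)[p Pp hp]] := h x (mem_head _ _).
have ncp : ~ P (c - p) by move=> h'; apply: nc; rewrite -(subrK p c); exact: idealD.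
have hp' : adj [set 0] t ((c - p) * x - j).
  have -> : (c - p) * x - j = c * x - j - p * x by ring.
  by apply: ideal_mul_subr hp; auto.
have [|y yt|d nd hd] := IHt ((c - p) * c); first exact: primeNM.
  have [|j' Jj' /(ideal_mul_cons hI)[q Pq hq]] := h y; first by rewrite inE yt orbT.
  exists ((c - p) * j' + q * j).
    by apply: idealD => //; exact: idealMl.
  have -> : (c - p) * c * y - ((c - p) * j' + q * j) =
    (c - p) * (c * y - j' - q * x) + q * ((c - p) * x - j) by ring.
  have hm := ideal_mul_ideal P (adj [set 0] t).
  by apply: (idealD hm); [exact: (idealMl _ hm) | exact: ideal_mulM].
exists (d * (c - p)); first exact: primeNM.
move=> y; rewrite inE => /orP[/eqP ->|yt].
  have -> : d * (c - p) * x = d * ((c - p) * x - j) + d * j by ring.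
  apply: idealD => //; last exact: idealMl.
  have : adj [set 0] t `<=` colon J d.
    apply: adj_min; [by auto | move=> _ /= ->; exact: ideal0 (colon_ideal _ hJ) |].
    by move=> v /hd; rewrite /colon /= mulrC.
  by move=> /(_ _ hp'); rewrite /colon /= mulrC.
by rewrite mulrAC; apply: idealMr => //; exact: hd.
Qed.

(* Nakayama's lemma for [N] modulo [J], localized at [P]. *)
Lemma nakayama_at P J N : is_prime P -> is_ideal J -> is_ideal N ->
  N `<=` satc P (isum J (ideal_mul P N)) ->
  exists2 c, ~ P c & forall x, N x -> J (c * x).
Proof.
move=> hP hJ hN; have [t Et] := noeth_fg noethR hN => sub.
have [c nc hc] : exists2 c, ~ P c & forall x, adj [set 0] t x ->
    isum J (ideal_mul P N) (c * x).
  apply: common_denominator => //; first by auto.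
  by move=> x xt; apply: sub; rewrite Et; apply: adj_mem.
have [x xt|d nd hd] := @nakayama_seq P J t c hP hJ nc.
  by have [|j] := hc x; [apply: adj_mem | exists j; rewrite -?Et].
have [|e ne he] := @common_denominator _ P J t hP hJ.
  by move=> x xt; exists d => //; exact: hd.
by exists e => // x; rewrite Et; exact: he.
Qed.

Lemma nakayama n J N : loc n -> is_ideal J -> is_ideal N ->
  N `<=` isum J (ideal_mul n N) -> N `<=` J.
Proof.
move=> hn hJ hN sub.
have [||c nc hc x /hc] := @nakayama_at n J N _ hJ hN; first by auto.
  by apply: subset_trans sub _; apply: satc_sub; auto.
exact: (loc_sat hn).
Qed.

(** Let [L] be maximal among the ideals that contain [D = J + n N] and meet [N] inside [D]. Every
    element of [n] has a power in [L], because the colons of [L] by its powers become stationary.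
    Hence some [n ^ k] lies in [L], so that [N] lies in [J + L] and therefore in [D], and Nakayama's
    lemma applies. This avoids the Artin-Rees lemma. *)
Lemma krull_intersection n J f : loc n -> is_ideal J ->
  (forall k, isum J (ideal_pow n k) f) -> J f.
Proof.
move=> hn hJ; have hn' : is_ideal n by case: hn.
pose N := [set f | forall k, isum J (ideal_pow n k) f].
have hN : is_ideal N.
  split=> [k|a x y hx hy k]; first by apply: ideal0; auto.
  by apply: (isum_ideal hJ (ideal_pow_ideal n k)).2; [exact: hx | exact: hy].
have JN : J `<=` N by move=> x Jx k; apply: isum_l.
suff: N `<=` J by apply.
apply: (nakayama hn hJ hN); set D := isum J (ideal_mul n N).
have hD : is_ideal D by rewrite /D; auto.
have [L [hL LD DL max]] := noeth_max noethR (A := fun L => L `&` N `<=` D) hD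
  (fun x (h : (D `&` N) x) => h.1).
have pow x : n x -> exists k, L (x ^+ k).
  move=> nx; have [||k hk] := @noeth_chain _ noethR (fun k => colon L (x ^+ k)).
  - by auto.
  - by move=> k r; rewrite /colon /= exprS mulrCA; exact: idealMl.
  exists k; apply: (max (addx L (x ^+ k))); [by auto | | exact: addx_sub | exact: addx_self].
  move=> y [[r hr _] Ny]; apply: LD; split=> //.
  rewrite -(subrK (r * x ^+ k) y); apply: idealD => //.
  apply: (hk 1%N); rewrite /colon /= addn1 exprSr mulrA.
  have -> : r * x ^+ k * x = x * y - x * (y - r * x ^+ k) by ring.
  apply: idealB => //; last exact: idealMl.
  by apply: DL; apply: isum_r => //; exact: ideal_mulM.
have [k nkL] : exists k, ideal_pow n k `<=` L.
  have [L1|nL1] := EM (L 1); first by exists 0%N => x _; exact: ideal_full.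
  have [|c [k [nc hc]]] := @minover_pow _ noethR L n hL.
    split; [by auto | exact: (loc_sub hn hL nL1) |].
    by move=> Q hQ LQ _ x /pow[k /LQ]; exact: primeX.
  by exists k => x /hc; exact: (loc_sat hn).
move=> x /[dup] Nx /(_ k)[j Jj /nkL Lxj]; apply: LD; split=> //.
by rewrite -(subrK j x); apply: idealD => //; apply: DL; exact: isum_l.
Qed.

End Nakayama.

(** * Chains of primes and systems of parameters *)

Section Chains.
Variable R : comPzRingType.
Implicit Types (I J K N P Q a b p q : set R) (s t w z : seq R) (x y f g : R).

(** The height of [P / a] is at least [l]. For the maximal ideal [P] of a local ring this reads: the
    dimension of the quotient by [a] is at least [l]. *)
Definition dimge a P l := exists c, [/\ prime_chain l c, c l = P & a `<=` c 0%N].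

Lemma dimge0 a P : is_prime P -> a `<=` P -> dimge a P 0.
Proof. by move=> hP aP; exists (fun=> P); split=> //; split. Qed.

Lemma dimge_sub a b P l : a `<=` b -> dimge b P l -> dimge a P l.
Proof. by move=> ab [c [h1 h2 h3]]; exists c; split=> //; apply: subset_trans h3. Qed.

Lemma chain_mono l (c : nat -> set R) i j : prime_chain l c ->
  (i <= j <= l)%N -> c i `<=` c j.
Proof.
move=> [_ hc] /andP[ij jl]; elim: j ij jl => [|j IHj] ij jl.
  by rewrite (eqP (_ : i == 0%N)) // -leqn0.
have [->//|] := eqVneq i j.+1; move=> nij.
have h : (i <= j)%N by rewrite -ltnS ltn_neqAle nij.
by apply: subset_trans (IHj h (ltnW jl)) _; exact: (hc j jl).1.
Qed.

Lemma dimge_prime a P l : dimge a P l -> is_prime P.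
Proof. by move=> [c [[h _] <- _]]; apply: h. Qed.

Lemma dimge_subset a P l : dimge a P l -> a `<=` P.
Proof.
by move=> [c [h <- h3]]; apply: subset_trans h3 _; apply: chain_mono h _; rewrite leqnn.
Qed.

Lemma dimge_le a P l k : (k <= l)%N -> dimge a P l -> dimge a P k.
Proof.
move=> kl [c [hc cl ac]]; exists (fun i => c (i + (l - k))%N); split.
- split=> i ik; first by apply: hc.1; lia.
  by rewrite addSn; apply: hc.2; lia.
- by rewrite subnKC.
- by apply: subset_trans ac _; apply: chain_mono hc _; lia.
Qed.

Lemma dimge_rcons a P Q l : is_prime Q -> P `<=` Q -> ~ Q `<=` P ->
  dimge a P l -> dimge a Q l.+1.
Proof.
move=> hQ PQ nQP [c [hc cl ac]]; exists (fun i => if (i <= l)%N then c i else Q).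
split=> //; last by rewrite ltnn.
split=> i il; first by case: ifP => // il'; exact: hc.1.
rewrite -ltnS il; case: ifP => il'; first exact: hc.2.
have -> : i = l by lia.
by rewrite cl.
Qed.

Lemma dimge_up a P Q l : is_prime Q -> P `<=` Q -> dimge a P l -> dimge a Q l.
Proof.
move=> hQ PQ d; have [QP|nQP] := EM (Q `<=` P); first by have -> : Q = P by apply/seteqP.
by apply: (@dimge_le _ _ l.+1) => //; exact: dimge_rcons d.
Qed.

Lemma dimgeS a P l : dimge a P l.+1 ->
  exists Q, [/\ dimge a Q l, Q `<=` P & ~ P `<=` Q].
Proof.
move=> [c [hc cl ac]]; have [h1 h2] := hc.2 l (leqnn _).
exists (c l); split; last 2 first; rewrite -?cl //.
exists c; split=> //; split=> i il; first by apply: hc.1; apply: leqW.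
by apply: hc.2; apply: ltnW.
Qed.

Lemma dimge_trans a b P k l :
  (forall q, is_prime q -> b `<=` q -> q `<=` P -> dimge a q k) ->
  dimge b P l -> dimge a P (k + l).
Proof.
move=> h; elim: l P h => [|l IHl] P h d.
  by rewrite addn0; apply: h => //; [exact: dimge_prime d | exact: dimge_subset d].
have [Q [dQ QP nPQ]] := dimgeS d.
rewrite addnS; apply: (dimge_rcons _ QP nPQ); first exact: dimge_prime d.
by apply: IHl => // q hq bq qQ; apply: h => //; apply: subset_trans QP.
Qed.

Lemma dimge_cons a b P l :
  (forall q, is_prime q -> b `<=` q -> q `<=` P ->
     exists p, [/\ is_prime p, a `<=` p, p `<=` q & ~ q `<=` p]) ->
  dimge b P l -> dimge a P l.+1.
Proof.
move=> h d; rewrite -add1n; apply: dimge_trans d => q hq bq qP.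
have [p [hp ap pq nqp]] := h q hq bq qP.
by apply: dimge_rcons pq nqp _ => //; exact: dimge0.
Qed.

End Chains.

(** * Krull's height theorem and systems of parameters *)

Section Height.
Variables (R : comPzRingType) (noethR : noetherian R).
Implicit Types (I J K N P Q a b p q : set R) (s t w z : seq R) (x y f g : R).

(* [R / c] localized at the minimal prime [P] of [c] is Artinian. *)
Lemma dcc_at P c : is_ideal c -> minover c P -> forall F : nat -> set R,
  (forall i, [/\ is_ideal (F i), satc P (F i) `<=` F i, c `<=` F i & F i.+1 `<=` F i]) ->
  exists n, forall k, F n `<=` F (n + k)%N.
Proof.
move=> hc mP F hF; have [hP cP mP'] := mP.
suff key J : is_ideal J -> satc P J `<=` J -> c `<=` J ->
    forall F : nat -> set R,
    (forall i, [/\ is_ideal (F i), satc P (F i) `<=` F i, J `<=` F i & F i.+1 `<=` F i]) ->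
    exists n, forall k, F n `<=` F (n + k)%N.
  apply: (key (satc P c)); [by auto | | exact: satc_sub | ].
    move=> x [d nd [e ne h]]; exists (e * d); last by rewrite -mulrA.
    exact: primeNM.
  move=> i; have [h1 h2 h3 h4] := hF i; split=> //.
  exact: subset_trans (satcS h3) h2.
move=> hJ; elim/noeth_ind: J / hJ {F hF}; first exact: noethR.
move=> J hJ IH sJ cJ F hF.
have mono n k : F (n + k)%N `<=` F n.
  elim: k => [|k IHk]; first by rewrite addn0.
  by rewrite addnS; apply: subset_trans IHk; have [] := hF (n + k)%N.
have [J1|nJ1] := EM (J 1).
  exists 0%N => k x _; have [h1 _ h3 _] := hF (0 + k)%N.
  by apply: ideal_full h1 _; exact: h3.
have JP : J `<=` P.
  move=> x Jx; apply: contrapT => nPx; apply: nJ1; apply: sJ.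
  by exists x; rewrite ?mulr1.
have [u [nJu Pu]] : exists u, ~ J u /\ forall v, P v -> J (v * u).
  have [|d [m [nd hd]]] := minover_pow noethR hJ (P := P).
    by split=> // Q hQ JQ; apply: mP' => //; exact: subset_trans JQ.
  have : ideal_pow P m `<=` J by move=> x /hd h; apply: sJ; exists d.
  elim: m {hd} => [|m IHm] hm; first by case: nJ1; exact: hm.
  have [/IHm//|/nonsubset[u [hu nJu]]] := EM (ideal_pow P m `<=` J).
  by exists u; split=> // v Pv; apply: hm; exact: ideal_mulM.
pose sat1 I := satc P (addx I u).
have sat_ideal I : is_ideal I -> is_ideal (sat1 I) by move=> hI; apply: satc_ideal; auto.
have sat_sat I : satc P (sat1 I) `<=` sat1 I.
  move=> x [d nd [e ne h]]; exists (e * d); last by rewrite -mulrA.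
  exact: primeNM.
have sat_sub I : is_ideal I -> I `<=` sat1 I.
  move=> hI; apply: (@subset_trans _ (addx I u)); first exact: addx_sub.
  exact: satc_sub.
have sat_u I : is_ideal I -> sat1 I u.
  by move=> hI; apply: satc_sub => //; exact: addx_self.
have satS I K : is_ideal K -> I `<=` K -> sat1 I `<=` sat1 K.
  move=> hK IK; apply: satcS; apply: addx_min; [by auto | | exact: addx_self].
  by apply: subset_trans IK _; exact: addx_sub.
have IH' := IH (sat1 J) (sat_ideal _ hJ) (sat_sub _ hJ) (fun h => nJu (h _ (sat_u _ hJ)))
  (sat_sat J) (subset_trans cJ (sat_sub _ hJ)).
have [allu|/existsNP[n1 nu]] := EM (forall i, F i u).
  apply: IH' => i; have [h1 h2 h3 h4] := hF i; split=> //.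
  by apply: subset_trans h2; apply: satcS; apply: addx_min.
have [|n2 hn2] := IH' (fun i => sat1 (F i)).
  move=> i; have [h1 h2 h3 h4] := hF i; split; [by auto | exact: sat_sat | |].
    exact: satS.
  by have [h1' _ _ _] := hF i.+1; apply: satS.
exists (n1 + n2)%N => k f Ff; have [h1 h2 h3 h4] := hF (n1 + n2 + k)%N.
have [k1 k2 k3 k4] := hF (n1 + n2)%N.
have [d nd [r hr _]] : sat1 (F (n1 + n2 + k)%N) f.
  rewrite [(n1 + n2)%N]addnC -addnA; apply: hn2.
  by apply: (satS (F (n1 + n2)%N)); [have [] := hF n2| rewrite addnC; exact: mono | exact: sat_sub].
have ru : F (n1 + n2)%N (r * u).
  rewrite -(subKr (d * f) (r * u)); apply: idealB => //; first exact: idealMl.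
  exact: mono hr.
have Pr : P r.
  apply: contrapT => nPr; apply: nu; apply: (mono n1 n2); apply: k2.
  by exists r.
apply: h2; exists d => //; rewrite -(subrK (r * u) (d * f)); apply: idealD => //.
by apply: h3; exact: Pu.
Qed.

(** [S k] is the [k]-th symbolic power of [q] modulo [q0]. Since [a + x] is Artinian at [P], the
    sums [S k + (x)] become stationary there. As [x] is not in [q], this gives [S n] inside
    [S n.+1 + x S n], and Nakayama's lemma at [P] gives [S n = S n.+1]. A second use of Nakayama, at
    [q], forces [q ^ n] into [q0]. *)
Lemma krull_pit a x P : is_ideal a -> minover (addx a x) P -> ~ dimge a P 2.
Proof.
move=> ha mP [c [[hc cS] cP ac]]; rewrite -cP in mP => {P cP}.
have [q0q nqq0] := cS 0%N isT; have [qP nPq] := cS 1%N isT.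
have hq0 : is_prime (c 0%N) by apply: hc. have hq : is_prime (c 1%N) by apply: hc.
set q0 := c 0%N in hq0 q0q nqq0 ac *; set q := c 1%N in hq q0q nqq0 qP nPq.
set P := c 2 in mP qP nPq; have [hP aP mP'] := mP.
have nqx : ~ q x.
  move=> qx; apply: nPq; apply: mP' => //; apply: addx_min => //; first by auto.
  exact: subset_trans ac q0q.
pose S k := satc q (isum q0 (ideal_pow q k)).
have hS k : is_ideal (S k) by apply: satc_ideal; auto.
have satS k : satc q (S k) `<=` S k.
  move=> f [d nd [e ne h]]; exists (e * d); last by rewrite -mulrA.
  exact: primeNM.
have aS k : a `<=` S k.
  move=> f /ac af; apply: satc_sub => //; exact: isum_l.
have [n hn] : exists n, forall k, satc P (addx (S n) x) `<=` satc P (addx (S (n + k)%N) x).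
  apply: (@dcc_at P (addx a x)) => //; first by auto.
  move=> i; split.
  - by apply: satc_ideal; auto.
  - move=> f [d nd [e ne h]]; exists (e * d); last by rewrite -mulrA.
    exact: primeNM.
  - apply: (@subset_trans _ (addx (S i) x)); last exact: satc_sub.
    by apply: addx_min; [auto | exact: (subset_trans (@aS i) (addx_sub _ (hS i))) | exact: addx_self].
  - apply: satcS; apply: addx_min; [by auto | | exact: addx_self].
    apply: (@subset_trans _ (S i)); last exact: addx_sub.
    by apply: satcS; apply: isumS => //; exact: ideal_pow_le.
have Sn : S n `<=` S n.+1.
  have [f Sf|d nPd hd] := @nakayama_at _ noethR P (S n.+1) (S n) hP (hS _) (hS _).
    have [|e ne [r hr _]] := hn 1%N f.
      by apply: satc_sub => //; exact: addx_sub.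
    exists e => //; exists (e * f - r * x); first by rewrite -addn1.
    have -> : e * f - (e * f - r * x) = x * r by ring.
    apply: ideal_mulM; first by apply: aP; exact: addx_self.
    apply: satS; exists x => //; rewrite mulrC -(subKr (e * f) (r * x)).
    apply: idealB => //; first exact: idealMl.
    rewrite addn1 in hr; apply: satcS hr; apply: isumS => //; exact: ideal_pow_le.
  by move=> f Sf; apply: satS; exists d; [move=> /qP | exact: hd].
have [|f hf|d nqd hd] := @nakayama_at _ noethR q q0 (ideal_pow q n) hq _ (ideal_pow_ideal _ _).
- by auto.
- by apply: Sn; apply: satc_sub => //; apply: isum_r => //; auto.
apply: nqq0; apply: (@ideal_pow_prime _ q0 q n) => // f /hd.
apply: primeMl => // h.
by apply: nqd; exact: q0q.
Qed.

(** Let [Q] be maximal among the primes strictly below [P] and above [Q0]; then [P] is minimal over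
    [Q + x] for a generator [x] outside [Q]. The other generators have powers that, up to a factor
    [e] outside [P], lie in [Q + x]. Their components [qs] in [Q] are one fewer, and [Q] is minimal
    over them by the principal ideal theorem modulo [a + qs]. *)
Lemma krull_height a w P l : is_ideal a -> minover (adj a w) P -> dimge a P l ->
  (l <= size w)%N.
Proof.
have [n] := ubnP (size w); elim: n w P l a => // n IHn w P l a; rewrite ltnS => sw ha mP.
case: l => // l d; have [hP wP mP'] := mP.
have [Q0 [dQ0 Q0P nPQ0]] := dimgeS d.
have [Q [hQ [pQ QP nPQ] Q0Q max]] : exists Q, [/\ is_ideal Q,
    [/\ is_prime Q, Q `<=` P & ~ P `<=` Q], Q0 `<=` Q & forall K, is_ideal K ->
    [/\ is_prime K, K `<=` P & ~ P `<=` K] -> Q `<=` K -> K `<=` Q].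
  have hQ0 := dimge_prime dQ0.
  have [|Q [h1 h2 h3 h4]] := noeth_max noethR (A := fun K => [/\ is_prime K, K `<=` P & ~ P `<=` K])
     (prime_ideal hQ0); first by [].
  by exists Q.
have aQ : a `<=` Q by apply: subset_trans (dimge_subset dQ0) Q0Q.
have dQ : dimge a Q l by apply: dimge_up dQ0.
have [x xw nQx] : exists2 x, x \in w & ~ Q x.
  apply: contrapT => no; apply: nPQ; apply: mP' => //; apply: adj_min => // x xw.
  by apply: contrapT => nQx; apply: no; exists x.
pose w' := rem x w; have ew : w =i x :: w' by apply: perm_mem; exact: perm_to_rem.
have size_w : size w = (size w').+1 by rewrite (perm_size (perm_to_rem xw)).
have mPx : minover (addx Q x) P.
  split=> //; first by apply: addx_min => //; [auto | apply: wP; exact: adj_mem].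
  move=> K hK QK KP; apply: contrapT => nPK; apply: nQx.
  have KQ : K `<=` Q.
    by apply: max; [auto | split | apply: subset_trans QK; exact: addx_sub].
  by apply: KQ; apply: QK; exact: addx_self.
have [e [m [nPe he]]] := minover_pow noethR (addx_ideal x hQ) mPx.
have [qs [sqs qsQ hqs]] : exists qs, [/\ size qs = size w', forall v, v \in qs -> Q v &
    forall v, v \in w' -> exists2 v', v' \in qs & exists r, e * v ^+ m = v' + r * x].
  have : forall v, v \in w' -> exists2 v', Q v' & exists r, e * v ^+ m = v' + r * x.
    move=> v vw; have [|r hr _] := he (v ^+ m).
      by apply: ideal_powX; apply: wP; apply: adj_mem; rewrite ?ew ?inE ?vw ?orbT.
    by exists (e * v ^+ m - r * x) => //; exists r; rewrite subrK.
  elim: (w') => [|v vs IHvs] hv; first by exists [::].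
  have [|qs [h1 h2 h3]] := IHvs; first by move=> u uv; apply: hv; rewrite inE uv orbT.
  have [v' Qv' [r hr]] := hv v (mem_head _ _).
  exists (v' :: qs); split; first by rewrite /= h1.
    by move=> u; rewrite inE => /orP[/eqP ->|/h2].
  move=> u; rewrite inE => /orP[/eqP ->|/h3[u' u'q hu']].
    by exists v'; rewrite ?mem_head //; exists r.
  by exists u'; rewrite // inE u'q orbT.
rewrite size_w ltnS -sqs; apply: (IHn qs Q l a) => //; first by rewrite sqs -size_w.
have qsQ' : adj a qs `<=` Q by apply: adj_min => //; auto.
split=> // K hK qsK KQ; apply: contrapT => nQK.
have [P1 P2 P3] := mPx.
have mq : minover (addx (adj a qs) x) P.
  split=> //; first by apply: addx_min; [auto | apply: subset_trans QP | apply: P2; exact: addx_self].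
  move=> L hL sL LP; have hL' : is_ideal L by auto.
  apply: mP' => //; apply: adj_min => //.
    by apply: subset_trans sL; apply: (subset_trans (adj_sub qs ha)); apply: addx_sub; auto.
  have Lx : L x by apply: sL; apply: addx_self; auto.
  move=> v; rewrite ew inE => /orP[/eqP -> //|/hqs[v' v'q [r hr]]].
  apply: (@primeX _ _ _ m) => //; apply: (@primeMl _ _ e) => //; first by move/LP.
  rewrite hr; apply: idealD => //; last exact: idealMl.
  by apply: sL; apply: addx_sub; [auto | exact: adj_mem].
apply: (krull_pit (adj_ideal qs ha) mq).
apply: (@dimge_rcons _ _ Q) => //; apply: (@dimge_rcons _ _ K) => //; exact: dimge0.
Qed.

(** Each new element of [w] is chosen in [P] outside the minimal primes of the current ideal that
    lie in [P], so that every step lengthens a chain of primes. With [krull_height], [size w] is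
    exactly the height of [P / a]. *)
Lemma sop_exists a P : is_ideal a -> is_prime P -> a `<=` P ->
  exists w, [/\ forall x, x \in w -> P x, minover (adj a w) P & dimge a P (size w)].
Proof.
move=> ha hP; elim/noeth_ind: a / ha; first exact: noethR.
move=> a ha IH aP; have [mP|nmP] := EM (minover a P).
  by exists [::]; split=> //; exact: dimge0.
have [ps [h1 h2]] := finite_minover noethR ha.
have [|x [Px hx]] := @prime_avoid0 _ P [seq p <- ps | `[< p `<=` P /\ minover a p >]] (prime_ideal hP).
  move=> p; rewrite mem_filter => /andP[/asboolP[pP mp] pps]; split; first by case: mp.
  by move=> Pp; apply: nmP; have <- : p = P by apply/seteqP.
have xmin p : minover a p -> p `<=` P -> ~ p x.
  by move=> mp pP; apply: hx; rewrite mem_filter h2 // andbT; apply/asboolP.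
have [p0 mp0 p0P] := minover_exists noethR ha hP aP.
have [||||w [w1 w2 w3]] := IH (addx a x); [by auto | exact: addx_sub | | |].
- by move=> h; apply: (xmin p0 mp0 p0P); case: mp0 => _ + _; apply; apply/h/addx_self.
- by apply: addx_min => //; auto.
exists (x :: w); split=> //.
- by move=> y; rewrite inE => /orP[/eqP ->|/w1].
- apply: dimge_cons w3 => q hq aq qP.
  have [|p mp pq] := minover_exists noethR ha hq; first by apply: subset_trans aq; exact: addx_sub.
  exists p; case: (mp) => m1 m2 _; split=> // qp; apply: (xmin p) => //.
    exact: subset_trans qP.
  by apply/qp/aq/addx_self.
Qed.

(** Prefixing [x] to a system of parameters modulo [a + x] makes [P] minimal over [a] and as many
    elements, so [krull_height] bounds [l.+1] by their number. *)
Lemma dimge_addx a x P l : is_ideal a -> P x -> dimge a P l.+1 -> dimge (addx a x) P l.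
Proof.
move=> ha Px d; have hP := dimge_prime d.
have [||w [w1 w2 w3]] := @sop_exists (addx a x) P _ hP; first by auto.
  by apply: addx_min => //; [auto | exact: dimge_subset d].
by apply: dimge_le w3; have := @krull_height a (x :: w) P _ ha w2 d.
Qed.

Lemma dimge_adj a z P l : is_ideal a -> (forall x, x \in z -> P x) ->
  dimge a P (size z + l) -> dimge (adj a z) P l.
Proof.
move=> ha; elim: z a ha => //= x z IHz a ha hz d.
apply: IHz; [by auto | by move=> y yz; apply: hz; rewrite inE yz orbT |].
by apply: dimge_addx => //; apply: hz; rewrite mem_head.
Qed.

End Height.

(** * Regular sequences *)

(** Every permutation of [z] is a regular sequence modulo [a]. Permutability is part of the notion
    because it lets [regperm_pow] replace one element by a power: the proof uses that element both
    before and after another one. *)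
Definition regperm (R : comPzRingType) (a : set R) (z : seq R) :=
  forall (z1 : seq R) (x : R) (z2 : seq R),
    perm_eq z (z1 ++ x :: z2) -> colon (adj a z1) x `<=` adj a z1.

Section Regular.
Variables (R : comPzRingType) (noethR : noetherian R) (n : set R) (hn : loc n).
Implicit Types (I J K N P Q a b p q : set R) (s t w z : seq R) (x y f g : R).

Let hn' : is_ideal n. Proof. by case: hn. Qed.

(** Steinitz exchange in [n / (a + n ^ 2)]: either all coefficients in an expression of [x] lie in
    [n], or one of them is a unit and the expression can be solved for its generator. *)
Lemma exchange a z x : is_ideal a -> (forall y, y \in z -> n y) -> adj a z x ->
  isum a (ideal_mul n n) x \/ exists2 y, y \in z & adj (addx a x) (rem y z) y.
Proof.
move=> ha; elim: z x => [|y z IHz] x hz; first by left; apply: isum_l.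
rewrite /= adj_addx // => -[r hr _].
have ny : n y by apply: hz; rewrite mem_head.
have [nr|nnr] := EM (n r); last first.
  right; exists y; rewrite ?mem_head // eqxx.
  apply: (@loc_sat _ n _ r) => //; first by auto.
  rewrite -(subKr x (r * y)); apply: idealB; [by auto | |].
    by apply: adj_sub; [auto | exact: addx_self].
  by apply: adj_subset hr; [auto.. | exact: addx_sub |].
have [|[j hj h]|[v vz hv]] := IHz (x - r * y) _ hr.
- by move=> v vz; apply: hz; rewrite inE vz orbT.
- left; exists j => //; have -> : x - j = x - r * y - j + r * y by ring.
  by apply: (idealD (ideal_mul_ideal n n)) => //; exact: ideal_mulM.
right; exists v; first by rewrite inE vz orbT.
have [yv|yv] := eqVneq y v.
  by subst v; apply: adj_mem; auto.
rewrite /=.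
have h1 : is_ideal (addx a x) by auto.
have h2 : is_ideal (addx (addx a x) y) by auto.
apply: adj_subset hv => //; first by auto.
apply: addx_min => //.
  exact: (subset_trans (addx_sub x ha) (addx_sub y h1)).
apply: idealB => //; first by apply: addx_sub => //; exact: addx_self.
by apply: idealMl => //; exact: addx_self.
Qed.

(** A regular local ring is a domain. Take [x] in [n], outside [a + n ^ 2] and outside all minimal
    primes of [a]. By exchange [a + x] is of the same kind with one generator fewer, hence prime by
    induction. A minimal prime [p] of [a] inside it satisfies [p = a + x p], so [p = a] by
    Nakayama's lemma. *)
Lemma reg_prime a z : is_ideal a -> adj a z = n -> dimge a n (size z) -> is_prime a.
Proof.
have [r] := ubnP (size z); elim: r z a => // r IHr z a; rewrite ltnS => sz ha az d.
have an : a `<=` n by rewrite -az; exact: adj_sub.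
have zn y : y \in z -> n y by rewrite -az; exact: adj_mem.
case: z => [|y0 z0] in sz az zn d *; first by rewrite (_ : a = n) //; exact: loc_prime.
set z := y0 :: z0 in sz az zn d *.
have hn2 : is_ideal (isum a (ideal_mul n n)) by auto.
have nn2 : ~ n `<=` isum a (ideal_mul n n).
  move=> /(nakayama noethR hn ha hn') na; have [Q [dQ Qn nnQ]] := dimgeS d.
  by apply: nnQ; apply: subset_trans na (dimge_subset dQ).
have [ps [h1 h2]] := finite_minover noethR ha.
have [|x [nx nx2 hx]] := @prime_avoid _ n _ [seq p <- ps | `[< minover a p >]] hn' hn2 nn2.
  move=> p; rewrite mem_filter => /andP[/asboolP mp pps]; split; first by case: mp.
  move=> np; have pn : p = n.
    by apply/seteqP; split=> //; apply: prime_sub_loc hn _; case: mp.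
  rewrite pn in mp; have := @krull_height _ noethR a [::] n _ ha mp d.
  by rewrite leqn0.
have xmin p : minover a p -> ~ p x.
  by move=> mp; apply: hx; rewrite mem_filter h2 // andbT; apply/asboolP.
have [|/nx2 //|[y yz hy]] := @exchange a z x ha zn; first by rewrite az.
have sr : size z = (size (rem y z)).+1 by rewrite (perm_size (perm_to_rem yz)).
have hax : is_ideal (addx a x) by auto.
have pax : is_prime (addx a x).
  apply: (IHr (rem y z)) => //; first by move: sz; rewrite sr.
    apply/seteqP; split.
      apply: adj_min => //; first by apply: addx_min.
      by move=> v /mem_rem; exact: zn.
    rewrite -az; apply: adj_min; first by auto.
      exact: (subset_trans (addx_sub x ha) (adj_sub _ hax)).
    move=> v; rewrite (perm_mem (perm_to_rem yz)) inE => /orP[/eqP -> //|].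
    exact: adj_mem.
  by apply: dimge_addx => //; rewrite -sr.
have [|p mp pax'] := minover_exists noethR ha pax; first exact: addx_sub.
suff -> : a = p by case: mp.
apply/seteqP; split; first by case: mp.
have hp : is_prime p by case: mp.
have hp' : is_ideal p by auto.
apply: (nakayama noethR hn ha hp') => f pf.
have [g hg _] := pax' f pf.
exists (f - g * x) => //; rewrite subKr mulrC; apply: ideal_mulM => //.
have ap : a `<=` p by case: mp.
apply: (@primeMl _ _ x) => //; first exact: xmin.
rewrite mulrC -(subKr f (g * x)); apply: idealB => //; exact: ap.
Qed.

Lemma reg_regperm a z : is_ideal a -> adj a z = n -> dimge a n (size z) -> regperm a z.
Proof.
move=> ha az d z1 x z2 pz.
have zn y : y \in z -> n y by rewrite -az; exact: adj_mem.
have z1z y : y \in z1 -> y \in z by rewrite (perm_mem pz) mem_cat => ->.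
have ez : adj a (z1 ++ x :: z2) = n.
  by rewrite -az; apply: eq_adj => // y; rewrite (perm_mem pz).
have sz := perm_size pz; rewrite size_cat /= in sz.
have pr : is_prime (adj a z1).
  apply: (@reg_prime _ (x :: z2)); [by auto | by rewrite -adj_cat |].
  by apply: dimge_adj => // [y /z1z /zn //|]; rewrite -sz.
suff nx : ~ adj a z1 x.
  by move=> f; rewrite /colon /= mulrC; apply: primeMl.
move=> hx; suff : (size z <= size (z1 ++ z2))%N by rewrite sz size_cat addnS ltnn.
apply: (@krull_height _ noethR a _ n) => //.
suff -> : adj a (z1 ++ z2) = n by split=> //; auto.
rewrite -ez !adj_cat /=; congr (adj _ z2); apply/seteqP; split.
  by apply: addx_sub; auto.
by apply: addx_min; auto.
Qed.

End Regular.

Section RegularSequences.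
Variable R : comPzRingType.
Implicit Types (I J K N P Q a p q : set R) (s t w z : seq R) (b x y f g : R).

Fixpoint kseq b a w : Prop :=
  if w is x :: w' then (forall f, a (f * x) -> a (b * f)) /\ kseq b (addx a x) w'
  else True.

Lemma kseqP b a w : kseq b a w <->
  forall w1 x w2, w = w1 ++ x :: w2 -> forall f, adj a w1 (f * x) -> adj a w1 (b * f).
Proof.
split.
  elim: w a => [|y w IHw] a; first by move=> _ [].
  move=> [h1 h2] [|y' w1] x w2 /= [yx ew]; first by rewrite -yx.
  by rewrite -yx; exact: (IHw _ h2 _ _ _ ew).
elim: w a => [|y w IHw] a h //=; split; first exact: (h [::] y w).
by apply: IHw => w1 x w2 ew; apply: (h (y :: w1) x w2); rewrite ew.
Qed.

Definition pw z (u : seq nat) : seq R := [seq v.1 ^+ v.2 | v <- zip z u].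

Lemma regperm_pow a x z k : is_ideal a -> regperm a (x :: z) -> regperm (addx a (x ^+ k)) z.
Proof.
move=> ha h z1 y z2 pz; rewrite adj_addx //; set c := adj a z1.
have hc : is_ideal c by rewrite /c; auto.
have cx : colon c x `<=` c.
  apply: (h z1 x (y :: z2)).
  by rewrite perm_sym -cat1s perm_catCA /= perm_cons perm_sym.
have cxy : colon (addx c x) y `<=` addx c x.
  by have := h (x :: z1) y z2; rewrite /= perm_cons adj_addx //; apply.
elim: k => [|k IHk] f; first by rewrite expr0 => _; exists f; rewrite // mulr1 subrr; exact: ideal0.
move=> [g hg _]; rewrite /colon /= in hg.
have [|r hr _] := cxy f.
  by exists (g * x ^+ k); rewrite // -mulrA -exprSr.
have : colon (addx c (x ^+ k)) y r.
  exists g => //; apply: cx; rewrite /colon /=.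
  have -> : (r * y - g * x ^+ k) * x = (f * y - g * x ^+ k.+1) - (f - r * x) * y.
    by rewrite exprSr; ring.
  by apply: idealB => //; apply: idealMr.
move=> /IHk[g' hg' _]; exists g' => //.
have -> : f - g' * x ^+ k.+1 = (f - r * x) + (r - g' * x ^+ k) * x by rewrite exprSr; ring.
by apply: idealD => //; apply: idealMr.
Qed.

Lemma regperm_kseq a z u : is_ideal a -> regperm a z -> kseq 1 a (pw z u).
Proof.
elim: z u a => [|x z IHz] [|k u] a ha h //=; split; last first.
  by apply: IHz; [auto | exact: regperm_pow].
have ax : colon a x `<=` a by apply: (h [::] x z).
move=> f; rewrite mul1r; elim: k f => [|k IHk] f; first by rewrite expr0 mulr1.
by rewrite exprS mulrA => /IHk /ax.
Qed.

End RegularSequences.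

(** * Koszul homology *)

Section Koszul.
Variable R : comPzRingType.
Implicit Types (I a : set R) (xs : seq R) (s t : seq bool) (b c x y u : R).
Implicit Types (f g h k : seq bool -> R).

(* Basis elements of the Koszul complex on [xs] are the subsets of [xs], given by
   their characteristic sequences; the degree is the number of [true]s. *)
Fixpoint kd xs f s : R :=
  match xs, s with
  | x :: xs', true :: s' => - kd xs' (fun t => f (true :: t)) s'
  | x :: xs', false :: s' => kd xs' (fun t => f (false :: t)) s' + x * f (true :: s')
  | _, _ => 0
  end.

Lemma kd_lin xs c f g s :
  kd xs (fun t => c * f t + g t) s = c * kd xs f s + kd xs g s.
Proof.
elim: xs f g s => [|x xs IHxs] f g [|[] s] /=; rewrite ?mulr0 ?addr0 //.
  by rewrite IHxs; ring.
by rewrite IHxs; ring.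
Qed.

Lemma kd_eq xs f g s : f =1 g -> kd xs f s = kd xs g s.
Proof. by move=> /funext ->. Qed.

Lemma kd_scale xs c f s : kd xs (fun t => c * f t) s = c * kd xs f s.
Proof.
elim: xs f s => [|x xs IHxs] f [|[] s] /=; rewrite ?mulr0 //.
  by rewrite IHxs; ring.
by rewrite IHxs; ring.
Qed.

Lemma kd_sub xs f g s : kd xs (fun t => f t - g t) s = kd xs f s - kd xs g s.
Proof.
rewrite (kd_eq xs (g := fun t => -1 * g t + f t)); last by move=> t; ring.
by rewrite kd_lin; ring.
Qed.

Lemma kd_kd xs f s : kd xs (kd xs f) s = 0.
Proof.
elim: xs f s => [|x xs IHxs] f [|[] s] //=.
  rewrite (kd_eq xs (g := fun t => -1 * kd xs (fun t => f (true :: t)) t)); last by move=> t; ring.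
  by rewrite kd_scale IHxs mulr0 oppr0.
rewrite (kd_eq xs (g := fun t => x * f (true :: t) + kd xs (fun t => f (false :: t)) t));
  last by move=> t; ring.
by rewrite kd_lin IHxs; ring.
Qed.

Lemma kd_in I xs f s : is_ideal I -> size s = size xs ->
  (forall t, size t = size xs -> count id t = (count id s).+1 -> I (f t)) -> I (kd xs f s).
Proof.
move=> hI; elim: xs f s => [|x xs IHxs] f [|[] s] //= => [_ _|[sz] h|[sz] h].
- exact: ideal0.
- apply: idealN => //; apply: IHxs => // t st ct; apply: h => /=; first by rewrite st.
  by rewrite ct.
- apply: idealD => //; last by apply: idealMl => //; apply: h; rewrite /= ?sz.
  by apply: IHxs => // t st ct; apply: h => //=; rewrite st.
Qed.

Lemma kd_congr I xs f g s : is_ideal I -> size s = size xs ->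
  (forall t, size t = size xs -> count id t = (count id s).+1 -> I (f t - g t)) ->
  I (kd xs f s - kd xs g s).
Proof. by move=> hI sz h; rewrite -kd_sub; exact: kd_in. Qed.

Lemma kd_mem I xs f s : is_ideal I -> (forall t x, x \in xs -> I (x * f t)) -> I (kd xs f s).
Proof.
move=> hI; elim: xs f s => [|x xs IHxs] f [|[] s] h /=; try exact: ideal0.
  apply: idealN => //; apply: IHxs => t y yxs; apply: h; rewrite inE yxs orbT //.
apply: idealD => //; last by apply: h; rewrite mem_head.
by apply: IHxs => t y yxs; apply: h; rewrite inE yxs orbT.
Qed.

(* [b] kills the Koszul homology of [R / a] with respect to [xs] in degree [j]. *)
Definition killsH b xs j a := forall f,
  (forall s, size s = size xs -> (count id s).+1 = j -> a (kd xs f s)) ->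
  exists g, forall s, size s = size xs -> count id s = j -> a (b * f s - kd xs g s).

Lemma killsH_ideal xs j a : is_ideal a -> is_ideal [set b | killsH b xs j a].
Proof.
move=> ha; split=> [f _|c x y hx hy f hf].
  exists (fun=> 0) => s sz cs; rewrite mul0r sub0r; apply: idealN => //.
  by apply: kd_mem => // t y _; rewrite mulr0; exact: ideal0.
have [g hg] := hx f hf; have [g' hg'] := hy f hf.
exists (fun t => c * g t + g' t) => s sz cs; rewrite kd_lin.
have -> : (c * x + y) * f s - (c * kd xs g s + kd xs g' s) =
  c * (x * f s - kd xs g s) + (y * f s - kd xs g' s) by ring.
by apply: idealD => //; [apply: idealMl => //; exact: hg | exact: hg'].
Qed.

Lemma killsH_full xs j a b : is_ideal a -> a b -> killsH b xs j a.
Proof.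
move=> ha ab f _; exists (fun=> 0) => s _ _; apply: idealB => //; first exact: idealMr.
by apply: kd_mem => // t y _; rewrite mulr0; exact: ideal0.
Qed.

Lemma killsH_large xs j a b : (size xs < j)%N -> killsH b xs j a.
Proof.
move=> sj f _; exists f => s sz cs; move: sj.
by rewrite -cs -sz ltnNge count_size.
Qed.

(** [H] is exterior multiplication by the basis vector of [x], a homotopy between multiplication by
    [x] and zero. The last clause expresses that [H] raises the degree by one. *)
Lemma kd_homotopy xs x : x \in xs -> exists H : (seq bool -> R) -> (seq bool -> R),
  [/\ forall f s, size s = size xs -> kd xs (H f) s + H (kd xs f) s = x * f s,
      forall c f g s, H (fun t => c * f t + g t) s = c * H f s + H g s
    & forall I f s, is_ideal I -> size s = size xs ->
      (forall t, size t = size xs -> (count id t).+1 = count id s -> I (f t)) -> I (H f s)].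
Proof.
elim: xs => // y xs IHxs; rewrite inE => /orP[/eqP ->|/IHxs[H [h1 h2 h3]]].
  exists (fun f s => if s is true :: s' then f (false :: s') else 0); split.
  - move=> f [|[] s] //= [sz]; last first.
      rewrite (kd_eq xs (g := fun t => 0 * f t)) ?kd_scale; last by move=> t; rewrite mul0r.
      by ring.
    by ring.
  - by move=> c f g [|[] s] //; rewrite mulr0 addr0.
  - move=> I f [|[] s] hI //= => [[sz] h|_ _]; last exact: ideal0.
    by apply: h => //=; rewrite sz.
exists (fun f s => match s with
  | true :: s' => - H (fun t => f (true :: t)) s'
  | false :: s' => H (fun t => f (false :: t)) s'
  | [::] => 0 end); split.
- move=> f [|[] s] //= [sz].
    rewrite (kd_eq xs (g := fun t => -1 * H (fun t => f (true :: t)) t)); last by move=> t; ring.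
    have -> : (fun t => - kd xs (fun t0 => f (true :: t0)) t) =
      (fun t => -2%:R * kd xs (fun t0 => f (true :: t0)) t + kd xs (fun t0 => f (true :: t0)) t).
      by apply/funext => t; ring.
    rewrite kd_scale h2 -(h1 (fun t => f (true :: t))) //; ring.
  have -> : (fun t => kd xs (fun t0 => f (false :: t0)) t + y * f (true :: t)) =
      (fun t => y * f (true :: t) + kd xs (fun t0 => f (false :: t0)) t).
    by apply/funext => t; ring.
  by rewrite h2 -(h1 (fun t => f (false :: t))) //; ring.
- by move=> c f g [|[] s] /=; rewrite ?h2; ring.
- move=> I f [|[] s] hI //= [sz] h.
    apply: idealN => //; apply: h3 => // t st ct; apply: h => /=; first by rewrite st.
    by rewrite !add1n ct.
  by apply: h3 => // t st ct; apply: h => //=; rewrite st.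
Qed.

Lemma killsH_self xs j a y : is_ideal a -> adj a xs y -> killsH y xs j a.
Proof.
move=> ha; have : adj a xs `<=` [set b | killsH b xs j a]; last by apply.
apply: adj_min; [exact: killsH_ideal | by move=> b; exact: killsH_full |].
move=> x /kd_homotopy[H [h1 h2 h3]] f hf; exists (H f) => s sz cs.
rewrite -h1 // addrAC subrr add0r; apply: h3 => // t st ct; apply: hf => //.
by rewrite ct.
Qed.

(** Multiplication by [u] embeds [R / (a : u)] in [R / a] with quotient [R / (a + u)]; in the long
    exact sequence of homology the annihilators of the two ends multiply. *)
Lemma killsH_ext xs j a u b c : is_ideal a ->
  killsH b xs j (colon a u) -> killsH c xs j (addx a u) -> killsH (b * c) xs j a.
Proof.
move=> ha hb hc f hf.
have [s sz cs|g hg] := hc f; first by apply: addx_sub => //; exact: hf.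
have /choice[h hh] : forall s, exists r, size s = size xs -> count id s = j ->
    a (c * f s - kd xs g s - r * u).
  move=> s; have [[sz cs]|no] := EM (size s = size xs /\ count id s = j).
    by have [r hr _] := hg s sz cs; exists r.
  by exists 0 => sz cs; case: no.
have [s sz cs|k hk] := hb h.
  rewrite /colon /= mulrC -kd_scale -[X in a X](subKr (kd xs (fun t => c * f t - kd xs g t) s)).
  apply: idealB => //.
    rewrite kd_sub kd_kd subr0 kd_scale; apply: idealMl => //; exact: hf.
  apply: kd_congr => // t st ct; rewrite [u * _]mulrC; apply: hh => //.
  by rewrite ct cs.
exists (fun t => u * k t + b * g t) => s sz cs; rewrite kd_lin kd_scale.
have -> : b * c * f s - (u * kd xs k s + b * kd xs g s) =
  b * (c * f s - kd xs g s - h s * u) + (b * h s - kd xs k s) * u by ring.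
by apply: idealD => //; [apply: idealMl => //; exact: hh | exact: hk].
Qed.

(** For a cycle [f], write [y f] as the boundary of [g]. Then [g] is a cycle modulo [a + y] in the
    next degree, so [b g] is a boundary plus [y k]. It follows that [b f] minus the boundary of [k]
    is killed by [y], and [c] removes this torsion. The gain is that the hypothesis on [b] is in
    degree [j.+1]. *)
Lemma killsH_torsion xs j a y b c : is_ideal a -> killsH y xs j a ->
  (forall u, a (u * y) -> a (c * u)) -> killsH b xs j.+1 (addx a y) ->
  killsH (c * b) xs j a.
Proof.
move=> ha hy hc hb f hf; have [g hg] := hy f hf.
have [s sz [cs]|h hh] := hb g.
  exists (f s); rewrite // -opprB; apply: idealN => //.
  by rewrite [f s * y]mulrC; exact: hg.
have /choice[k hk] : forall s, exists r, size s = size xs -> count id s = j.+1 ->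
    a (b * g s - kd xs h s - r * y).
  move=> s; have [[sz cs]|no] := EM (size s = size xs /\ count id s = j.+1).
    by have [r hr _] := hh s sz cs; exists r.
  by exists 0 => sz cs; case: no.
exists (fun t => c * k t) => s sz cs; rewrite kd_scale -mulrA -mulrBr; apply: hc.
have -> : (b * f s - kd xs k s) * y = b * (y * f s - kd xs g s) +
   (b * kd xs g s - y * kd xs k s) by ring.
apply: idealD => //; first by apply: idealMl => //; exact: hg.
rewrite -!kd_scale -[kd xs (fun t => b * g t) s]subr0 -[X in _ - X - _](kd_kd xs h s) -kd_sub.
by apply: kd_congr => // t st ct; rewrite [y * _]mulrC; apply: hk; rewrite // ct cs.
Qed.

(** The long exact sequence of multiplication by the nonzerodivisor [y] on [R / a] places this
    homology between that of [R / a] in degrees [j.+1] and [j]. *)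
Lemma killsH_quotient xs j a y : is_ideal a -> (forall u, a (u * y) -> a u) ->
  killsH 1 xs j a -> killsH 1 xs j.+1 a -> killsH 1 xs j.+1 (addx a y).
Proof.
move=> ha hy h0 h1 f hf.
have /choice[h hh] : forall s, exists r, size s = size xs -> count id s = j ->
    a (kd xs f s - r * y).
  move=> s; have [[sz cs]|no] := EM (size s = size xs /\ count id s = j).
    by have [|r hr _] := hf s sz; [rewrite cs | exists r].
  by exists 0 => sz cs; case: no.
have [s sz cs|k hk] := h0 h.
  apply: hy; rewrite mulrC -kd_scale -[X in a X]opprK; apply: idealN => //.
  rewrite -sub0r -(kd_kd xs f s); apply: kd_congr => // t st ct; rewrite [y * _]mulrC.
  by apply: hh; rewrite // ct cs.
have [s sz [cs]|g hg] := h1 (fun t => f t - y * k t).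
  rewrite kd_sub kd_scale.
  have -> : kd xs f s - y * kd xs k s = (kd xs f s - h s * y) + (1 * h s - kd xs k s) * y by ring.
  by apply: idealD => //; [exact: hh | apply: idealMr => //; exact: hk].
exists g => s sz cs; exists (k s) => //.
have -> : 1 * f s - kd xs g s - k s * y = 1 * (f s - y * k s) - kd xs g s by ring.
exact: hg.
Qed.

(** Depth sensitivity of the Koszul complex. Elements of [(xs)] kill the homology, so
    [killsH_torsion] trades each element of [w] for one degree and one factor [b], until the degree
    exceeds [size xs]. *)
Lemma killsH_kseq xs j a b w : is_ideal a -> kseq b a w ->
  (forall y, y \in w -> adj a xs y) -> (size xs < j + size w)%N ->
  killsH (b ^+ size w) xs j a.
Proof.
elim: w j a => [|y w IHw] j a ha /=; first by rewrite addn0 => _ _; exact: killsH_large.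
move=> [hb kw] hw sz; rewrite exprS.
apply: (@killsH_torsion xs j a y) => //; first by apply: killsH_self => //; apply: hw; rewrite mem_head.
apply: (IHw _ _ _ kw); [by auto | | by rewrite addSnnS].
move=> z zw; apply: adj_subset (hw z _); [by auto.. | exact: addx_sub | by [] |].
by rewrite inE zw orbT.
Qed.

Lemma killsH_top xs a u : is_ideal a -> killsH 1 xs (size xs) a ->
  (forall x, x \in xs -> a (u * x)) -> a u.
Proof.
move=> ha h hu; have [s _ _|g hg] := h (fun=> u).
  by apply: kd_mem => // t x xxs; rewrite mulrC; exact: hu.
have := hg (nseq (size xs) true); rewrite size_nseq count_nseq mul1n mul1r.
move=> /(_ erefl erefl) hau; apply: idealDr hau => //; apply: idealN => //.
apply: kd_in => //; first by rewrite size_nseq.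
move=> t st; rewrite count_nseq mul1n => ct.
by have := count_size id t; rewrite ct st ltnn.
Qed.

Lemma adj_kd a xs y : is_ideal a -> adj a xs y ->
  exists f, a (y - kd xs f (nseq (size xs) false)).
Proof.
move=> ha; elim: xs y => [|x xs IHxs] y /=; first by exists (fun=> 0); rewrite subr0.
rewrite adj_addx // => -[r /IHxs[f hf] _].
exists (fun t => if t is true :: _ then r else f (behead t)).
by have <- : y - r * x - kd xs f (nseq (size xs) false) = y - (kd xs f (nseq (size xs) false) + x * r)
  by ring.
Qed.

(** A relation expressing [u * x] through [xs] is a cycle of degree one with component [u] at [x],
    whereas the component at [x] of a boundary lies in [(xs)]. *)
Lemma killsH1_colon c x xs a u : is_ideal a -> killsH c (x :: xs) 1 a ->
  adj a xs (u * x) -> adj a xs (c * u).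
Proof.
move=> ha hc /(adj_kd ha)[g hg].
have [|h hh] := hc (fun t => if t is true :: _ then u else - g (behead t)).
  move=> [|[] s] //= [sz] [cs].
  have -> : s = nseq (size xs) false.
    rewrite -sz; elim: (s) cs => //= -[] s' IHs' //= h; congr (_ :: _).
    by apply: IHs'.
  rewrite (kd_eq xs (g := fun t => -1 * g t)); last by move=> t; ring.
  rewrite kd_scale.
  by have -> : -1 * kd xs g (nseq (size xs) false) + x * u = u * x - kd xs g (nseq (size xs) false) by ring.
have := hh (true :: nseq (size xs) false); rewrite /= size_nseq count_nseq /=.
move=> /(_ erefl erefl); rewrite opprK => hcf.
apply: (@idealDr _ _ _ (kd xs (fun t => h (true :: t)) (nseq (size xs) false))); first by auto.
  by apply: kd_mem => [|t z zxs]; [auto | apply: idealMr; [auto | exact: adj_mem]].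
exact: adj_sub.
Qed.

End Koszul.

(** * Associated primes *)

Section AssociatedPrimes.
Variables (R : comPzRingType) (noethR : noetherian R).
Implicit Types (a P Q : set R) (u f g y : R).

(** Among the annihilators modulo [a] of those multiples of [f] that stay nonzero in the
    localization at [Q], a maximal one is prime. *)
Lemma assoc_prime_at a Q f : is_ideal a -> is_prime Q -> ~ satc Q a f ->
  exists c, is_prime (colon a (c * f)) /\ colon a (c * f) `<=` Q.
Proof.
move=> ha hQ nf.
have sub c : ~ satc Q a (c * f) -> colon a (c * f) `<=` Q.
  by move=> nc r hr; apply: contrapT => nr; apply: nc; exists r.
have [|J [hJ [c nc ->] _ max]] := noeth_max noethR
    (A := fun J => exists2 c, ~ satc Q a (c * f) & J = colon a (c * f)) (colon_ideal (1 * f) ha).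
  by exists 1; rewrite ?mul1r.
exists c; split; last exact: sub.
split=> //; first by auto.
  by move=> h; apply: nc; apply: satc_sub => //; rewrite -[c * f]mul1r.
move=> x y hxy; have [hs|ns] := EM (satc Q a (y * (c * f))).
  right; case: hs => d nd hd.
  apply: (max (colon a ((d * c) * f))) => //; first by auto.
  - exists (d * c) => //.
    by move=> h; apply: nc; apply: satcK nd _ => //; rewrite mulrA.
  - by move=> r hr; rewrite /colon /= -mulrA mulrCA; exact: idealMl.
  by rewrite /colon /= -mulrA mulrCA.
left; apply: (max (colon a ((y * c) * f))); first by auto.
- by exists (y * c); rewrite // -mulrA.
- by move=> r hr; rewrite /colon /= -mulrA mulrCA; exact: idealMl.
by rewrite /colon /= -mulrA mulrA.
Qed.

(** If [a : u0] is prime, [(a + u0) / a] is isomorphic to [R / (a : u0)], so any associated prime of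
    [a] is either [a : u0] or associated to the larger ideal [a + u0]. *)
Lemma finite_assoc a : is_ideal a -> exists ps : seq (set R),
  forall u, is_prime (colon a u) -> colon a u \in ps.
Proof.
move=> ha; elim/noeth_ind: a / ha; first exact: noethR.
move=> a ha IH; have [[u0 hu0]|no] := EM (exists u, is_prime (colon a u)); last first.
  by exists [::] => u hu; case: no; exists u.
have [|h|ps hps] := IH (addx a u0) (addx_ideal _ ha); first exact: addx_sub.
  case: (primeN1 hu0); rewrite /colon /= mul1r; apply: h; exact: addx_self.
exists (colon a u0 :: ps) => u hu; rewrite inE.
have [[c nc [r hr _]]|no] := EM (exists2 c, ~ colon a u c & addx a u0 (c * u)).
  have nr : ~ a (r * u0).
    move=> h; apply: nc; rewrite /colon /= -(subrK (r * u0) (c * u)); exact: idealD.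
  suff -> : colon a u = colon a u0 by rewrite eqxx.
  apply/seteqP; split=> x hx; rewrite /colon /= in hx.
    apply: (@primeMl _ (colon a u0) r) => //; rewrite /colon /=.
    have -> : r * x * u0 = c * (x * u) - x * (c * u - r * u0) by ring.
    by apply: idealB => //; exact: idealMl.
  apply: (@primeMl _ (colon a u) c) => //; rewrite /colon /=.
  have -> : c * x * u = r * (x * u0) + x * (c * u - r * u0) by ring.
  by apply: idealD => //; exact: idealMl.
have E : colon (addx a u0) u = colon a u.
  apply/seteqP; split=> x; last exact: (addx_sub u0 ha).
  by move=> hx; apply: contrapT => nx; apply: no; exists x.
by rewrite -E hps ?orbT // E.
Qed.

End AssociatedPrimes.

(** The property is tested on the union with [A0], because the union of the empty chain is empty and
    need not have the property. *)
Lemma zorn_above (T : Type) (P : set (set T)) (A0 : set T) : P A0 ->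
  (forall F : set (set T), F `<=` P -> F !=set0 -> total_on F subset -> P (\bigcup_(X in F) X)) ->
  exists A, [/\ P A, A0 `<=` A & forall B, P B -> A `<=` B -> B `<=` A].
Proof.
move=> PA0 chain; pose P' : set (set T) := fun A => P (A `|` A0).
have [F FP' Ftot|A [PA max]] := @Zorn_bigcup T P'.
  have [F0|nF0] := EM (F !=set0); last first.
    rewrite /P' (_ : \bigcup_(X in F) X = set0) ?set0U //.
    by apply/seteqP; split=> // x [X FX _]; case: nF0; exists X.
  rewrite /P' (_ : _ `|` A0 = \bigcup_(X in [set Y `|` A0 | Y in F]) X).
    apply: chain; first by move=> _ [X /FP' PX <-].
      by case: F0 => X FX; exists (X `|` A0), X.
    move=> _ _ [X FX <-] [Y FY <-]; have [XY|YX] := Ftot X Y FX FY.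
      by left; apply: setSU.
    by right; apply: setSU.
  apply/seteqP; split=> x.
    case=> [[X FX Xx]|A0x]; first by exists (X `|` A0); [exists X | left].
    by case: F0 => X FX; exists (X `|` A0); [exists X | right].
  by case=> _ [X FX <-] [Xx|A0x]; [left; exists X | right].
exists (A `|` A0); split=> // B PB AB x Bx.
have A0B : A0 `<=` B by move=> y A0y; apply: AB; right.
apply: contrapT => nx; apply: (max B); last by rewrite /P' (setUidl A0B).
split; first by move=> y Ay; apply: AB; left.
by move=> BA; apply: nx; left; exact: BA.
Qed.

(** * Complete local rings *)

Section Cohen.
Variable R : comPzRingType.
Implicit Types (I p : set R) (s t ps : seq R) (x y f r v w : R).

Lemma adj0_sum (s : seq R) x : adj [set 0] s x ->
  exists c : nat -> R, x = \sum_(i < size s) c i * s`_i.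
Proof.
elim: s x => [|y s IHs] x /=; first by move=> ->; exists (fun=> 0); rewrite big_ord0.
rewrite adj_addx // => -[r /IHs[c hc] _].
exists (fun i => if i is i'.+1 then c i' else r).
by rewrite big_ord_recl /= -hc addrC subrK.
Qed.

Lemma sum_adj I (s : seq R) (c : nat -> R) : is_ideal I ->
  (forall x, x \in s -> I x) -> I (\sum_(i < size s) c i * s`_i).
Proof.
move=> hI hs; apply: ideal_sum => // i _; apply: idealMl => //.
by apply: hs; exact: mem_nth.
Qed.

(* Cohen: an ideal maximal among those not finitely generated is prime. *)
Lemma cohen_prime p :
  is_ideal p -> ~ (exists s, p = idl [set` s]) ->
  (forall I, is_ideal I -> p `<=` I -> ~ I `<=` p -> exists s, I = idl [set` s]) ->
  is_prime p.
Proof.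
move=> hp nfg max; split=> // [p1|x y pxy].
  apply: nfg; exists [:: 1]; rewrite adj_idl; apply/seteqP; split=> z _.
    by apply: ideal_full; [auto | apply: adj_mem; rewrite ?mem_head].
  exact: ideal_full.
apply: contrapT => /not_orP[npx npy]; apply: nfg.
have [||s Es] := @max (addx p x) _ (addx_sub x hp); first by auto.
  by move=> h; apply: npx; apply: h; exact: addx_self.
have [||t Et] := @max (colon p x) _ (colon_sub x hp); first by auto.
  by move=> h; apply: npy; apply: h; rewrite /colon /= mulrC.
rewrite adj_idl in Es; rewrite adj_idl in Et.
have [ps [psp hps]] : exists ps, (forall v, v \in ps -> p v) /\
    forall v, v \in s -> addx (adj [set 0] ps) x v.
  have : forall v, v \in s -> addx p x v by move=> v vs; rewrite Es; exact: adj_mem.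
  elim: (s) => [|v s' IHs] h; first by exists [::].
  have [|ps [h1 h2]] := IHs; first by move=> u us; apply: h; rewrite inE us orbT.
  have [r hr _] := h v (mem_head _ _).
  exists (v - r * x :: ps); split=> u; rewrite inE => /orP[/eqP ->|] //; first exact: h1.
    by exists r => //; apply: adj_mem; rewrite ?mem_head.
  move=> /h2[r' hr' _]; exists r' => //.
  apply: adj_subset hr'; [by auto | by auto | by [] |].
  by move=> w wp; rewrite inE wp orbT.
exists (ps ++ [seq v * x | v <- t]); rewrite adj_idl; set K := adj _ _.
have hK : is_ideal K by rewrite /K; auto.
apply/seteqP; split; last first.
  apply: adj_min => //; first by move=> _ /= ->; exact: ideal0.
  move=> v; rewrite mem_cat => /orP[/psp //|/mapP[w wt ->]].
  suff: colon p x w by [].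
  by rewrite Et; exact: adj_mem.
move=> f pf.
have psK : adj [set 0] ps `<=` K.
  by apply: adj_subset => // w wp; rewrite mem_cat wp.
have [r hr _] : addx (adj [set 0] ps) x f.
  have : adj [set 0] s f by rewrite -Es; exact: addx_sub.
  apply: adj_min; [by auto | by move=> _ /= ->; apply: ideal0; auto | exact: hps].
rewrite -(subrK (r * x) f); apply: idealD => //; first exact: psK.
have : adj [set 0] t r.
  rewrite -Et /colon /= -(subKr f (r * x)); apply: idealB => //.
  have : adj [set 0] ps `<=` p by apply: adj_min => // _ /= ->; exact: ideal0.
  by apply.
suff : adj [set 0] t `<=` colon K x by apply.
apply: adj_min; [by auto | by move=> _ /= ->; apply: ideal0; auto |].
move=> v vt; apply: adj_mem => //; rewrite mem_cat; apply/orP; right.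
by apply/mapP; exists v.
Qed.

End Cohen.

Section Complete.
Variables (C : comPzRingType) (J : set C) (F : nat -> set C).
Implicit Types (I p q : set C) (s z : seq C) (x y : C).

(** The filtration [F] may be coarser than the powers of [J]. A power series subring of [B] is
    studied with the filtration induced by the powers of [M], for which separatedness is inherited
    from [B]. *)
Definition complete_for := [/\ forall N, is_ideal (F N),
  forall N, ideal_pow J N `<=` F N,
  forall x, (forall N, F N x) -> x = 0 &
  forall t : nat -> C, (forall n, ideal_pow J n (t n)) ->
    exists u, forall N, F N (u - \sum_(i < N) t i)].

Hypothesis compl : complete_for.

Lemma geometric_inverse x : J x -> exists y, (1 - x) * y = 1.
Proof.
move=> Jx; have [hF JF F0 lim] := compl.
have [n|u hu] := lim (fun n => x ^+ n); first exact: ideal_powX.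
exists u; apply/eqP; rewrite -subr_eq0; apply/eqP/F0 => N.
have -> : (1 - x) * u - 1 = (1 - x) * (u - \sum_(i < N) x ^+ i) - x ^+ N.
  have := subrX1 x N; move=> h; have -> : x ^+ N = 1 + (x - 1) * \sum_(i < N) x ^+ i.
    by rewrite -h addrC subrK.
  by ring.
apply: idealB => //; first exact: idealMl.
exact/JF/ideal_powX.
Qed.

Lemma loc_complete : is_ideal J -> ~ J 1 ->
  (forall x, ~ J x -> exists y, J (x * y - 1)) -> loc J.
Proof.
move=> hJ nJ1 hinv; split=> // x /hinv[y hy].
have [u hu] : exists u : C, (1 - (1 - x * y)) * u = 1.
  by apply: geometric_inverse; rewrite -opprB; exact: idealN.
by exists (y * u); rewrite mulrA -hu; congr (_ * u); ring.
Qed.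

(** By Cohen's criterion take [p] prime and maximal among the ideals not finitely generated. Some
    [w] in [J] is outside [p], and [p + w] is finitely generated. As [p] is prime, each element of
    [p] is a combination of [ps] plus [w] times an element of [p]. Iterating this produces
    convergent series, so [ps] generates [p]. *)
Lemma noetherian_complete z : loc J -> adj [set 0] z = J -> noetherian C.
Proof.
move=> hJ Ez; have [hF JF F0 lim] := compl.
move=> I0 hI0; apply: contrapT => nfg0.
pose P : set (set C) := fun I => is_ideal I /\ ~ exists s, I = idl [set` s].
have [|G GP [X0 GX0] Gtot|p [[hp nfg] _ max]] := @zorn_above _ P I0; first by [].
  have hG : is_ideal (\bigcup_(X in G) X).
    split; first by exists X0 => //; apply: ideal0; case: (GP _ GX0).
    move=> a x y [X GX Xx] [Y GY Yy]; have [XY|YX] := Gtot X Y GX GY.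
      by exists Y => //; apply: (GP _ GY).1.2 => //; exact: XY.
    by exists X => //; apply: (GP _ GX).1.2 => //; exact: YX.
  split=> // -[s Es].
  have [X GX hX] : exists2 X, G X & forall v, v \in s -> X v.
    have : forall v, v \in s -> (\bigcup_(X in G) X) v.
      by move=> v vs; rewrite Es; apply: idl_sub.
    elim: (s) => [|v s' IHs] h; first by exists X0.
    have [|X GX hX] := IHs; first by move=> w ws; apply: h; rewrite inE ws orbT.
    have [Y GY Yv] := h v (mem_head _ _).
    have [XY|YX] := Gtot X Y GX GY.
      by exists Y => // w; rewrite inE => /orP[/eqP -> //|/hX /XY].
    by exists X => // w; rewrite inE => /orP[/eqP ->|/hX //]; exact: YX.
  apply: (GP _ GX).2; exists s; apply/seteqP; split; first by rewrite -Es => x Xx; exists X.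
  by apply: idl_min; [exact: (GP _ GX).1 | move=> v /= /hX].
have pp : is_prime p.
  apply: cohen_prime => // I hI pI nIp; apply: contrapT => nI.
  by apply: nIp; apply: max.
have [w [Jw npw]] : exists w, J w /\ ~ p w.
  apply: contrapT => no; apply: nfg; exists z; rewrite adj_idl Ez.
  apply/seteqP; split; first exact: prime_sub_loc.
  by move=> w Jw; apply: contrapT => npw; apply: no; exists w.
have [s Es] : exists s, addx p w = idl [set` s].
  apply: contrapT => nI; apply: npw; apply: (max (addx p w)); last exact: addx_self.
    by split=> //; exact: addx_ideal.
  exact: addx_sub.
rewrite adj_idl in Es.
have [ps [psp hps]] : exists ps, (forall v, v \in ps -> p v) /\
    forall v, p v -> addx (adj [set 0] ps) w v.
  have : forall v, v \in s -> addx p w v by move=> v vs; rewrite Es; exact: adj_mem.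
  suff key : forall s', (forall v, v \in s' -> addx p w v) -> exists ps,
      (forall v, v \in ps -> p v) /\ forall v, v \in s' -> addx (adj [set 0] ps) w v.
    move=> /key[ps [h1 h2]]; exists ps; split=> // v /(addx_sub w hp); rewrite Es.
    by apply: adj_min; [auto | move=> _ /= ->; apply: ideal0; auto | exact: h2].
  elim=> [|v s' IHs] h; first by exists [::].
  have [|qs [h1 h2]] := IHs; first by move=> u us; apply: h; rewrite inE us orbT.
  have [r hr _] := h v (mem_head _ _).
  exists (v - r * w :: qs); split=> u; rewrite inE => /orP[/eqP ->|] //; first exact: h1.
    by exists r => //; apply: adj_mem; rewrite ?mem_head.
  move=> /h2[r' hr' _]; exists r' => //.
  apply: adj_subset hr'; [by auto | by auto | by [] |].
  by move=> x xp; rewrite inE xp orbT.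
have step v : exists cb : (nat -> C) * C, p v ->
    p cb.2 /\ v = \sum_(i < size ps) cb.1 i * ps`_i + w * cb.2.
  have [pv|npv] := EM (p v); last by exists (fun=> 0, 0).
  have [r /[dup] hr /adj0_sum[c Ec] _] := hps v pv.
  exists (c, r) => _ /=; split; last by rewrite -Ec mulrC subrK.
  apply: (@primeMl _ _ w) => //; rewrite mulrC -(subKr v (r * w)); apply: idealB => //.
  have : adj [set 0] ps `<=` p by apply: adj_min => // _ /= ->; exact: ideal0.
  by apply.
have [nx hnx] := choice step.
apply: nfg; exists ps; rewrite adj_idl; apply/seteqP; split; last first.
  by apply: adj_min => // _ /= ->; exact: ideal0.
move=> a pa; pose b n := iter n (fun v => (nx v).2) a.
have pb n : p (b n) by elim: n => // n IHn; case: (hnx _ IHn).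
pose c n i := (nx (b n)).1 i.
have Ea N : a = \sum_(i < size ps) (\sum_(n < N) w ^+ n * c n i) * ps`_i + w ^+ N * b N.
  elim: N => [|N IHN].
    rewrite expr0 mul1r big1 ?add0r // => i _; by rewrite big_ord0 mul0r.
  rewrite {1}IHN {1}(hnx _ (pb N)).2 mulrDr addrA mulrA -exprSr; congr (_ + _).
  rewrite mulr_sumr -big_split /=; apply: eq_bigr => i _.
  by rewrite big_ord_recr /= mulrDl mulrA.
have /choice[r hr] : forall i, exists u, forall N, F N (u - \sum_(n < N) w ^+ n * c n i).
  move=> i; apply: (lim (fun n => w ^+ n * c n i)) => n.
  exact: (idealMr _ (ideal_pow_ideal J n) (ideal_powX n Jw)).
have -> : a = \sum_(i < size ps) r i * ps`_i.
  apply/eqP; rewrite -subr_eq0; apply/eqP/F0 => N; rewrite {1}(Ea N) addrAC -sumrB.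
  apply: idealD => //.
    2: by apply: JF; exact: (idealMr _ (ideal_pow_ideal J N) (ideal_powX N Jw)).
  apply: ideal_sum => // i _; rewrite -mulrBl -opprB; apply: idealMr => //.
  exact: idealN.
by apply: sum_adj; [auto | move=> x; exact: adj_mem].
Qed.

End Complete.

Definition subring (R : comPzRingType) (K : set R) :=
  [/\ K 1, forall x y, K x -> K y -> K (x - y) & forall x y, K x -> K y -> K (x * y)].

Section Subring.
Variables (R : comPzRingType) (K : set R) (hK : subring K).

Lemma subring0 : K 0. Proof. by case: hK => h1 h2 _; rewrite -(subrr 1); apply: h2. Qed.

Lemma subringN x : K x -> K (- x).
Proof. by case: hK => h1 h2 _ Kx; rewrite -sub0r; apply: h2 => //; exact: subring0. Qed.

Lemma subringD x y : K x -> K y -> K (x + y).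
Proof. by case: (hK) => _ h _ Kx Ky; rewrite -(opprK y); apply: h => //; exact: subringN. Qed.

Lemma subringM x y : K x -> K y -> K (x * y). Proof. by case: hK => _ _; apply. Qed.

Lemma subringX x n : K x -> K (x ^+ n).
Proof.
by move=> Kx; elim: n => [|n IHn]; [case: hK | rewrite exprS; exact: subringM].
Qed.

Lemma subring_sum (T : Type) (l : seq T) (Q : pred T) (G : T -> R) :
  (forall i, Q i -> K (G i)) -> K (\sum_(i <- l | Q i) G i).
Proof.
move=> h; elim/big_rec: _ => [|i x Qi Kx]; first exact: subring0.
by apply: subringD => //; exact: h.
Qed.

Lemma subring_nat n : K n%:R.
Proof. by elim: n => [|n IHn]; [exact: subring0 | rewrite mulrS; apply: subringD; case: hK]. Qed.

Lemma subring_adjoin d s (h : nat -> R) : (0 < d)%N -> (forall i, K (h i)) ->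
  s ^+ d = \sum_(i < d) h i * s ^+ i ->
  subring [set x | exists2 f : nat -> R, forall i, K (f i) & x = \sum_(i < d) f i * s ^+ i].
Proof.
move=> d0 hh Es; set G := [set x | _].
have GK x : K x -> G x.
  move=> Kx; exists (fun i => if i is 0%N then x else 0).
    by case=> // i; exact: subring0.
  case: (d) d0 => // d' _; rewrite big_ord_recl /= mulr1 big1 ?addr0 // => i _.
  by rewrite mul0r.
have GB x y : G x -> G y -> G (x - y).
  move=> [f hf ->] [g hg ->]; exists (fun i => f i - g i).
    by move=> i; case: hK => _ h2 _; exact: h2.
  by rewrite -sumrB; apply: eq_bigr => i _; rewrite mulrBl.
have G0 : G 0 by apply: GK; exact: subring0.
have GD x y : G x -> G y -> G (x + y).
  by move=> Gx Gy; rewrite -(opprK y) -[- y]sub0r; apply: (GB) => //; exact: (GB).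
have GM x y : K x -> G y -> G (x * y).
  move=> Kx [f hf ->]; exists (fun i => x * f i); first by move=> i; exact: subringM.
  by rewrite mulr_sumr; apply: eq_bigr => i _; rewrite mulrA.
have Gs y : G y -> G (s * y).
  move=> [f hf ->]; case Ed : d d0 => [|d'] // _.
  rewrite big_ord_recr /= mulrDr; apply: GD; last first.
    rewrite mulrCA -exprS -Ed; apply: GM => //; exists h => //; by rewrite Es.
  exists (fun i => if i is i'.+1 then f i' else 0).
    by case=> [|i] //=; exact: subring0.
  rewrite Ed big_ord_recl /= mul0r add0r mulr_sumr; apply: eq_bigr => i _.
  by rewrite mulrCA -exprS.
split=> //; first by apply: GK; case: hK.
move=> x y Gx [f hf ->]; rewrite mulr_sumr.
elim/big_rec: _ => // i z _ Gz; apply: GD => //.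
have -> : x * (f i * s ^+ i) = f i * (s ^+ i * x) by ring.
apply: GM => //; elim: (nat_of_ord i) => [|n IHn]; first by rewrite mul1r.
by rewrite exprS -mulrA; exact: Gs.
Qed.

End Subring.

(** * Coefficient fields *)

Section CoefficientField.
Variables (C : comPzRingType) (M : set C) (p : nat).
Implicit Types (x y s t e : C) (K L : set C).
Hypotheses (hM : loc M) (prime_p : prime p) (charp : p%:R = 0 :> C).

Lemma frobeniusD x y : (x + y) ^+ p = x ^+ p + y ^+ p.
Proof.
have p0 := prime_gt0 prime_p; rewrite exprDn; case Ep : p p0 => [//|p'] _.
rewrite big_ord_recr big_ord_recl /= subn0 subnn !expr0 mulr1 mul1r bin0 binn !mulr1n.
rewrite big1 ?addr0 // => i _; rewrite -mulr_natr -Ep.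
have /dvdnP[k ->] : (p %| 'C(p, bump 0 i))%N.
  by apply: prime_dvd_bin => //; rewrite /bump leq0n add1n /= Ep ltnS ltn_ord.
by rewrite natrM charp mulr0 mulr0.
Qed.

Lemma frobeniusB x y : (x - y) ^+ p = x ^+ p - y ^+ p.
Proof. by apply/eqP; rewrite eq_sym subr_eq -frobeniusD subrK. Qed.

Definition lifts n K :=
  [/\ subring K, ideal_pow M n `<=` K, forall x, K x -> M x -> ideal_pow M n x
    & forall x, exists2 y, K y & M (x - y)].

Let hM' : is_ideal M. Proof. by case: hM. Qed.
Let pM : is_prime M. Proof. by apply: loc_prime. Qed.

Lemma nat_unit d : (0 < d < p)%N -> ~ M d%:R.
Proof.
move=> /andP[d0 dp] Md; apply: (primeN1 pM).
have co : coprime d p by rewrite coprime_sym prime_coprime // gtnNdvd.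
have [u v e _] := egcdnP p d0.
rewrite (eqP co) in e; have := congr1 (fun n => n%:R : C) e.
rewrite natrD !natrM charp mulr0 add0r => h; rewrite -[1]/(1%:R) -h.
exact: idealMl.
Qed.

(** First-order Taylor expansion, for Newton's method with a correction [e] of square zero modulo
    [I]. *)
Lemma pow_sub_mod I s e i : is_ideal I -> I (e ^+ 2) ->
  I ((s - e) ^+ i - (s ^+ i - e * (i%:R * s ^+ i.-1))).
Proof.
move=> hI he; elim: i => [|i IHi].
  by rewrite !expr0 mul0r mulr0 subr0 subrr; exact: ideal0.
rewrite exprS; case: i IHi => [|i] IHi.
  have -> : (s - e) * (s - e) ^+ 0 - (s ^+ 1 - e * (1%:R * s ^+ 1.-1)) = 0.
    by rewrite !expr0 expr1 /=; ring.
  exact: ideal0.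
have -> : (s - e) * (s - e) ^+ i.+1 - (s ^+ i.+2 - e * (i.+2%:R * s ^+ i.+2.-1)) =
    (s - e) * ((s - e) ^+ i.+1 - (s ^+ i.+1 - e * (i.+1%:R * s ^+ i.+1.-1))) +
    i.+1%:R * s ^+ i * e ^+ 2.
  by rewrite /= !exprS (natrD _ 1 i.+1); ring.
by apply: idealD => //; exact: idealMl.
Qed.

(* If the residue of [t] is not in that of the maximal [L], then a monic relation for [t]
   modulo [M] of least degree [d] has [d <= p]. If [d < p] its derivative does not vanish
   at [t], so that Newton's method makes it hold modulo [M ^ n.+1]; otherwise use
   [t ^ p \in L]. *)
Lemma lifts_step n K : (0 < n)%N -> lifts n K -> exists2 L, lifts n.+1 L & L `<=` K.
Proof.
move=> n0 [hK MK KM Ksurj]; have Mn := ideal_pow_ideal M n.+1.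
have Mle : ideal_pow M n.+1 `<=` ideal_pow M n by exact: ideal_pow_le.
(* This is [K ^ p + M ^ n.+1]. If [a] in [K] lies in [M], it lies in [M ^ n], and [a ^ p] lies in
   [M ^ n.+1] since [p > 1]; so [L0] has the right intersection with [M], and only its residue field
   may be too small. *)
pose L0 : set C := [set x | exists2 a, K a & ideal_pow M n.+1 (x - a ^+ p)].
pose P : set (set C) := fun L => [/\ subring L, L0 `<=` L, L `<=` K
  & forall x, L x -> M x -> ideal_pow M n.+1 x].
have ML0 x : ideal_pow M n.+1 x -> L0 x.
  move=> hx; exists 0; first exact: subring0 hK.
  by rewrite expr0n eqn0Ngt prime_gt0 // subr0.
have L0p x : K x -> L0 (x ^+ p).
  by move=> Kx; exists x => //; rewrite subrr; exact: ideal0.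
have [|G GP [X0 GX0] Gtot|L [[hL L0L LK LM] _ max]] := @zorn_above _ P L0.
- split=> //.
  + split; first by exists 1; [case: hK | rewrite expr1n subrr; exact: ideal0].
      move=> x y [a Ka ha] [b Kb hb]; exists (a - b); first by case: hK => _ h _; exact: h.
      rewrite frobeniusB; have -> : x - y - (a ^+ p - b ^+ p) = (x - a ^+ p) - (y - b ^+ p) by ring.
      exact: (idealB Mn).
    move=> x y [a Ka ha] [b Kb hb]; exists (a * b); first exact: subringM.
    have -> : x * y - (a * b) ^+ p = y * (x - a ^+ p) + a ^+ p * (y - b ^+ p).
      by rewrite exprMn; ring.
    by apply: (idealD Mn); exact: (idealMl _ Mn).
  + move=> x [a Ka ha]; rewrite -(subrK (a ^+ p) x); apply: subringD => //.
      by apply: MK; exact: Mle.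
    exact: subringX.
  + move=> x [a Ka ha] Mx.
    have Ma : M a.
      apply: (@primeX _ _ _ p) => //; rewrite -(subKr x (a ^+ p)); apply: idealB => //.
      by apply: ideal_mul_subl ha; exact: hM'.
    rewrite -(subrK (a ^+ p) x); apply: (idealD Mn) => //.
    have : ideal_pow M (1 + n) (a * a ^+ p.-1).
      apply: ideal_powM; first by rewrite ideal_pow1.
      have := KM a Ka Ma; case: (p) (prime_gt1 prime_p) => [|[|q]] //= _ h.
      by rewrite exprS; exact: (idealMr _ (ideal_pow_ideal M n)).
    by rewrite add1n -exprS prednK // prime_gt0.
- have sub X : G X -> subring X by move=> /GP[].
  split.
  + split; first by exists X0 => //; case: (sub _ GX0).
      move=> x y [X GX Xx] [Y GY Yy]; have [XY|YX] := Gtot X Y GX GY.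
        by exists Y => //; case: (sub _ GY) => _ h _; apply: h => //; exact: XY.
      by exists X => //; case: (sub _ GX) => _ h _; apply: h => //; exact: YX.
    move=> x y [X GX Xx] [Y GY Yy]; have [XY|YX] := Gtot X Y GX GY.
      by exists Y => //; case: (sub _ GY) => _ _ h; apply: h => //; exact: XY.
    by exists X => //; case: (sub _ GX) => _ _ h; apply: h => //; exact: YX.
  + by move=> x L0x; exists X0 => //; case: (GP _ GX0) => _ h _ _; exact: h.
  + by move=> x [X GX Xx]; case: (GP _ GX) => _ _ h _; exact: h.
  + by move=> x [X GX Xx]; case: (GP _ GX) => _ _ _ h; exact: h.
exists L => //; split=> //; first by move=> x /ML0 /L0L.
suff surj t : K t -> exists2 y, L y & M (t - y).
  move=> x; have [y Ky My] := Ksurj x; have [z Lz Mz] := surj y Ky; exists z => //.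
  have -> : x - z = (x - y) + (y - z) by ring.
  exact: idealD.
move=> Kt; apply: contrapT => no.
pose rel d (g : nat -> C) u := (forall i, L (g i)) /\ u = u ^+ d - \sum_(i < d) g i * t ^+ i.
pose indep d := forall f : nat -> C, (forall i, L (f i)) -> M (\sum_(i < d) f i * t ^+ i) ->
  forall i, (i < d)%N -> M (f i).
(* The inverse of [x] is [x ^ p.-1] times the [p]-th power of an inverse in [K], and [p]-th powers
   of elements of [K] are in [L]. *)
have inv x : L x -> ~ M x -> exists2 y, L y & M (y * x - 1).
  move=> Lx nMx; case: (hM) => _ _ /(_ x nMx)[y xy].
  have [y' Ky' My'] := Ksurj y; exists (x ^+ p.-1 * y' ^+ p).
    by apply: subringM => //; [exact: subringX | apply: L0L; exact: L0p].
  have -> : x ^+ p.-1 * y' ^+ p * x - 1 = (x * y') ^+ p - 1.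
    have Ep : x ^+ p = x ^+ p.-1 * x by rewrite -exprSr prednK // prime_gt0.
    by rewrite exprMn Ep; ring.
  rewrite -[X in _ - X](expr1n _ p) -frobeniusB.
  have Ep (v : C) : v ^+ p = v ^+ p.-1 * v by rewrite -exprSr prednK // prime_gt0.
  rewrite Ep; apply: idealMl => //.
  have -> : x * y' - 1 = - (x * (y - y')) by rewrite -xy; ring.
  by apply: idealN => //; exact: idealMl.
have [d [d0 dp ind [g Lg Mg]]] : exists d, [/\ (0 < d)%N, (d <= p)%N, indep d &
    exists2 g : nat -> C, (forall i, L (g i)) & M (t ^+ d - \sum_(i < d) g i * t ^+ i)].
  have indS d : indep d -> (exists2 g : nat -> C, (forall i, L (g i)) &
      M (t ^+ d - \sum_(i < d) g i * t ^+ i)) \/ indep d.+1.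
    move=> ind; have [h|no'] := EM (exists2 g : nat -> C, (forall i, L (g i)) &
      M (t ^+ d - \sum_(i < d) g i * t ^+ i)); [by left | right].
    move=> f Lf; rewrite big_ord_recr /= => Mf.
    have Mfd : M (f d).
      apply: contrapT => nM; have [y Ly My] := inv _ (Lf d) nM.
      apply: no'; exists (fun i => - (y * f i)).
        by move=> i; apply: subringN => //; exact: subringM.
      have -> : t ^+ d - \sum_(i < d) - (y * f i) * t ^+ i =
          y * (\sum_(i < d) f i * t ^+ i + f d * t ^+ d) - (y * f d - 1) * t ^+ d.
        under eq_bigr => i _ do rewrite mulNr -mulrA.
        by rewrite sumrN -mulr_sumr; ring.
      by apply: idealB => //; [exact: idealMl | exact: idealMr].
    have Mf' : M (\sum_(i < d) f i * t ^+ i).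
      by apply: idealDr Mf => //; exact: idealMr.
    by move=> i; rewrite ltnS leq_eqVlt => /orP[/eqP -> //|]; exact: ind.
  have ind0 : indep 0%N by [].
  have tp : exists2 g : nat -> C, (forall i, L (g i)) & M (t ^+ p - \sum_(i < p) g i * t ^+ i).
    exists (fun i => if i is 0%N then t ^+ p else 0).
      by case=> [|i]; [apply: L0L; exact: L0p | exact: subring0 hL].
    case: (p) (prime_gt0 prime_p) => // q _; rewrite big_ord_recl /= mulr1 big1 ?addr0.
      by rewrite subrr; exact: ideal0.
    by move=> i _; rewrite mul0r.
  have [d [dp ind h]] : exists d, [/\ (d <= p)%N, indep d & exists2 g : nat -> C, (forall i, L (g i)) &
      M (t ^+ d - \sum_(i < d) g i * t ^+ i)].
    have : exists d, [/\ (d <= p)%N, indep d & (exists2 g : nat -> C, (forall i, L (g i)) &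
        M (t ^+ d - \sum_(i < d) g i * t ^+ i)) \/ d = p].
      suff h k : (k <= p)%N -> (exists d, [/\ (d <= p)%N, indep d & (exists2 g : nat -> C, (forall i, L (g i)) &
        M (t ^+ d - \sum_(i < d) g i * t ^+ i)) \/ d = p]) \/ indep k.
        by case: (h p (leqnn _)) => // ind; exists p; split=> //; right.
      elim: k => [|k IHk] kp; first by right.
      case: (IHk (ltnW kp)) => [h|/[dup] ik /indS[h|ik']]; [by left | | by right].
      by left; exists k; split=> //; [exact: ltnW | left].
    by move=> [d [dp ind [h|Ed]]]; exists d; split=> //; rewrite Ed.
  exists d; split=> //; case: (d) h => // -[g _]; rewrite big_ord0 expr0 subr0.
  by move/(primeN1 pM).
have [s [Ks Mst [h Lh Es]]] : exists s, [/\ K s, M (s - t) &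
    exists2 h : nat -> C, (forall i, L (h i)) & s ^+ d = \sum_(i < d) h i * s ^+ i].
  have [Ed|nd] := eqVneq d p.
    exists t; split=> //; first by rewrite subrr; exact: ideal0.
    exists (fun i => if i is 0%N then t ^+ p else 0).
      by case=> [|i]; [apply: L0L; exact: L0p | exact: subring0 hL].
    rewrite Ed; case: (p) (prime_gt0 prime_p) => // q _; rewrite big_ord_recl /= mulr1 big1 ?addr0 //.
    by move=> i _; rewrite mul0r.
  pose g' := d%:R * t ^+ d.-1 - \sum_(i < d) g i * (i%:R * t ^+ i.-1).
  have ng' : ~ M g'.
    (* Otherwise the derivative is a relation of degree [d.-1] whose leading coefficient [d] is a
       unit, against [indep d]. *)
    move=> Mg'; pose f i := if i == d.-1 then d%:R else - (g i.+1 * i.+1%:R).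
    have hf i : L (f i).
      rewrite /f; case: eqP => _; first exact: subring_nat.
      by apply: subringN => //; apply: subringM => //; exact: subring_nat.
    have dd : (0 < d < p)%N by rewrite d0 ltn_neqAle nd dp.
    have := ind f hf; case Ed : d d0 => [//|d'] _ h; apply: (nat_unit dd).
    have := h _ d' (ltnSn _); rewrite /f Ed eqxx; apply.
    rewrite big_ord_recr /= eqxx; move: Mg'; rewrite /g' Ed /= big_ord_recl /= mul0r mulr0 add0r.
    set a := \sum_(i < d') _; set b := \sum_(i < d') _; suff -> : b = - a by rewrite addrC.
    rewrite -sumrN; apply: eq_bigr => i _; rewrite ifN; last by rewrite neq_ltn ltn_ord.
    by rewrite /bump leq0n add1n /= mulNr mulrA.
  pose G x := x ^+ d - \sum_(i < d) g i * x ^+ i.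
  have KG : K (G t).
    rewrite /G; case: (hK) => _ hB _; apply: hB; first exact: subringX.
    by apply: subring_sum => // i _; apply: subringM => //; [exact: LK | exact: subringX].
  have MG : ideal_pow M n (G t) by exact: KM.
  case: (hM) => _ _ /(_ g' ng')[e' ge'].
  pose e := G t * e'; have Me : ideal_pow M n e by exact: (idealMr _ (ideal_pow_ideal M n)).
  have Me2 : ideal_pow M n.+1 (e ^+ 2).
    rewrite expr2; have := ideal_powM Me Me; apply: ideal_pow_le; lia.
  have MG1 : ideal_pow M n.+1 (G (t - e)).
    have -> : G (t - e) = ((t - e) ^+ d - (t ^+ d - e * (d%:R * t ^+ d.-1))) -
       \sum_(i < d) g i * ((t - e) ^+ i - (t ^+ i - e * (i%:R * t ^+ i.-1))) +
       (G t - e * g').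
      rewrite /G /g' mulrBr mulr_sumr.
      have -> : \sum_(i < d) g i * ((t - e) ^+ i - (t ^+ i - e * (i%:R * t ^+ i.-1))) =
        \sum_(i < d) g i * (t - e) ^+ i - \sum_(i < d) g i * t ^+ i +
        \sum_(i < d) e * (g i * (i%:R * t ^+ i.-1)).
        by rewrite -sumrB -big_split /=; apply: eq_bigr => i _; ring.
      by ring.
    apply: (idealD Mn); last first.
      have -> : G t - e * g' = G t - G t * (g' * e') by rewrite /e; ring.
      by rewrite ge' mulr1 subrr; exact: (ideal0 Mn).
    apply: (idealB Mn); first exact: (@pow_sub_mod _ _ _ _ Mn Me2).
    by apply: (ideal_sum _ Mn) => i _; apply: (idealMl _ Mn); exact: (@pow_sub_mod _ _ _ _ Mn Me2).
  exists (t - e); split.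
  - by case: (hK) => _ hB _; apply: hB => //; exact: MK.
  - rewrite addrC addKr; apply: idealN => //.
    by have := ideal_pow_le n0 Me; rewrite ideal_pow1.
  (* The remaining error [G (t - e)] is in [M ^ n.+1], which is part of [L]; absorbed in the
     constant coefficient, it turns the congruence into an exact equation for [s]. *)
  exists (fun i => if i is 0%N then g 0%N + G (t - e) else g i).
    by case=> [|i] //; apply: subringD => //; apply: L0L; exact: ML0.
  rewrite -[LHS](subrK (\sum_(i < d) g i * (t - e) ^+ i)) -/(G (t - e)).
  case: (d) d0 => // d' _; rewrite !big_ord_recl /= !mulr1; ring.
(* [L'] is [L[s]]. Independence of the powers of [t] modulo [M] keeps its intersection with [M]
   inside [M ^ n.+1], so maximality of [L] puts [s] in [L], against [no]. *)
pose L' : set C := [set x | exists2 f : nat -> C, forall i, L (f i) & x = \sum_(i < d) f i * s ^+ i].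
have hL' : subring L' by apply: (subring_adjoin hL d0 Lh Es).
have LL' : L `<=` L'.
  move=> x Lx; exists (fun i => if i is 0%N then x else 0).
    by case=> [|i] //; exact: subring0 hL.
  case: (d) d0 => // d' _; rewrite big_ord_recl /= mulr1 big1 ?addr0 // => i _.
  by rewrite mul0r.
have powst i : M (s ^+ i - t ^+ i).
  by rewrite subrXX; apply: idealMr.
have PL' : P L'.
  split=> //; first exact: subset_trans LL'.
    move=> x [f Lf ->]; apply: subring_sum => // i _; apply: subringM => //; first exact: LK.
    exact: subringX.
  move=> x [f Lf ->] Mx; apply: (ideal_sum _ Mn) => i _; apply: (idealMr _ Mn).
  apply: LM => //; apply: (ind f) => //.
  have -> : \sum_(i < d) f i * t ^+ i = \sum_(i < d) f i * s ^+ i - \sum_(i < d) f i * (s ^+ i - t ^+ i).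
    by rewrite -sumrB; apply: eq_bigr => j _; ring.
  by apply: idealB => //; apply: ideal_sum => // j _; exact: idealMl.
have Ls : L s.
  apply: (max L' PL' LL'); case Ed : d d0 => [//|[|d']] _.
    by apply: LL'; move: Es; rewrite Ed expr1 big_ord_recl big_ord0 /= mulr1 addr0 => ->.
  exists (fun i => if i == 1%N then 1 else 0).
    by move=> i; case: eqP => _; [case: hL | exact: subring0 hL].
  rewrite Ed big_ord_recl big_ord_recl /= mul0r add0r mul1r big1 ?addr0 // => i _.
  by rewrite mul0r.
by apply: no; exists s => //; rewrite -opprB; exact: idealN.
Qed.

(** The field is the intersection of nested lifts [K n]. Representatives of a residue class chosen
    in the [K n] have successive differences in the intersection of [K n] and [M], hence in
    [M ^ n.+1], and converge. *)
Lemma coefficient_field : complete_for M (ideal_pow M) -> exists k : set C,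
  [/\ subring k, forall x, k x -> M x -> x = 0 & forall x, exists2 y, k y & M (x - y)].
Proof.
move=> [_ _ sep lim].
have step (nK : nat * set C) : exists L, (0 < nK.1)%N -> lifts nK.1 nK.2 ->
    lifts nK.1.+1 L /\ L `<=` nK.2.
  case: nK => n K; have [[n0 hK]|no] := EM ((0 < n)%N /\ lifts n K).
    by have [L hL LK] := lifts_step n0 hK; exists L.
  by exists K => n0 hK; case: no.
have [nx hnx] := choice step.
pose fix K n : set C := if n is n'.+1 then nx (n'.+1, K n') else setT.
have hK n : lifts n.+1 (K n).
  elim: n => [|n IHn]; last by have [] := hnx (n.+1, K n) isT IHn.
  split=> //; first by move=> x _ Mx; rewrite ideal_pow1.
  by move=> x; exists x => //; rewrite subrr; exact: ideal0.
have KS n : K n.+1 `<=` K n by have [] := hnx (n.+1, K n) isT (hK n).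
have Kmono m n : (m <= n)%N -> K n `<=` K m.
  by move=> mn; rewrite -(subnK mn); elim: (n - m)%N => // k IHk x /KS /IHk.
exists (\bigcap_n K n); split.
- split=> [n _|x y hx hy n _|x y hx hy n _]; have [[h1 h2 h3] _ _ _] := hK n.
  + exact: h1.
  + by apply: h2; [exact: hx | exact: hy].
  + by apply: h3; [exact: hx | exact: hy].
- move=> x kx Mx; apply: sep => n; have [_ _ h _] := hK n.
  by apply: ideal_pow_le (h x (kx n I) Mx); exact: leqnSn.
move=> x; have /choice[y hy] : forall n, exists y, K n y /\ M (x - y).
  by move=> n; have [_ _ _ /(_ x)[y Ky My]] := hK n; exists y.
have dy n : ideal_pow M n.+1 (y n.+1 - y n).
  have [[_ h _] _ h' _] := hK n; apply: h'.
    by apply: h; [apply: KS; case: (hy n.+1) | case: (hy n)].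
  have -> : y n.+1 - y n = (x - y n) - (x - y n.+1) by ring.
  by apply: idealB => //; [case: (hy n) | case: (hy n.+1)].
pose u n := if n is n'.+1 then y n'.+1 - y n' else 0.
have [|z hz] := lim u.
  by case=> [|n]; [exact: ideal0 | exact: dy].
have su n : \sum_(i < n.+1) u i = y n - y 0%N.
  elim: n => [|n IHn]; first by rewrite big_ord_recl big_ord0 /= subrr addr0.
  by rewrite big_ord_recr /= IHn; ring.
have hw n : ideal_pow M n.+1 (z + y 0%N - y n).
  have := hz n.+1; rewrite su; congr (ideal_pow M n.+1); ring.
exists (z + y 0%N).
  move=> n _; have [hKn MK _ _] := hK n.
  by rewrite -(subrK (y n) (z + y 0%N)); apply: subringD => //; [exact: MK | case: (hy n)].
have -> : x - (z + y 0%N) = (x - y 0%N) - (z + y 0%N - y 0%N) by ring.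
apply: idealB => //; first by case: (hy 0%N).
by have := hw 0%N; rewrite ideal_pow1.
Qed.

End CoefficientField.

Section SubringType.
Variables (B : comPzRingType) (S : {K : set B | subring K}).

Definition in_subring : {pred B} := fun x => `[< sval S x >].

Lemma in_subring_closed : subring_closed in_subring.
Proof.
have [h1 h2 h3] := svalP S; split; first exact/asboolP.
  by move=> x y /asboolP hx /asboolP hy; apply/asboolP; exact: h2.
by move=> x y /asboolP hx /asboolP hy; apply/asboolP; exact: h3.
Qed.

Definition subring_of := {x : B | x \in in_subring}.
HB.instance Definition _ := SubChoice.on subring_of.
HB.instance Definition _ :=
  GRing.SubChoice_isSubComPzRing.Build B in_subring subring_of in_subring_closed.

End SubringType.

(** It turns the power series subring, defined as a set, into a ring to which the theory of ideals
    and of regular sequences applies. *)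
Lemma subring_type (B : comPzRingType) (K : set B) : subring K ->
  exists (A : comPzRingType) (v : {rmorphism A -> B}),
    injective v /\ forall x, K x <-> exists a, v a = x.
Proof.
move=> hK; pose S : {K : set B | subring K} := exist _ K hK.
exists (subring_of S), (\val : {rmorphism subring_of S -> B}).
split; first exact: val_inj.
move=> x; split=> [Kx|[[a /asboolP ha] <-] //].
have Sx : x \in in_subring S by apply/asboolP.
by exists (exist _ x Sx).
Qed.

Section RMorphismIdeals.
Variables (A B : comPzRingType) (v : {rmorphism A -> B}).
Implicit Types (I : set A) (J : set B) (s : seq A).

Lemma preimage_ideal J : is_ideal J -> is_ideal (v @^-1` J).
Proof.
move=> hJ; split; first by rewrite /preimage /= rmorph0; exact: ideal0.
by move=> a x y hx hy; rewrite /preimage /= rmorphD rmorphM; exact: hJ.2.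
Qed.

Lemma preimage_prime J : is_prime J -> is_prime (v @^-1` J).
Proof.
move=> hJ; split; first by apply: preimage_ideal; auto.
  by rewrite /preimage /= rmorph1; exact: primeN1.
by move=> x y; rewrite /preimage /= rmorphM; exact: primeM.
Qed.

Lemma adj_preimage I J s : is_ideal J -> I `<=` v @^-1` J ->
  adj I s `<=` v @^-1` (adj J (map v s)).
Proof.
move=> hJ hI; apply: adj_min; first by apply: preimage_ideal; auto.
  by move=> x /hI; exact: (adj_sub _ hJ).
by move=> x xs; apply: (adj_mem hJ); exact: map_f.
Qed.

Lemma ideal_pow_preimage I J n : I `<=` v @^-1` J ->
  ideal_pow I n `<=` v @^-1` (ideal_pow J n).
Proof.
move=> IJ; elim: n => [//|n IHn]; apply: ideal_mul_min; first by apply: preimage_ideal.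
move=> x y /IJ Jx /IHn hy; rewrite /preimage /= rmorphM; exact: ideal_mulM.
Qed.

Lemma map_pw s u : map v (pw s u) = pw (map v s) u.
Proof.
by elim: s u => [|x s IHs] [|k u] //=; rewrite rmorphXn; congr (_ :: _); exact: IHs.
Qed.

End RMorphismIdeals.

(** * Noether normalization of complete local rings *)

Section PowerSeriesSubring.
Variables (B : comPzRingType) (M k : set B) (z : seq B).
Hypotheses (hM : loc M) (cB : complete_for M (ideal_pow M)).
Hypotheses (hk : subring k) (kM : forall x, k x -> M x -> x = 0).
Hypotheses (ksurj : forall x, exists2 y, k y & M (x - y)) (zM : forall x, x \in z -> M x).
Implicit Types (X : set B) (x y a c : B) (h g : nat -> B).

Let hM' : is_ideal M. Proof. by case: hM. Qed.

Definition expand X : set B := [set x | exists c h,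
  [/\ k c, forall i, X (h i) & x = c + \sum_(i < size z) h i * z`_i]].

(* The image of [k[[Z_1, ..., Z_r]]], as a greatest fixed point. *)
Definition pseries : set B := [set x | exists2 X, X `<=` expand X & X x].

Lemma pseries_coind X : X `<=` expand X -> X `<=` pseries.
Proof. by move=> hX x Xx; exists X. Qed.

Lemma pseries_expand : pseries `<=` expand pseries.
Proof.
move=> x [X hX /hX[c [h [kc Xh ->]]]]; exists c, h; split=> // i.
by exists X.
Qed.

Lemma pseries_const : k `<=` pseries.
Proof.
apply: pseries_coind => x kx; exists x, (fun=> 0); split=> //.
  by move=> _; exact: subring0.
by rewrite big1 ?addr0 // => i _; rewrite mul0r.
Qed.

Lemma pseries0 : pseries 0. Proof. by apply: pseries_const; exact: subring0. Qed.

Lemma pseriesB x y : pseries x -> pseries y -> pseries (x - y).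
Proof.
move=> hx hy; pose X : set B := [set v | exists a b, [/\ pseries a, pseries b & v = a - b]].
suff: X `<=` pseries by apply; exists x, y.
apply: pseries_coind => _ [a [b [/pseries_expand[c [h [kc hh ->]]]
  /pseries_expand[d [g [kd hg ->]]] ->]]].
exists (c - d), (fun i => h i - g i); split; first by case: hk => _ hB _; exact: hB.
  by move=> i; exists (h i), (g i).
under [in RHS]eq_bigr => i _ do rewrite mulrBl.
by rewrite sumrB; ring.
Qed.

Lemma pseriesD x y : pseries x -> pseries y -> pseries (x + y).
Proof.
move=> hx hy; rewrite -(opprK y); apply: pseriesB => //.
by rewrite -sub0r; apply: pseriesB => //; exact: pseries0.
Qed.

(** The tail of a product is a sum of products, so the set used for the coinduction consists of
    finite sums of products. *)
Lemma pseriesM x y : pseries x -> pseries y -> pseries (x * y).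
Proof.
move=> hx hy; pose X : set B := [set w | exists s : seq (B * B),
  (forall p, p \in s -> pseries p.1 /\ pseries p.2) /\ w = \sum_(p <- s) p.1 * p.2].
have XD a b : X a -> X b -> X (a + b).
  move=> [s [hs ->]] [t [ht ->]]; exists (s ++ t); split; last by rewrite big_cat.
  by move=> p; rewrite mem_cat => /orP[/hs|/ht].
have XM a b : pseries a -> pseries b -> X (a * b).
  move=> ha hb; exists [:: (a, b)]; split; last by rewrite big_seq1.
  by move=> p; rewrite inE => /eqP ->.
have X0 : X 0 by rewrite -(mul0r 0); apply: XM; exact: pseries0.
suff: X `<=` pseries by apply; exact: XM.
apply: pseries_coind => _ [s [hs ->]].
elim: s hs => [_|[a b] s IHs hs].
  rewrite big_nil; exists 0, (fun=> 0); split=> //; first exact: subring0.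
  by rewrite big1 ?addr0 // => i _; rewrite mul0r.
have [|c [h [kc hh E]]] := IHs.
  by move=> p ps; apply: hs; rewrite inE ps orbT.
rewrite big_cons E /=; have [/= pa pb] := hs (a, b) (mem_head _ _).
have [d [f [kd hf Ea]]] := pseries_expand pa.
have [e [g [ke hg Eb]]] := pseries_expand pb.
exists (d * e + c), (fun i => (d * g i + f i * b) + h i); split.
- by apply: subringD => //; exact: subringM.
- by move=> i; apply: (XD) => //; apply: (XD); apply: XM => //; exact: pseries_const.
have -> : \sum_(i < size z) (d * g i + f i * b + h i) * z`_i =
  d * (\sum_(i < size z) g i * z`_i) + (\sum_(i < size z) f i * z`_i) * b +
  \sum_(i < size z) h i * z`_i.
  rewrite mulr_sumr mulr_suml -!big_split /=; apply: eq_bigr => i _; ring.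
have -> : a * b = d * (e + \sum_(i < size z) g i * z`_i) + (\sum_(i < size z) f i * z`_i) * b.
  by rewrite -Eb {1}Ea mulrDl.
by ring.
Qed.

Lemma pseries_subring : subring pseries.
Proof.
split; [by apply: pseries_const; case: hk | exact: pseriesB | exact: pseriesM].
Qed.

Lemma pseries_var x : x \in z -> pseries x.
Proof.
move=> xz; pose X : set B := [set y | k y \/ y \in z].
suff: X `<=` pseries by apply; right.
apply: pseries_coind => y [ky|yz].
  exists y, (fun=> 0); split=> //; first by move=> _; left; exact: subring0.
  by rewrite big1 ?addr0 // => i _; rewrite mul0r.
exists 0, (fun i => if i == index y z then 1 else 0); split; first exact: subring0.
  by move=> i; left; case: eqP => _; [case: hk | exact: subring0].
have iy : (index y z < size z)%N by rewrite index_mem.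
rewrite add0r (bigD1 (Ordinal iy)) //= eqxx mul1r nth_index // big1 ?addr0 // => i ni.
by rewrite ifN ?mul0r //; apply: contra ni => /eqP e; apply/eqP/val_inj.
Qed.

(** The [n]-th power of the ideal generated by [z] in [pseries], in nested form, so that one
    variable can be divided out at a time. *)
Fixpoint order_ge n : set B := if n is n'.+1 then
  [set x | exists2 h : nat -> B, forall i, order_ge n' (h i) & x = \sum_(i < size z) h i * z`_i]
  else pseries.

Lemma order_geD n x y : order_ge n x -> order_ge n y -> order_ge n (x + y).
Proof.
elim: n x y => [|n IHn] x y /=; first exact: pseriesD.
move=> [h hh ->] [g hg ->]; exists (fun i => h i + g i); first by move=> i; exact: IHn.
by rewrite -big_split /=; apply: eq_bigr => i _; rewrite mulrDl.
Qed.

Lemma order_geM n x y : pseries x -> order_ge n y -> order_ge n (x * y).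
Proof.
move=> hx; elim: n y => [|n IHn] y /=; first exact: pseriesM.
move=> [h hh ->]; exists (fun i => x * h i); first by move=> i; exact: IHn.
by rewrite mulr_sumr; apply: eq_bigr => i _; rewrite mulrA.
Qed.

Lemma order_ge0 n : order_ge n 0.
Proof.
elim: n => [|n IHn] /=; first exact: pseries0.
by exists (fun=> 0) => //; rewrite big1 // => i _; rewrite mul0r.
Qed.

Lemma order_ge_pow n : order_ge n `<=` ideal_pow M n.
Proof.
elim: n => [//|n IHn] x /= [h hh ->].
apply: (ideal_sum _ (ideal_pow_ideal M n.+1)) => i _; rewrite mulrC.
by apply: ideal_mulM; [apply: zM; exact: mem_nth | exact: IHn].
Qed.

(** The limits form a coinductive set: the constant comes from [t 0], and dividing the terms by the
    variables leaves, as coefficient of each variable, a limit of the same kind. The index shifts by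
    one, since [t n.+1] contributes a coefficient of order [n]. *)
Lemma pseries_lim (t : nat -> B) : (forall n, order_ge n (t n)) ->
  exists2 s, pseries s & forall N, ideal_pow M N (s - \sum_(i < N) t i).
Proof.
move=> ht; have [_ _ sep lim] := cB.
pose X : set B := [set s | exists2 t : nat -> B, (forall n, order_ge n (t n)) &
  forall N, ideal_pow M N (s - \sum_(i < N) t i)].
have [s hs] := lim t (fun n => order_ge_pow (ht n)).
exists s => //; suff: X `<=` pseries by apply; exists t.
apply: pseries_coind => {t ht s hs} s [t ht hs].
have [c [h [kc hh Et]]] := pseries_expand (ht 0%N).
have /choice[g hg] : forall n, exists g, (forall i, order_ge n (g i)) /\
    t n.+1 = \sum_(i < size z) g i * z`_i.
  by move=> n; have [g] := ht n.+1; exists g.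
pose u i n := (if n is 0%N then h i else 0) + g n i.
have hu i n : order_ge n (u i n).
  rewrite /u; apply: order_geD; last exact: (hg n).1.
  by case: n => [|n]; [exact: hh | exact: order_ge0].
have /choice[r hr] : forall i, exists r, forall N, ideal_pow M N (r - \sum_(n < N) u i n).
  by move=> i; apply: lim => n; apply: order_ge_pow; exact: hu.
exists c, r; split=> //; first by move=> i; exists (u i).
apply/eqP; rewrite -subr_eq0; apply/eqP/sep => N.
have hN := ideal_pow_ideal M N.
have E : \sum_(i < N.+1) t i = c + \sum_(i < size z) (\sum_(n < N.+1) u i n) * z`_i -
    \sum_(i < size z) g N i * z`_i.
  rewrite big_ord_recl Et -!addrA; congr (c + _).
  have -> : \sum_(i < N) t (bump 0 i) = \sum_(i < size z) (\sum_(n < N) g n i) * z`_i.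
    under eq_bigr => i _ do rewrite /bump leq0n add1n (hg i).2.
    by rewrite exchange_big /=; apply: eq_bigr => i _; rewrite mulr_suml.
  rewrite -big_split -sumrB /=; apply: eq_bigr => i _.
  have -> : \sum_(n < N.+1) u i n = h i + \sum_(n < N.+1) g n i.
    by rewrite big_split /= big_ord_recl /= big1 ?addr0.
  by rewrite big_ord_recr /=; ring.
have -> : s - (c + \sum_(i < size z) r i * z`_i) = (s - \sum_(i < N.+1) t i) -
    \sum_(i < size z) (r i - \sum_(n < N.+1) u i n) * z`_i - \sum_(i < size z) g N i * z`_i.
  have -> : \sum_(i < size z) (r i - \sum_(n < N.+1) u i n) * z`_i =
      \sum_(i < size z) r i * z`_i - \sum_(i < size z) (\sum_(n < N.+1) u i n) * z`_i.
    by rewrite -sumrB; apply: eq_bigr => i _; rewrite mulrBl.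
  by rewrite E; ring.
have le1 : ideal_pow M N.+1 `<=` ideal_pow M N by exact: ideal_pow_le.
apply: (idealB hN); first apply: (idealB hN).
- by apply: le1; exact: hs.
- by apply: (ideal_sum _ hN) => i _; apply: (idealMr _ hN); apply: le1; exact: hr.
by apply: (ideal_sum _ hN) => i _; apply: (idealMr _ hN); apply: order_ge_pow; exact: (hg N).1.
Qed.

Lemma const_inv c : k c -> c <> 0 -> exists2 d, k d & c * d = 1.
Proof.
move=> kc nc; have nMc : ~ M c by move=> Mc; apply: nc; exact: kM.
have [_ _ /(_ c nMc)[e ce]] := hM; have [d kd Md] := ksurj e.
exists d => //; apply/eqP; rewrite -subr_eq0; apply/eqP/kM.
  case: hk => h1 hB hMul; apply: hB => //; exact: hMul.
have -> : c * d - 1 = - (c * (e - d)) by rewrite -ce; ring.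
by apply: idealN => //; exact: idealMl.
Qed.

Section SeriesRing.
Variables (A : comPzRingType) (v : {rmorphism A -> B}) (zA : seq A).
Hypotheses (v_inj : injective v) (Av : forall x, pseries x <-> exists a : A, v a = x).
Hypothesis (vz : map v zA = z).

Let JA := adj [set 0] zA.

Let vA (a : A) : pseries (v a). Proof. by apply/Av; exists a. Qed.

Let hJA : is_ideal JA. Proof. by rewrite /JA; auto. Qed.

Let JAM : JA `<=` v @^-1` M.
Proof.
apply: adj_min; first exact: preimage_ideal.
  by move=> _ /= ->; rewrite /preimage /= rmorph0; exact: ideal0.
by move=> x xz; apply: zM; rewrite -vz; exact: map_f.
Qed.

Lemma series_expand (a : A) : exists c j : A, [/\ k (v c), JA j & a = c + j].
Proof.
have [c [h [kc hh E]]] := pseries_expand (vA a).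
have [c' Ec] := (Av c).1 (pseries_const kc).
have /choice[h' Eh] : forall i, exists b : A, v b = h i by move=> i; apply/Av.
exists c', (\sum_(i < size zA) h' i * zA`_i); split; first by rewrite Ec.
  by apply: sum_adj => // x; exact: adj_mem.
apply: v_inj; rewrite E rmorphD rmorph_sum Ec -vz size_map; congr (_ + _).
by apply: eq_bigr => i _; rewrite rmorphM Eh (nth_map 0).
Qed.

(** Limits exist in [A] by [pseries_lim]. An element outside [JA] has a nonzero constant term, which
    has an inverse in the coefficient field, and [loc_complete] does the rest. *)
Lemma series_loc_complete : loc JA /\ complete_for JA (fun N => v @^-1` (ideal_pow M N)).
Proof.
have cA : complete_for JA (fun N => v @^-1` (ideal_pow M N)).
  have [_ _ sep _] := cB; split.
  - by move=> N; apply: preimage_ideal.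
  - by move=> N; exact: ideal_pow_preimage.
  - by move=> a ha; apply: v_inj; rewrite rmorph0; apply: sep.
  move=> t ht.
  have hv n : ideal_pow JA n `<=` v @^-1` (order_ge n).
    elim: n => [|n IHn]; first by move=> a _; exact: vA.
    have oI m : is_ideal (v @^-1` (order_ge m)).
      split; first by rewrite /preimage /= rmorph0; exact: order_ge0.
      move=> a x y hx hy; rewrite /preimage /= rmorphD rmorphM.
      by apply: order_geD => //; apply: order_geM.
    apply: ideal_mul_min => // x y /adj0_sum[c ->] /IHn hy.
    exists (fun i => v (c i) * v y); first by move=> i; exact: order_geM.
    rewrite rmorphM rmorph_sum mulr_suml -vz size_map; apply: eq_bigr => i _.
    by rewrite rmorphM (nth_map 0) // mulrAC.
  have [s /Av[a <-] hs] := pseries_lim (fun n => hv n _ (ht n)).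
  by exists a => N; rewrite /preimage /= rmorphB rmorph_sum.
split=> //; apply: (loc_complete cA) => //.
  by move=> /JAM; rewrite /preimage /= rmorph1; case: hM.
move=> a na; have [c [j [kc Jj Ea]]] := series_expand a.
have [d kd cd] : exists2 d, k d & v c * d = 1.
  apply: const_inv => // c0; apply: na; rewrite Ea (_ : c = 0) ?add0r //.
  by apply: v_inj; rewrite c0 rmorph0.
have [d' Ed] := (Av d).1 (pseries_const kd).
exists d'; rewrite Ea mulrDl (_ : c * d' = 1); last by apply: v_inj; rewrite rmorphM rmorph1 Ed.
by rewrite addrC addKr; exact: idealMr.
Qed.

End SeriesRing.
End PowerSeriesSubring.

(** * Descent of regular sequences along a generically free extension *)

Section Span.
Variables (A B : comPzRingType) (v : {rmorphism A -> B}) (Q : set B).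
Hypotheses (hQ : is_ideal Q).
Implicit Types (c : set A) (E : seq B) (a : A) (x y b : B).

(** The preimage in [B] of the submodule of [B / Q] spanned by [E] with coefficients in [c]. *)
Fixpoint span c E : set B :=
  if E is x :: E' then [set y | exists2 a, c a & span c E' (y - v a * x)] else Q.

Fixpoint indep E : Prop :=
  if E is x :: E' then (forall a, span setT E' (v a * x) -> Q (v a)) /\ indep E' else True.

Lemma spanD c E x y : is_ideal c -> span c E x -> span c E y -> span c E (x + y).
Proof.
move=> hc; elim: E x y => [|e E IHE] x y /=; first exact: idealD.
move=> [a ca ha] [a' ca' ha']; exists (a + a'); first exact: idealD.
have -> : x + y - v (a + a') * e = (x - v a * e) + (y - v a' * e) by rewrite rmorphD; ring.
exact: IHE.
Qed.

Lemma spanM c c' E a x : (forall a', c a' -> c' (a * a')) -> span c E x ->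
  span c' E (v a * x).
Proof.
move=> hc; elim: E x => [|e E IHE] x /=; first exact: idealMl.
move=> [a' ca' ha']; exists (a * a'); first exact: hc.
have -> : v a * x - v (a * a') * e = v a * (x - v a' * e) by rewrite rmorphM; ring.
exact: IHE.
Qed.

Lemma span_base c E : is_ideal c -> Q `<=` span c E.
Proof.
move=> hc; elim: E => //= e E IHE x Qx; exists 0; first exact: ideal0.
by rewrite rmorph0 mul0r subr0; exact: IHE.
Qed.

Lemma spanS c c' E : c `<=` c' -> span c E `<=` span c' E.
Proof.
by move=> cc'; elim: E => //= e E IHE x [a /cc' ca /IHE h]; exists a.
Qed.

Lemma span_min c E (J : set B) : is_ideal J -> Q `<=` J -> c `<=` v @^-1` J ->
  span c E `<=` J.
Proof.
move=> hJ QJ cJ; elim: E => //= e E IHE x [a /cJ Ja /IHE h].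
by rewrite -(subrK (v a * e) x); apply: idealD => //; exact: idealMr.
Qed.

Lemma span_sum E (h : nat -> A) : span setT E (\sum_(i < size E) v (h i) * E`_i).
Proof.
elim: E h => [|e E IHE] h /=; first by rewrite big_ord0; exact: ideal0.
exists (h 0%N) => //; rewrite big_ord_recl /= addrAC subrr add0r.
exact: (IHE (fun i => h i.+1)).
Qed.

Hypothesis primeQ : is_prime Q.

(** [E] is a basis, over the field of fractions of the image of [A] in [B / Q], of the space spanned
    by [e]; [a] is a common denominator. *)
Lemma extract_basis e : exists E a, [/\ ~ Q (v a), indep E &
  forall y, span setT e y -> span setT E (v a * y)].
Proof.
elim: e => [|x e [E [a [na iE hE]]]].
  by exists [::], 1; rewrite rmorph1; split=> //; [exact: primeN1 | by move=> y; apply: idealMl].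
have [[a' na' ha']|no] := EM (exists2 a', ~ Q (v a') & span setT E (v a' * x)).
  exists E, (a * a'); split=> //; first by rewrite rmorphM; exact: primeNM.
  move=> y [a0 _ /hE h0].
  have -> : v (a * a') * y = v a' * (v a * (y - v a0 * x)) + v (a0 * a) * (v a' * x).
    by rewrite !rmorphM; ring.
  by apply: spanD => //; apply: (@spanM setT).
exists (x :: E), a; split=> //=.
  by split=> // a' h; apply: contrapT => na'; apply: no; exists a'.
move=> y [a0 _ /hE h0]; exists (a * a0) => //.
have -> : v a * y - v (a * a0) * x = v a * (y - v a0 * x) by rewrite rmorphM; ring.
exact: h0.
Qed.

(** On a free module the colon by [a] is computed coefficient by coefficient. *)
Lemma span_colon c E a y : is_ideal c -> v @^-1` Q `<=` c -> colon c a `<=` c ->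
  indep E -> span setT E y -> span c E (v a * y) -> span c E y.
Proof.
move=> hc Qc cc; elim: E y => [//|e E IHE] y /= [iE0 iE] [a1 _ h1] [a2 ca2 h2].
have h3 : span setT E (v (a * a1 - a2) * e).
  have -> : v (a * a1 - a2) * e = (v a * y - v a2 * e) + v (- a) * (y - v a1 * e).
    by rewrite rmorphB rmorphN !rmorphM; ring.
  by apply: spanD => //; [apply: spanS h2 | apply: (@spanM setT)].
have Q3 := iE0 _ h3.
have ca1 : c a1.
  by apply: cc; rewrite /colon /= mulrC -(subrK a2 (a * a1)); apply: idealD => //; exact: Qc.
exists a1 => //; apply: IHE => //.
have -> : v a * (y - v a1 * e) = (v a * y - v a2 * e) + - (v (a * a1 - a2) * e).
  by rewrite rmorphB !rmorphM; ring.
apply: spanD => //; apply: span_base => //; apply: idealN => //; exact: idealMr.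
Qed.

(** Multiplication by [v a] carries [B / Q] into the free module on [E], where [w] remains regular.
    Going there and returning to [c'] costs the factor [v a] once per colon, whatever the length of
    [w]; the hypothesis relating [c'] to [span c E] is the invariant that survives adjoining an
    element. *)
Lemma kseq_descent c (c' : set B) E a (w : seq A) : is_ideal c -> is_ideal c' ->
  v @^-1` Q `<=` c -> c `<=` v @^-1` c' -> Q `<=` c' ->
  indep E -> (forall y, span setT E (v a * y)) ->
  (forall f, c' f -> span c E (v a * f)) ->
  kseq 1 c w -> kseq (v a) c' (map v w).
Proof.
move=> + + + + + iE hE; elim: w c c' => //= x w IHw c c' hc hc' Qc cc' Qc' hf [h1 h2].
split.
  move=> f /hf h; apply: (span_min hc' Qc' cc').
  apply: (@span_colon _ _ x) => //; try by move=> r /h1; rewrite mul1r.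
    exact: iE.
  by move: h; rewrite [f * _]mulrC mulrCA.
apply: (IHw (addx c x)) => //; [by auto | by auto | | | |].
- exact: subset_trans Qc (addx_sub x hc).
- apply: addx_min; first by apply: preimage_ideal; auto.
    by move=> r /cc' h; exact: (addx_sub (v x) hc').
  exact: (addx_self (v x) hc').
- exact: subset_trans Qc' (addx_sub (v x) hc').
move=> f [r /hf hr _].
have -> : v a * f = v a * (f - r * v x) + v x * (v a * r) by ring.
apply: spanD; [by auto | by apply: spanS hr; exact: addx_sub |].
by apply: spanM (hE r) => a' _; apply: idealMr; [auto | exact: addx_self].
Qed.

End Span.

(** * Finiteness over power series and the dimension formula *)

Section CompleteLocal.
Variables (B : comPzRingType) (noethB : noetherian B) (M : set B) (p : nat).
Hypotheses (hM : loc M) (cB : complete_for M (ideal_pow M)).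
Hypotheses (prime_p : prime p) (charp : p%:R = 0 :> B).
Implicit Types (P Q I J : set B) (z w : seq B) (x y b : B).

Let hM' : is_ideal M. Proof. by case: hM. Qed.

Lemma sop_pow I z : is_ideal I -> minover (adj I z) M ->
  exists n, ideal_pow M n `<=` adj I z.
Proof.
move=> hI /(minover_pow noethB (adj_ideal z hI))[c [n [nc h]]]; exists n => x /h.
by apply: (loc_sat hM); auto.
Qed.

Lemma ideal_pow_split z n x : ideal_pow (adj [set 0] z) n.+1 x ->
  exists2 g : nat -> B, forall i, ideal_pow (adj [set 0] z) n (g i) &
    x = \sum_(i < size z) g i * z`_i.
Proof.
set Z := adj _ _; pose K : set B := [set x | exists2 g : nat -> B,
  forall i, ideal_pow Z n (g i) & x = \sum_(i < size z) g i * z`_i].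
suff: ideal_pow Z n.+1 `<=` K by apply.
have hn := ideal_pow_ideal Z n.
apply: ideal_mul_min.
  split; first by exists (fun=> 0); [move=> _; exact: (ideal0 hn) |
    rewrite big1 // => i _; rewrite mul0r].
  move=> a u v [g hg ->] [g' hg' ->]; exists (fun i => a * g i + g' i).
    by move=> i; exact: hn.2.
  by rewrite mulr_sumr -big_split /=; apply: eq_bigr => i _; ring.
move=> u v /adj0_sum[c ->] hv; exists (fun i => c i * v).
  by move=> i; exact: (idealMl _ hn).
by rewrite mulr_suml; apply: eq_bigr => i _; rewrite mulrAC.
Qed.

Section Coefficients.
Variable k : set B.
Hypotheses (hk : subring k) (kM : forall x, k x -> M x -> x = 0).
Hypothesis ksurj : forall x, exists2 y, k y & M (x - y).

Lemma finite_mod_pow n : exists e : seq B, forall b, exists2 c : nat -> B,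
  forall i, k (c i) & ideal_pow M n (b - \sum_(i < size e) c i * e`_i).
Proof.
elim: n => [|n [e he]]; first by exists [::] => b; exists (fun=> 0) => // _; exact: subring0.
have [g Eg] := noeth_fg noethB (ideal_pow_ideal M n).
exists (e ++ g) => b; have [c kc] := he b; rewrite Eg => /adj0_sum[d Ed].
have /choice[d' hd'] : forall i, exists y, k y /\ M (d i - y).
  by move=> i; have [y] := ksurj (d i); exists y.
exists (fun i => if (i < size e)%N then c i else d' (i - size e)%N).
  by move=> i; case: ifP => // _; case: (hd' (i - size e)%N).
rewrite size_cat big_split_ord /=.
have -> : \sum_(i < size e) (if (i < size e)%N then c i else d' (i - size e)%N) * (e ++ g)`_i =
    \sum_(i < size e) c i * e`_i.
  by apply: eq_bigr => i _; rewrite ltn_ord nth_cat ltn_ord.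
have -> : \sum_(i < size g) (if (size e + i < size e)%N then c (size e + i)%N
    else d' (size e + i - size e)%N) * (e ++ g)`_(size e + i) = \sum_(i < size g) d' i * g`_i.
  apply: eq_bigr => i _; rewrite nth_cat ltnNge leq_addr /=.
  by rewrite addnC addnK.
rewrite opprD addrA Ed -sumrB; apply: (ideal_sum _ (ideal_pow_ideal M n.+1)) => i _.
have gi : ideal_pow M n g`_i by rewrite Eg; apply: adj_mem => //; exact: mem_nth.
by rewrite -mulrBl; apply: ideal_mulM => //; case: (hd' i).
Qed.

Variables (Q : set B) (z : seq B).
Hypotheses (hQ : is_ideal Q) (zM : forall x, x \in z -> M x) (mQz : minover (adj Q z) M).
Let Z := adj [set 0] z.

Let hZ : is_ideal Z. Proof. by rewrite /Z; auto. Qed.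

Let sub_isum : adj Q z `<=` isum Q Z.
Proof.
apply: adj_min; [exact: isum_ideal | exact: isum_l | move=> x xz].
by apply: isum_r => //; exact: adj_mem.
Qed.

Let ZM : Z `<=` M.
Proof. by apply: adj_min => // _ /= ->; exact: ideal0. Qed.

(** Since [M ^ N0] lies in [Q + (z)], a finite set [e] spanning [B / M ^ N0] over [k] spans [B]
    modulo [Q + (z)]. The remainder is expanded again, with coefficients of increasing order in [z];
    the resulting series are correct modulo [Q] by Krull's intersection theorem. *)
Lemma finite_over_pseries : exists e : seq B, forall b, exists2 a : nat -> B,
  forall i, pseries k z (a i) & Q (b - \sum_(i < size e) a i * e`_i).
Proof.
have [N0 hN0] := sop_pow hQ mQz; have [e he] := finite_mod_pow N0.
exists e.
have approx n b : ideal_pow Z n b -> exists h : nat -> B,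
    (forall l, order_ge k z n (h l)) /\
    isum Q (ideal_pow Z n.+1) (b - \sum_(l < size e) h l * e`_l).
  elim: n b => [|n IHn] b.
    move=> _; have [c kc /hN0/sub_isum hc] := he b; exists c; split.
      by move=> l; apply: pseries_const.
    by rewrite ideal_pow1.
  move=> /ideal_pow_split[g hg Eb].
  have /choice[h hh] := fun i => IHn (g i) (hg i).
  exists (fun l => \sum_(i < size z) h i l * z`_i); split.
    by move=> l; exists (fun i => h i l) => // i; case: (hh i).
  have -> : b - \sum_(l < size e) (\sum_(i < size z) h i l * z`_i) * e`_l =
      \sum_(i < size z) (g i - \sum_(l < size e) h i l * e`_l) * z`_i.
    have -> : \sum_(l < size e) (\sum_(i < size z) h i l * z`_i) * e`_l =
        \sum_(i < size z) (\sum_(l < size e) h i l * e`_l) * z`_i.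
      under eq_bigr => l _ do rewrite mulr_suml.
      rewrite exchange_big /=; apply: eq_bigr => i _; rewrite mulr_suml.
      by apply: eq_bigr => l _; rewrite mulrAC.
    by rewrite Eb -sumrB; apply: eq_bigr => i _; rewrite mulrBl.
  have hI : is_ideal (isum Q (ideal_pow Z n.+2)) by auto.
  apply: ideal_sum => // i _; have [_ [q Qq hq]] := hh i.
  exists (q * z`_i); first exact: idealMr.
  rewrite -mulrBl mulrC; apply: ideal_mulM => //.
  by apply: adj_mem => //; exact: mem_nth.
have step (nb : nat * B) : exists hb : (nat -> B) * B, ideal_pow Z nb.1 nb.2 ->
    [/\ forall l, order_ge k z nb.1 (hb.1 l), ideal_pow Z nb.1.+1 hb.2 &
        Q (nb.2 - \sum_(l < size e) hb.1 l * e`_l - hb.2)].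
  case: nb => n b; have [hb|no] := EM (ideal_pow Z n b); last first.
    by exists ((fun=> 0), 0) => hb; case: (no hb).
  have [h [hh [q Qq hq]]] := approx n b hb.
  by exists (h, b - \sum_(l < size e) h l * e`_l - q) => _; split=> //=; rewrite subKr.
have [nx hnx] := choice step.
move=> b; pose fix bn n : B := if n is n'.+1 then (nx (n', bn n')).2 else b.
pose h n := (nx (n, bn n)).1.
have hbn n : ideal_pow Z n (bn n).
  by elim: n => [//|n IHn]; case: (hnx (n, bn n) IHn).
have hh n l : order_ge k z n (h n l).
  by have [h1 _ _] := hnx (n, bn n) (hbn n); exact: h1.
have hQn N : Q (b - \sum_(l < size e) (\sum_(n < N) h n l) * e`_l - bn N).
  elim: N => [|N IHN].
    rewrite big1 ?subr0 ?subrr; first exact: ideal0.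
    by move=> i _; rewrite big_ord0 mul0r.
  have [_ _ /= hQN] := hnx (N, bn N) (hbn N).
  have -> : b - \sum_(l < size e) (\sum_(n < N.+1) h n l) * e`_l - bn N.+1 =
    (b - \sum_(l < size e) (\sum_(n < N) h n l) * e`_l - bn N) +
    (bn N - \sum_(l < size e) h N l * e`_l - bn N.+1).
    have -> : \sum_(l < size e) (\sum_(n < N.+1) h n l) * e`_l =
       \sum_(l < size e) (\sum_(n < N) h n l) * e`_l + \sum_(l < size e) h N l * e`_l.
      by rewrite -big_split /=; apply: eq_bigr => l _; rewrite big_ord_recr mulrDl.
    by ring.
  exact: idealD.
have /choice[a ha] : forall l, exists s, pseries k z s /\
    forall N, ideal_pow M N (s - \sum_(n < N) h n l).
  by move=> l; have [s] := pseries_lim cB hk zM (fun n => hh n l); exists s.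
exists a; first by move=> i; case: (ha i).
apply: (krull_intersection noethB hM hQ) => N.
exists (b - \sum_(l < size e) (\sum_(n < N) h n l) * e`_l - bn N) => //.
have -> : b - \sum_(i < size e) a i * e`_i -
    (b - \sum_(l < size e) (\sum_(n < N) h n l) * e`_l - bn N) =
    bn N - \sum_(l < size e) (a l - \sum_(n < N) h n l) * e`_l.
  have -> : \sum_(l < size e) (a l - \sum_(n < N) h n l) * e`_l =
    \sum_(l < size e) a l * e`_l - \sum_(l < size e) (\sum_(n < N) h n l) * e`_l.
    by rewrite -sumrB; apply: eq_bigr => l _; rewrite mulrBl.
  by ring.
have hMN := ideal_pow_ideal M N.
apply: (idealB hMN); first by apply: ideal_powS_sub (hbn N).
apply: (ideal_sum _ hMN) => l _; apply: (idealMr _ hMN); by case: (ha l).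
Qed.

End Coefficients.

(* [B / Q] is finite over a ring [A] in which [z] is a regular sequence; [b] is such that
   [b B] lies in a free [A]-submodule of [B / Q]. *)
Lemma colon_killer Q z : is_prime Q -> minover (adj Q z) M -> dimge Q M (size z) ->
  exists2 b, ~ Q b & forall u, kseq b Q (pw z u).
Proof.
move=> pQ mQz dQ; have hQ : is_ideal Q by auto.
have zM x : x \in z -> M x by case: mQz => _ h _ xz; apply: h; exact: adj_mem.
have [k [hk kM ksurj]] := coefficient_field hM prime_p charp cB.
have [A [v [vinj Av]]] := subring_type (pseries_subring z hk).
have [zA vz] : exists zA, map v zA = z.
  have : forall x, x \in z -> exists a, v a = x by move=> x xz; apply/Av; exact: pseries_var.
  elim: (z) => [|x z' IHz] h; first by exists [::].
  have [|zA <-] := IHz; first by move=> y yz; apply: h; rewrite inE yz orbT.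
  by have [a <-] := h x (mem_head _ _); exists (a :: zA).
have [hJ cA] := series_loc_complete hM cB hk kM ksurj zM vinj Av vz.
have noethA := noetherian_complete cA hJ erefl.
set JA := adj [set 0] zA in hJ cA.
have hJ' : is_ideal JA by case: hJ.
pose q := v @^-1` Q; have pq : is_prime q by exact: preimage_prime.
have hq : is_ideal q by auto.
have qJ : q `<=` JA by apply: prime_sub_loc.
have Ez : adj q zA = JA.
  apply/seteqP; split; last by apply: adj_subset => // x /= ->; exact: ideal0.
  by apply: adj_min => // x xz; exact: adj_mem.
have [w [wJ mw dw]] := sop_exists noethA hq (loc_prime hJ) qJ.
(* Powers of [zA] lie in [q + (w)], so [M] is minimal over [Q] and the image of [w]; as [B / Q] has
   dimension at least [size z], so has [w] at least as many elements. Hence [zA] generates the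
   maximal ideal of [A / q] with as many elements as its dimension. *)
have dq : dimge q JA (size zA).
  apply: dimge_le dw; rewrite -(size_map v zA) vz.
  rewrite -(size_map v w); apply: (krull_height noethB hQ _ dQ).
  have [c [N [nc hN]]] := minover_pow noethA (adj_ideal w hq) mw.
  split; [exact: loc_prime | |].
    apply: adj_min => //; first by case: mQz => _ h _; apply: subset_trans h; exact: adj_sub.
    move=> _ /mapP[x xw ->]; have /adj0_sum[c' ->] := wJ x xw.
    rewrite rmorph_sum; apply: ideal_sum => // i _; rewrite rmorphM; apply: idealMl => //.
    by apply: zM; rewrite -vz; apply: map_f; exact: mem_nth.
  move=> P pP wP PM; case: mQz => _ _; apply => //; apply: adj_min; first by auto.
    by apply: subset_trans wP; exact: adj_sub.
  rewrite -vz => _ /mapP[x xz ->]; apply: (@primeX _ _ _ N) => //; apply: wP.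
  rewrite -rmorphXn; apply: adj_preimage => //.
  apply: (loc_sat hJ _ nc); first by auto.
  apply: hN; apply: ideal_powX; exact: adj_mem.
have reg : regperm q zA := reg_regperm noethA hJ hq Ez dq.
have [e he] := finite_over_pseries hk ksurj hQ zM mQz.
have [E [a [na iE hE]]] := extract_basis v hQ pQ e.
have all_span y : span v Q setT E (v a * y).
  apply: hE; have [h hh hy] := he y.
  have /choice[h' Eh'] : forall i, exists a, v a = h i by move=> i; apply/Av.
  rewrite -(subrK (\sum_(i < size e) h i * e`_i) y) addrC; apply: spanD => //.
    by under eq_bigr => i _ do rewrite -Eh'; exact: span_sum.
  exact: span_base.
exists (v a) => // u; rewrite -vz -map_pw.
apply: (@kseq_descent _ _ v Q hQ q Q E a (pw zA u)) => //.
  by move=> f Qf; apply: span_base => //; exact: idealMl.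
exact: regperm_kseq.
Qed.

(** Otherwise choose [x] in [P'] outside the minimal primes of [P + y] of dimension at least [l];
    then [y, x] begin a system of parameters of [B / P], with a colon killer [b]. For each [u] some
    [s] outside [P'] carries a power of [x] into [(P, y ^ u.+1)], so [s b] is a multiple of
    [y ^ u.+1] modulo [P]. As the colons of [P + b] by powers of [y] become stationary, [b] can be
    cancelled to make [s] a multiple of [y] modulo [P], which puts it in [P']. *)
Lemma complete_catenary P P' y l : is_prime P -> ~ P y -> minover (addx P y) P' ->
  dimge P M l.+1 -> dimge P' M l.
Proof.
move=> pP nPy mP' d; have [pP' PP' min] := mP'; have hP : is_ideal P by auto.
have hPy : is_ideal (addx P y) by auto.
have P'M : P' `<=` M by exact: prime_sub_loc.
apply: contrapT => nd.
have [ps [h1 h2]] := finite_minover noethB hPy.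
have [x [P'x hx]] : exists x, P' x /\
    forall q, q \in [seq q <- ps | `[< minover (addx P y) q /\ dimge q M l >] ] -> ~ q x.
  apply: prime_avoid0 => [|q]; first by auto.
  rewrite mem_filter => /andP[/asboolP[mq dq] _]; split; first by case: mq.
  move=> P'q; apply: nd; suff -> : P' = q by [].
  by apply/seteqP; split=> //; case: mq => pq Pq mq; apply: mq.
have xM : M x by exact: P'M.
have yM : M y by apply/P'M/PP'/addx_self.
have hPyx : is_ideal (addx (addx P y) x) by auto.
have PyxM : addx (addx P y) x `<=` M.
  by case: hM => hM'' _ _; apply: addx_min => //; apply: subset_trans P'M.
have [w [w1 w2 w3]] := sop_exists noethB hPyx (loc_prime hM) PyxM.
(* Below a chain over [(P, y, x)] sits a minimal prime [q] of [P + y]. If its dimension is at least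
   [l], it omits [x] and both [q] and [P] prolong the chain; if not, [size w < l] and the hypothesis
   on [P] suffices. *)
have dz : dimge P M (size (y :: x :: w)).
  have [c [hc cw ac]] := w3.
  have pc : is_prime (c 0%N) by apply: hc.1.
  have dc : dimge (c 0%N) M (size w) by exists c.
  have Pyc : addx P y `<=` c 0%N by apply: subset_trans ac; exact: addx_sub.
  have [q mq qc] := minover_exists noethB hPy pc Pyc.
  have dq : dimge q M (size w) by exact: dimge_sub dc.
  have [dql|ndql] := EM (dimge q M l); last first.
    apply: dimge_le d; rewrite /= !ltnS ltnNge; apply/negP => h; apply: ndql.
    exact: dimge_le dq.
  have nqx : ~ q x by apply: hx; rewrite mem_filter h2 // andbT; apply/asboolP.
  apply: (dimge_cons (b := addx P y)).
    move=> r pr Pr _; exists P; split=> //.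
      by apply: subset_trans Pr; exact: addx_sub.
    by move=> h; apply/nPy/h/Pr/addx_self.
  apply: dimge_cons dc => r pr cr _; exists q; case: mq => pq Pq _; split=> //.
    exact: subset_trans cr.
  by move=> h; apply/nqx/h/cr/ac/addx_self.
have [b nPb hb] := @colon_killer P (y :: x :: w) pP w2 dz.
have key u : exists s g, ~ P' s /\ P (s * b - g * y ^+ u.+1).
  have [|s [N [nPs hs]]] := @minover_pow _ noethB (addx P (y ^+ u.+1)) P' (addx_ideal _ hP).
    split=> //.
      apply: addx_min; [by auto | by apply: subset_trans PP'; exact: addx_sub |].
      by rewrite exprS; apply: idealMr; [auto | apply/PP'/addx_self].
    move=> q pq h qP'; apply: min => //; apply: addx_min; first by auto.
      by apply: subset_trans h; exact: addx_sub.
    by apply: (@primeX _ _ _ u.+1) => //; apply/h/addx_self.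
  have [_ [/= hk _]] := hb [:: u.+1; N].
  have [|g hg _] := hk s; first by apply: hs; exact: ideal_powX.
  by exists s, g; rewrite mulrC.
have /choice[s] := key; move=> /choice[g hsg].
have [n hn] := @noeth_chain _ noethB (fun u => colon (addx P b) (y ^+ u))
  (fun u => colon_ideal _ (addx_ideal b hP))
  (fun u r => ltac:(by rewrite /colon /= exprS mulrCA => h; apply: idealMl; auto)).
have [nPs hs] := hsg n.
have [|c hc _] := hn 1%N (g n).
  rewrite /colon /= addn1 -(subKr (s n * b) (g n * y ^+ n.+1)).
  apply: idealB; [by auto | by apply: idealMl; [auto | exact: addx_self] |].
  exact: addx_sub.
apply: nPs; rewrite -(subrK (c * y) (s n)); apply: idealD; [by auto | | ]; last first.
  by apply: idealMl; [auto | apply/PP'/addx_self].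
apply: PP'; apply: addx_sub => //; apply: (@primeMl _ _ b) => //.
have -> : b * (s n - c * y) = (s n * b - g n * y ^+ n.+1) + y * (g n * y ^+ n - c * b).
  by rewrite exprS; ring.
by apply: idealD => //; exact: idealMl.
Qed.

Lemma complete_dim P Q l : is_prime P -> is_prime Q -> P `<=` Q -> dimge P M l ->
  exists e r, [/\ dimge P Q e, dimge Q M r & (l <= e + r)%N].
Proof.
move=> + pQ; elim: l P => [|l IHl] P pP PQ d.
  exists 0%N, 0%N; split=> //; first exact: dimge0.
  by apply: dimge0; [exact: loc_prime | exact: prime_sub_loc].
have [QP|/nonsubset[y [Qy nPy]]] := EM (Q `<=` P).
  exists 0%N, l.+1; split=> //; first exact: dimge0.
  by apply: dimge_sub d.
have hP : is_ideal P by auto.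
have [|P' mP' P'Q] := minover_exists noethB (addx_ideal y hP) pQ.
  by apply: addx_min => //; auto.
have [pP' PyP' _] := mP'.
have [e [r [h1 h2 h3]]] := IHl P' pP' P'Q (complete_catenary pP nPy mP' d).
exists e.+1, r; split=> //; apply: dimge_cons h1 => q pq P'q _; exists P; split=> //.
  by apply: subset_trans P'q; apply: subset_trans PyP'; exact: addx_sub.
by move=> h; apply/nPy/h/P'q/PyP'/addx_self.
Qed.

End CompleteLocal.

(** * Catenary rings *)

Section SaturatedChains.
Variables (R : comPzRingType) (noethR : noetherian R).
Implicit Types (P Q a b : set R) (x y : R).

Lemma dimge_segment n (c : nat -> set R) i j : prime_chain n c -> (i <= j <= n)%N ->
  dimge (c i) (c j) (j - i).
Proof.
move=> [hc cS] /andP[ij jn]; exists (fun k => c (i + k)%N); split.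
- split=> k hk; first by apply: hc; lia.
  by rewrite addnS; apply: cS; lia.
- by rewrite subnKC.
- by rewrite addn0.
Qed.

(** A chain of greatest length is saturated, and [krull_height] bounds the lengths. *)
Lemma saturated_exists P Q l : is_prime P -> dimge P Q l ->
  exists2 n, (l <= n)%N & saturated_chain P Q n.
Proof.
move=> pP d; have pQ := dimge_prime d; have hP : is_ideal P by auto.
have [w [_ mw _]] := sop_exists noethR hP pQ (dimge_subset d).
have [n dn max] : exists2 n, dimge P Q n & forall k, dimge P Q k -> (k <= n)%N.
  have ex : exists k, `[< dimge P Q k >] by exists l; apply/asboolP.
  have ub k : `[< dimge P Q k >] -> (k <= size w)%N.
    by move=> /asboolP; exact: krull_height.
  case: (ex_maxnP ex ub) => n /asboolP dn max; exists n => // k dk.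
  by apply: max; apply/asboolP.
exists n; first exact: max.
have [c [hc cn Pc]] := dn; exists c; split=> //.
  apply/seteqP; split=> //; apply: contrapT => ncP.
  suff /max : dimge P Q n.+1 by rewrite ltnn.
  apply: (dimge_cons (b := c 0%N)); last by exists c.
  by move=> q pq cq _; exists P; split=> //; [exact: subset_trans cq | move=> qP; apply/ncP/(subset_trans cq)].
move=> i hi [P' [pP' [h1 h2] [h3 h4]]].
suff /max : dimge P Q (i.+1 + (n - i)) by rewrite -{2}(subnKC (ltnW hi)) addSn ltnn.
apply: (dimge_trans (b := P')).
  move=> q pq P'q _; apply: dimge_up P'q _ => //.
  apply: (dimge_rcons _ h1 h2) => //; apply: (dimge_sub Pc).
  by have := @dimge_segment n c 0 i hc; rewrite subn0 leq0n ltnW //; exact.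
have -> : (n - i = (n - i.+1).+1)%N by lia.
apply: (dimge_cons (b := c i.+1)).
  move=> q pq cq _; exists P'; split=> //; first exact: subset_trans cq.
  by move=> qP'; apply: h4; exact: subset_trans qP'.
by rewrite -cn; apply: dimge_segment hc _; rewrite hi leqnn.
Qed.

(** By the principal ideal theorem no prime lies strictly between [P] and [P'], so a saturated chain
    from [P'] to [Q] is prolonged by [P], and its length is forced. *)
Lemma catenary_dim P P' Q y l : catenary R -> is_prime P -> ~ P y ->
  minover (addx P y) P' -> P' `<=` Q -> dimge P Q l.+1 -> dimge P' Q l.
Proof.
move=> cat pP nPy mP' P'Q d; have [pP' PyP' _] := mP'; have hP : is_ideal P by auto.
have pQ := dimge_prime d.
have PP' : P `<=` P' by apply: subset_trans PyP'; exact: addx_sub.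
have [n ln sn] := saturated_exists pP d.
have [n' _ sn'] := saturated_exists pP' (dimge0 pQ P'Q).
have sS : saturated_chain P Q n'.+1.
  have [c [[hc cS] c0 cn sat]] := sn'.
  exists (fun i => if i is i'.+1 then c i' else P); split=> //.
  - split; case=> [|i] /= hi; [by [] | by apply: hc | | by apply: cS].
    by rewrite c0; split=> // h; apply/nPy/h/PyP'/addx_self.
  case=> [|i] hi; last exact: sat.
  rewrite c0 => -[P2 [pP2 [h1 h2] [h3 h4]]].
  apply: (krull_pit noethR hP mP'); apply: (dimge_rcons _ h3 h4) => //.
  by apply: (dimge_rcons _ h1 h2) => //; exact: dimge0.
have [N [_ uniq]] := cat P Q pP pQ (subset_trans PP' P'Q).
have E : n = n'.+1 by rewrite -(uniq _ sn) -(uniq _ sS).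
have [c [hc c0 cn _]] := sn'; apply: (@dimge_le _ _ _ n'); last by exists c; rewrite c0.
by rewrite -ltnS -E.
Qed.

End SaturatedChains.

(** * Completions *)

Section CompletionMap.
Variables (R B : comPzRingType) (phi : {rmorphism R -> B}) (m : set R).
Implicit Types (J K p q : set R) (P Q : set B) (f g a : R) (b : B).

Definition ext J : set B := idl (phi @` J).
Let M := ext m.

Hypotheses (noethR : noetherian R) (hm : loc m).
Hypothesis phi_inj : forall n a, ideal_pow M n (phi a) -> ideal_pow m n a.
Hypothesis phi_dense : forall n b, exists a, ideal_pow M n (b - phi a).
Hypothesis cB : complete_for M (ideal_pow M).

Let hm' : is_ideal m. Proof. by case: hm. Qed.

Lemma ext_ideal J : is_ideal (ext J). Proof. exact: idl_ideal. Qed.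

Lemma ext_mem J a : J a -> ext J (phi a).
Proof. by move=> Ja; apply: idl_sub; exists a. Qed.

Lemma ext_min J P : is_ideal P -> J `<=` phi @^-1` P -> ext J `<=` P.
Proof. by move=> hP h; apply: idl_min => // _ [a /h ? <-]. Qed.

Lemma extS J K : J `<=` K -> ext J `<=` ext K.
Proof. by move=> JK; apply: ext_min; [exact: ext_ideal | move=> a /JK; exact: ext_mem]. Qed.

Lemma ext_adj s : ext (adj [set 0] s) = adj [set 0] (map phi s).
Proof.
apply/seteqP; split.
  apply: ext_min; first by auto.
  apply: adj_preimage => // _ /= ->; by rewrite /preimage /= rmorph0.
apply: adj_min; [exact: ext_ideal | by move=> _ /= ->; exact: ideal0 (ext_ideal _) |].
by move=> _ /mapP[x xs ->]; apply: ext_mem; exact: adj_mem.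
Qed.

Lemma ext_addx J a : is_ideal J -> ext (addx J a) = addx (ext J) (phi a).
Proof.
move=> hJ; have hE := ext_ideal J; apply/seteqP; split.
  apply: ext_min; first by auto.
  move=> x [r hr _]; exists (phi r) => //; rewrite -rmorphM -rmorphB; exact: ext_mem.
apply: addx_min; [exact: ext_ideal | by apply: extS; exact: addx_sub |].
by apply: ext_mem; exact: addx_self.
Qed.

Lemma ext_pow n : ideal_pow M n `<=` ext (ideal_pow m n).
Proof.
elim: n => [|n IHn]; first by move=> b _; apply: ideal_full (ext_ideal _) _; rewrite -(rmorph1 phi); exact: ext_mem.
apply: ideal_mul_min; first exact: ext_ideal.
move=> x y Mx /IHn; have hE := ext_ideal (ideal_pow m n.+1).
suff h : ext (ideal_pow m n) `<=` colon (ext (ideal_pow m n.+1)) x.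
  by move=> /h; rewrite /colon /= mulrC.
apply: ext_min; first by auto.
move=> a ha; rewrite /preimage /colon /=.
suff h : M `<=` colon (ext (ideal_pow m n.+1)) (phi a) by rewrite mulrC; exact: h.
apply: ext_min; first by auto.
by move=> c mc; rewrite /preimage /colon /= -rmorphM; apply: ext_mem; exact: ideal_mulM.
Qed.

Lemma phi_pow n a : ideal_pow m n a -> ideal_pow M n (phi a).
Proof. by apply: ideal_pow_preimage => x mx; exact: ext_mem. Qed.

Lemma ext_proper : ~ M 1.
Proof.
case: hm => _ nm1 _ M1; apply: nm1.
have := @phi_inj 1%N 1; rewrite rmorph1 !ideal_pow1 //; [by apply | exact: ext_ideal].
Qed.

Lemma completion_loc : loc M.
Proof.
apply: (loc_complete cB); [exact: ext_ideal | exact: ext_proper |].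
move=> b nMb; have [a] := phi_dense 1 b; rewrite ideal_pow1; last exact: ext_ideal.
move=> ha; have nma : ~ m a.
  move=> ma; apply: nMb; rewrite -(subrK (phi a) b).
  by apply: (idealD (ext_ideal _)) => //; exact: ext_mem.
have [_ _ /(_ a nma)[c ac]] := hm; exists (phi c).
have -> : b * phi c - 1 = (b - phi a) * phi c by rewrite mulrBl -[in RHS]rmorphM ac rmorph1.
exact: (idealMr _ (ext_ideal _)).
Qed.

Lemma completion_noetherian : noetherian B.
Proof.
have [s Es] := noeth_fg noethR hm'.
by apply: (noetherian_complete cB completion_loc (z := map phi s)); rewrite /M Es ext_adj.
Qed.

Lemma ext_approx J b n : is_ideal J -> ext J b -> exists2 j, J j & ideal_pow M n (b - phi j).
Proof.
move=> hJ; have hMn := ideal_pow_ideal M n.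
pose K : set B := [set b | exists2 j, J j & ideal_pow M n (b - phi j)].
suff: ext J `<=` K by apply.
apply: ext_min.
  split; first by exists 0; [exact: ideal0 | rewrite rmorph0 subrr; exact: (ideal0 hMn)].
  move=> x u v [j Jj hj] [j' Jj' hj']; have [a ha] := phi_dense n x.
  exists (a * j + j'); first exact: hJ.2.
  have -> : x * u + v - phi (a * j + j') =
    x * (u - phi j) + phi j * (x - phi a) + (v - phi j') by rewrite rmorphD rmorphM; ring.
  by apply: (idealD hMn) => //; apply: (idealD hMn); exact: (idealMl _ hMn).
by move=> a Ja; exists a => //; rewrite subrr; exact: (ideal0 hMn).
Qed.

(** By approximation [a] lies in [J + m ^ n] for all [n], and ideals are closed. *)
Lemma ext_contract J a : is_ideal J -> ext J (phi a) -> J a.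
Proof.
move=> hJ h; apply: (krull_intersection noethR hm hJ) => n.
have [j Jj hj] := ext_approx n hJ h; exists j => //.
by apply: phi_inj; rewrite rmorphB.
Qed.

Lemma ext_colon J f s : is_ideal J -> ext J (s * phi f) -> ext (colon J f) s.
Proof.
move=> hJ hs; apply: (krull_intersection completion_noetherian completion_loc (ext_ideal _)) => n.
have hmn := ideal_pow_ideal m n; have hMn := ideal_pow_ideal M n.
have [a ha] := phi_dense n s.
pose K : set R := [set x | exists2 u, ideal_pow m n u & J (x - f * u)].
have hK : is_ideal K.
  split; first by exists 0; [exact: (ideal0 hmn) | rewrite mulr0 subrr; exact: ideal0].
  move=> x u v [w hw Jw] [w' hw' Jw']; exists (x * w + w'); first exact: hmn.2.
  have -> : x * u + v - f * (x * w + w') = x * (u - f * w) + (v - f * w') by ring.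
  exact: hJ.2.
have [u hu Ju] : K (a * f).
  apply: ext_contract => //; rewrite rmorphM.
  have -> : phi a * phi f = s * phi f - (s - phi a) * phi f by ring.
  apply: (idealB (ext_ideal _)).
    apply: extS hs => x Jx; exists 0; [exact: (ideal0 hmn) | by rewrite mulr0 subr0].
  have h : ext (ideal_pow m n) `<=` colon (ext K) (phi f).
    apply: ext_min; first by apply: colon_ideal; exact: ext_ideal.
    move=> u hu; rewrite /preimage /colon /= -rmorphM; apply: ext_mem.
    by exists u => //; rewrite mulrC subrr; exact: ideal0.
  by apply: (h (s - phi a)); exact: ext_pow.
exists (phi (a - u)); first by apply: ext_mem; rewrite /colon /= mulrBl [u * f]mulrC.
have -> : s - phi (a - u) = (s - phi a) + phi u by rewrite rmorphB; ring.
by apply: (idealD hMn) => //; exact: phi_pow.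
Qed.

Lemma minover_contract J P : is_ideal J -> minover (ext J) P -> minover J (phi @^-1` P).
Proof.
move=> hJ mP; have [pP JP _] := mP; split; first exact: preimage_prime.
  by move=> a Ja; apply: (JP (phi a)); exact: ext_mem.
move=> q pq Jq qP f Pf.
have [s [n [nPs hs]]] := minover_pow completion_noetherian (ext_ideal J) mP.
have : ext (colon J (f ^+ n)) s.
  by apply: ext_colon => //; apply: hs; rewrite rmorphXn; exact: ideal_powX.
move=> hext; have [t ht nPt] : exists2 t, colon J (f ^+ n) t & ~ P (phi t).
  apply: contrapT => no; apply: nPs; apply: (ext_min _ _ hext); first by auto.
  by move=> t ht; apply: contrapT => nPt; apply: no; exists t.
apply: (@primeX _ _ _ n) => //; apply: (@primeMl _ _ t) => //; last exact: Jq.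
by move=> /qP.
Qed.

Lemma prime_contract p P : is_prime p -> minover (ext p) P -> phi @^-1` P = p.
Proof.
move=> pp mP; have [_ h1 h2] := minover_contract (prime_ideal pp) mP.
by apply/seteqP; split=> //; exact: h2.
Qed.

End CompletionMap.

(** * Hilbert's basis theorem and primes of polynomial rings *)

Lemma hilbert_basis (R : comNzRingType) : noetherian R -> noetherian {poly R}.
Proof.
move=> noethR I hI.
pose L n : set R := [set c | exists F : {poly R}, [/\ I F, (size F <= n.+1)%N & F`_n = c]].
have hL n : is_ideal (L n).
  split; first by exists 0; rewrite size_poly0 coef0; split=> //; exact: ideal0.
  move=> a x y [F [IF sF <-]] [G [IG sG <-]]; exists (a%:P * F + G); split.
  - exact: hI.2.
  - rewrite (leq_trans (size_polyD _ _)) // geq_max sG andbT mul_polyC.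
    by rewrite (leq_trans (size_scale_leq _ _)).
  - by rewrite coefD coefCM.
have LS n : L n `<=` L n.+1.
  move=> c [F [IF sF <-]]; exists (F * 'X); split; first exact: idealMr.
    by rewrite (leq_trans (size_polyMleq _ _)) // size_polyX addn2.
  by rewrite coefMX.
have [N hN] := noeth_chain noethR hL LS.
have /choice[T hT] : forall n, exists T : seq {poly R},
    (forall F, F \in T -> I F /\ (size F <= n.+1)%N) /\
    forall c, L n c -> exists r : nat -> R, c = \sum_(i < size T) r i * (T`_i)`_n.
  move=> n; have [s Es] := noeth_fg noethR (hL n).
  have [T [hT E]] : exists T : seq {poly R},
      (forall F, F \in T -> I F /\ (size F <= n.+1)%N) /\ s = [seq F`_n | F : {poly R} <- T].
    have : forall x, x \in s -> L n x by move=> x xs; rewrite Es; exact: adj_mem.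
    elim: (s) => [|x s' IHs] h; first by exists [::].
    have [|T [h1 ->]] := IHs; first by move=> y ys; apply: h; rewrite inE ys orbT.
    have [F [IF sF <-]] := h x (mem_head _ _); exists (F :: T); split=> //.
    by move=> G; rewrite inE => /orP[/eqP ->|/h1].
  exists T; split=> // c; rewrite Es => /adj0_sum[r ->]; exists r.
  rewrite E size_map; apply: eq_bigr => i _; by rewrite (nth_map 0).
pose S := flatten [seq T n | n <- iota 0 N.+1].
have TS n F : (n <= N)%N -> F \in T n -> F \in S.
  move=> nN FT; apply/flattenP; exists (T n) => //; apply/mapP; exists n => //.
  by rewrite mem_iota add0n.
have SI F : F \in S -> I F.
  by case/flattenP => _ /mapP[n _ ->] /(hT n).1[].
exists S; rewrite adj_idl; apply/seteqP; split; last first.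
  by apply: adj_min => // _ /= ->; exact: ideal0.
move=> F; have [d] := ubnP (size F); elim: d F => // d IHd F; rewrite ltnS => sF IF.
have hS : is_ideal (adj [set 0] S) by auto.
case: d => [|d] in IHd sF *.
  by move: sF; rewrite leqn0 size_poly_eq0 => /eqP ->; exact: ideal0.
pose n := minn d N; have [h1 h2] := hT n.
have [|r Er] := h2 F`_d.
  have LF : L d F`_d by exists F.
  rewrite /n; have [dN|Nd] := leqP d N; first by [].
  by apply: (hN (d - N)%N); rewrite subnKC // ltnW.
pose G := \sum_(i < size (T n)) (r i)%:P * (T n)`_i * 'X^(d - n).
have GS : adj [set 0] S G.
  apply: ideal_sum => // i _; apply: idealMr => //; apply: idealMl => //.
  by apply: adj_mem => //; apply: TS (mem_nth _ _); rewrite ?geq_minr.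
have IG : I G by move: G GS {Er}; apply: adj_min => // _ /= ->; exact: ideal0.
rewrite -(subrK G F); apply: idealD => //; apply: IHd; last exact: idealB.
rewrite ltnS; apply/leq_sizeP => j; rewrite leq_eqVlt => /orP[/eqP <-|dj].
  rewrite coefB coef_sum Er -sumrB big1 // => i _.
  rewrite coefMXn ltnNge leq_subr /= subKn ?geq_minl // coefCM subrr //.
rewrite coefB coef_sum nth_default ?(leq_trans sF) // sub0r big1 ?oppr0 // => i _.
rewrite coefMXn; case: ifP => // /negbT; rewrite -leqNgt => hj; rewrite coefCM nth_default ?mulr0 //.
have [_ sT] := h1 _ (mem_nth 0 (ltn_ord i)); apply: leq_trans sT _.
by have := geq_minl d N; rewrite -/n; lia.
Qed.

Section PolynomialPrimes.
Variable R : idomainType.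
Implicit Types (p q : set R) (F G H : {poly R}) (a b c : R).

(** The extension [p R[X]]. *)
Definition polyset p : set {poly R} := [set F : {poly R} | forall i, p F`_i].

Lemma polyset_prime p : is_prime p -> is_prime (polyset p).
Proof.
move=> pp; have hp : is_ideal p by auto.
split; first split.
- by move=> i; rewrite coef0; exact: ideal0.
- move=> A F G hF hG i; rewrite coefD coefM; apply: idealD => //.
  by apply: ideal_sum => // j _; exact: idealMl.
- by move=> /(_ 0%N); rewrite coef1; exact: primeN1.
move=> F G hFG; apply: contrapT => /not_orP[nF nG].
have least (H : {poly R}) : ~ polyset p H ->
    exists i, ~ p H`_i /\ forall j, (j < i)%N -> p H`_j.
  move=> /existsNP[i0 hi0]; have ex : exists i, ~~ `[< p H`_i >] by exists i0; apply/asboolPn.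
  case: (ex_minnP ex) => i /asboolPn ni min; exists i; split=> // j ji.
  by apply: contrapT => /asboolPn nj; have := min j nj; rewrite leqNgt ji.
have [i [ni hi]] := least F nF; have [j [nj hj]] := least G nG.
have := hFG (i + j)%N; rewrite coefM.
have lti : (i < (i + j).+1)%N by rewrite ltnS leq_addr.
rewrite (bigD1 (Ordinal lti)) //= addKn => hs.
apply: (primeNM pp ni nj); apply: (idealDr hp _ hs); apply: (ideal_sum _ hp) => k nk.
have [ki|ik] := ltnP k i; first exact: (idealMr _ hp (hi _ ki)).
apply: (idealMl _ hp); apply: hj.
have : (k != i :> nat) by apply: contra nk => /eqP e; apply/eqP/val_inj.
by have := ltn_ord k; lia.
Qed.

(** The ideal [(p, X)]. *)
Definition maxpoly p : set {poly R} := [set F : {poly R} | p F`_0].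

Lemma maxpoly_prime p : is_prime p -> is_prime (maxpoly p).
Proof.
move=> pp; have hp : is_ideal p by auto.
split; first split.
- by rewrite /maxpoly /= coef0; exact: ideal0.
- by move=> A F G hF hG; rewrite /maxpoly /= coefD coef0M; exact: hp.2.
- by rewrite /maxpoly /= coef1; exact: primeN1.
by move=> F G; rewrite /maxpoly /= coef0M; exact: primeM.
Qed.

Variables (p : set R) (a b : R).
Hypotheses (pp : is_prime p) (nb : ~ p b).

Let hp : is_ideal p. Proof. by auto. Qed.

Let b0 : b != 0. Proof. by apply/eqP => e; apply: nb; rewrite e; exact: ideal0. Qed.

Notation tf := (@tofrac R).
Let w := tf a / tf b.

Let tb0 : tf b != 0. Proof. by rewrite tofrac_eq0. Qed.

Let bw : tf b * w = tf a. Proof. by rewrite /w mulrC divfK. Qed.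

(* [c = b ^ l F(a / b)]. *)
Definition homogenized l F c := tf c = tf b ^+ l * (map_poly tf F).[w].

Lemma homogenized_horner l F c d : homogenized l F d ->
  homogenized l.+1 (F * 'X + c%:P) (d * a + b ^+ l.+1 * c).
Proof.
move=> Ed; have E : (map_poly tf (F * 'X + c%:P)).[w] = (map_poly tf F).[w] * w + tf c.
  by rewrite rmorphD rmorphM /= map_polyX map_polyC hornerD hornerM hornerX hornerC.
by rewrite /homogenized E tofracD !tofracM tofracXn Ed -bw exprSr; ring.
Qed.

Lemma homogenized0 : homogenized 0 0 0.
Proof. by rewrite /homogenized !rmorph0 horner0 mulr0. Qed.

Lemma homogenized_exists F : exists l c, homogenized l F c.
Proof.
elim/poly_ind: F => [|F c [l [d Ed]]]; first by exists 0%N, 0; exact: homogenized0.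
by exists l.+1, (d * a + b ^+ l.+1 * c); exact: homogenized_horner.
Qed.

Lemma homogenized_inj l F c d : homogenized l F c -> homogenized l F d -> c = d.
Proof. by rewrite /homogenized => <- /eqP; rewrite tofrac_eq => /eqP. Qed.

Lemma homogenizedM l l' F G c d : homogenized l F c -> homogenized l' G d ->
  homogenized (l + l') (F * G) (c * d).
Proof.
by rewrite /homogenized tofracM rmorphM /= hornerM exprD => -> ->; ring.
Qed.

Lemma homogenizedD l l' F G c d : homogenized l F c -> homogenized l' G d ->
  homogenized (l + l') (F + G) (b ^+ l' * c + b ^+ l * d).
Proof.
rewrite /homogenized tofracD !tofracM !tofracXn rmorphD /= hornerD exprD => -> ->; ring.
Qed.

Lemma homogenized_const c : homogenized 0 c%:P c.
Proof. by rewrite /homogenized map_polyC hornerC mul1r. Qed.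

(* The kernel of [R[X] -> Frac (R / p)], [X |-> a / b]. *)
Definition ratker : set {poly R} := [set F | exists l c, p c /\ homogenized l F c].

Lemma ratkerP F l c : homogenized l F c -> ratker F -> p c.
Proof.
move=> h [l' [d [pd h']]].
have e : b ^+ l' * c = b ^+ l * d.
  apply: (@homogenized_inj (l' + l) F); rewrite /homogenized tofracM tofracXn.
    by rewrite h exprD mulrA.
  by rewrite h' exprD mulrCA mulrA.
by apply: (@primeMl _ _ (b ^+ l')) => //; [exact: primeNX | rewrite e; exact: idealMl].
Qed.

Lemma ratker_prime : is_prime ratker.
Proof.
split.
- split; first by exists 0%N, 0; split; [exact: ideal0 | exact: homogenized_const].
  move=> A F G [l [c [pc hF]]] [l' [d [pd hG]]].
  have [k [e hA]] := homogenized_exists A.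
  exists (k + l + l')%N, (b ^+ l' * (e * c) + b ^+ (k + l) * d); split.
    by apply: idealD => //; apply: idealMl => //; apply: idealMl.
  by apply: homogenizedD => //; exact: homogenizedM.
- move=> h; apply: (primeN1 pp); apply: ratkerP h; exact: homogenized_const.
move=> F G hFG; have [l [c hF]] := homogenized_exists F; have [k [d hG]] := homogenized_exists G.
have := ratkerP (homogenizedM hF hG) hFG => /(primeM pp)[pc|pd]; [left | right].
  by exists l, c.
by exists k, d.
Qed.

Lemma ratker_const c : ratker c%:P <-> p c.
Proof.
split; first by apply: ratkerP; exact: homogenized_const.
by move=> pc; exists 0%N, c; split=> //; exact: homogenized_const.
Qed.

Lemma polyset_sub_ratker : polyset p `<=` ratker.
Proof.
move=> F hF; rewrite -[F]coefK poly_def.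
have hr : is_ideal ratker by apply: prime_ideal; exact: ratker_prime.
apply: ideal_sum => // i _; rewrite -mul_polyC; apply: idealMr => //.
exact/ratker_const.
Qed.

Definition linear_poly : {poly R} := b%:P * 'X - a%:P.

Lemma linear_ratker : ratker linear_poly.
Proof.
exists 1%N, 0; split; first exact: ideal0.
rewrite /homogenized /linear_poly rmorphB rmorphM /= map_polyX !map_polyC.
by rewrite hornerD hornerN hornerM hornerX !hornerC bw subrr mulr0 tofrac0.
Qed.

Lemma pseudo_division n F : (size F <= n.+1)%N -> exists k G c,
  (b ^+ k)%:P * F = linear_poly * G + c%:P /\ (size G <= n)%N.
Proof.
elim: n F => [|n IHn] F sF.
  exists 0%N, 0, F`_0; rewrite size_poly0; split=> //.
  by rewrite mulr0 add0r expr0 mul1r [LHS]size1_polyC.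
have [F1 [c0 EF]] : exists F1 c0, F = F1 * 'X + c0%:P.
  by elim/poly_ind: (F) => [|F' c _]; [exists 0, 0; rewrite mul0r add0r | exists F', c].
have sF1 : (size F1 <= n.+1)%N.
  apply/leq_sizeP => j hj; have /leq_sizeP/(_ j.+1) := sF; rewrite ltnS hj => /(_ isT).
  by rewrite EF coefD coefMX coefC /= addr0.
have [k [G [c [E sG]]]] := IHn F1 sF1.
exists k.+1, (b%:P * 'X * G + c%:P), (a * c + b ^+ k.+1 * c0); split.
  rewrite EF exprS !polyCD !polyCM mulrDr.
  have -> : b%:P * (b ^+ k)%:P * (F1 * 'X) = b%:P * 'X * ((b ^+ k)%:P * F1) by ring.
  by rewrite E /linear_poly; ring.
apply/leq_sizeP => j hj; rewrite coefD coefC -mulrA coefCM coefXM.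
case: j hj => // j hj; rewrite /= addr0 nth_default ?mulr0 //.
exact: leq_trans sG _.
Qed.

(** Pseudo-division by [linear_poly] of an element of [P] leaves a constant remainder in [p]. If
    [linear_poly] were not in [P], the quotient would be in [P] with smaller degree, and by descent
    [P] would be [p R[X]]. Once [linear_poly] is in [P], the same division puts [ratker] inside
    [P]. *)
Lemma ratker_saturated P : is_prime P -> polyset p `<=` P -> ~ P `<=` polyset p ->
  P `<=` ratker -> ratker `<=` P.
Proof.
move=> pP sP nP Pr; have hP : is_ideal P by auto.
have Pc c : P c%:P -> p c by move=> /Pr /ratker_const.
have pP' c : p c -> P c%:P.
  by move=> pc; apply: sP => i; rewrite coefC; case: eqP => // _; exact: ideal0.
have nPb k : ~ P (b ^+ k)%:P by move/Pc; apply: primeNX.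
have rem F k G c : P F -> (b ^+ k)%:P * F = linear_poly * G + c%:P -> p c.
  move=> PF E; apply/ratker_const; have hr : is_ideal ratker by apply: prime_ideal; exact: ratker_prime.
  have -> : c%:P = (b ^+ k)%:P * F - linear_poly * G by rewrite E addrC addKr.
  by apply: idealB => //; [apply: idealMl => //; exact: Pr | apply: idealMr => //; exact: linear_ratker].
have lin : P linear_poly.
  apply: contrapT => nlin; apply: nP => F; have [n] := ubnP (size F).
  elim: n F => // n IHn F sF PF i; case: n => [|n] in IHn sF *.
    by move: sF; rewrite ltnS leqn0 size_poly_eq0 => /eqP ->; rewrite coef0; exact: ideal0.
  have [k [G [c [E sG]]]] := @pseudo_division n F sF.
  have pc := rem F k G c PF E.
  have PG : P G.
    apply: (primeMl pP nlin); apply: (@idealDr _ _ _ c%:P) => //; first exact: pP'.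
    by rewrite -E; exact: idealMl.
  have hG : polyset p G by apply: IHn.
  apply: (@primeMl _ _ (b ^+ k)) => //; first exact: primeNX.
  rewrite -coefCM E coefD; apply: idealD => //.
    have hps : is_ideal (polyset p) by apply: prime_ideal; exact: polyset_prime.
    by apply: (idealMl _ hps hG).
  by rewrite coefC; case: eqP => // _; exact: ideal0.
move=> F rF; have [k [G [c [E sG]]]] := @pseudo_division (size F) F (leqnSn _).
have pc : p c.
  apply/ratker_const; have hr : is_ideal ratker by apply: prime_ideal; exact: ratker_prime.
  have -> : c%:P = (b ^+ k)%:P * F - linear_poly * G by rewrite E addrC addKr.
  by apply: idealB => //; [apply: idealMl | apply: idealMr => //; exact: linear_ratker].
apply: (primeMl pP (nPb k)); rewrite E; apply: idealD => //; first exact: idealMr.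
exact: pP'.
Qed.

End PolynomialPrimes.

(** * Formal equidimensionality *)

Section Ratliff.
Variables (R : idomainType) (B : comPzRingType) (phi : {rmorphism R -> B}) (m : set R).
Implicit Types (J K p q : set R) (P Q : set B) (f g a : R) (b : B).
Let M := ext phi m.
Hypotheses (noethR : noetherian R) (hm : loc m).
Hypothesis phi_inj : forall n a, ideal_pow M n (phi a) -> ideal_pow m n a.
Hypothesis phi_dense : forall n b, exists a, ideal_pow M n (b - phi a).
Hypothesis cB : complete_for M (ideal_pow M).
Hypotheses (catR : catenary R) (catRX : catenary {poly R}).

Let hm' : is_ideal m. Proof. by case: hm. Qed.
Let hM : loc M. Proof. exact: completion_loc. Qed.
Let hM' : is_ideal M. Proof. by case: hM. Qed.
Let noethB : noetherian B.
Proof. exact: completion_noetherian noethR hm phi_inj phi_dense cB. Qed.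

(** [f] avoids all associated primes of [J] other than [m]. If [b] is killed by a power of [f] but
    by no power of [g], some multiple of [g ^ n * b] has an associated prime as annihilator; it
    contains [f], hence [m], hence [g], although the colons by powers of [g] are stationary from [n]
    on. *)
Lemma saturation_element J : is_ideal J -> J `<=` m -> exists2 f, m f &
  forall k (b g : R), J (b * f ^+ k) -> m g -> exists n, J (g ^+ n * b).
Proof.
move=> hJ Jm; have [ps hps] := finite_assoc noethR hJ.
have [|f [mf hf]] := @prime_avoid0 _ m [seq q <- ps | `[< is_prime q /\ ~ m `<=` q >]] hm'.
  by move=> q; rewrite mem_filter => /andP[/asboolP hq _].
exists f => // k b g hb mg; apply: contrapT => no.
have [||n hn] := @noeth_chain _ noethR (fun n => colon J (g ^+ n * b)).
- by auto.
- move=> n r hr; rewrite /colon /=.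
  have -> : r * (g ^+ n.+1 * b) = g * (r * (g ^+ n * b)) by rewrite exprS; ring.
  exact: idealMl.
have nJ : ~ satc m J (g ^+ n * b).
  by move=> [d nd hd]; apply: no; exists n; exact: (loc_sat hm hJ nd hd).
have [c [pc cm]] := assoc_prime_at noethR hJ (loc_prime hm) nJ.
set q := colon J _ in pc cm.
have qf : q f.
  apply: (@primeX _ _ _ k) => //; rewrite /q /colon /=.
  have -> : f ^+ k * (c * (g ^+ n * b)) = c * g ^+ n * (b * f ^+ k) by ring.
  exact: idealMl.
have mq : m `<=` q.
  apply: contrapT => nmq; apply: (hf q) => //.
  by rewrite mem_filter hps // andbT; apply/asboolP.
have : colon J (g ^+ (n + 1) * b) c.
  have := mq g mg; rewrite /q /colon /= addn1 exprS.
  by have -> : g * (c * (g ^+ n * b)) = c * (g * g ^+ n * b) by ring.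
move=> /(hn 1%N) h; apply: (primeN1 pc).
by rewrite /q /colon /= mul1r.
Qed.

Lemma minover_maximal (J : set B) : is_ideal J -> J `<=` M -> (forall Q, is_prime Q -> J `<=` Q ->
  M `<=` Q) -> minover J M.
Proof. by move=> hJ JM h; split=> //; [exact: loc_prime | move=> Q pQ JQ _; exact: h]. Qed.

(* If [B] has a minimal prime [P] over [p B] with [dim B / P = 1 < dim R / p], then some
   [beta / alpha] is not integral over [R / p] although it is killed by a power of [m]
   modulo [R / p]; hence [(m, alpha / beta)] has height one in [(R / p)[alpha / beta]],
   while it has height [dim R / p] since [R[X]] is catenary. *)
Lemma no_short_component p P : is_prime p -> minover (ext phi p) P ->
  dimge P M 1 -> ~ dimge P M 2 -> ~ dimge p m 2.
Proof.
move=> pp mP d1 nd2 dp2; have [pP pPsub _] := mP.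
have hp : is_ideal p by auto. have hP : is_ideal P by auto.
have pE : phi @^-1` P = p by apply: prime_contract noethR hm phi_inj phi_dense cB _ _ pp mP.
have pm : p `<=` m by exact: dimge_subset dp2.
have [a [ma npa]] : exists a, m a /\ ~ p a.
  have [Q [dQ Qm nmQ]] := dimgeS dp2; have [a [ma nQa]] := nonsubset nmQ.
  by exists a; split=> // pa; apply: nQa; exact: (dimge_subset dQ).
have nPa : ~ P (phi a) by move=> h; apply: npa; rewrite -pE.
have Ma : M (phi a) by exact: ext_mem.
have PM : P `<=` M by exact: prime_sub_loc.
have above Q x : is_prime Q -> P `<=` Q -> Q x -> ~ P x -> M `<=` Q.
  move=> pQ PQ Qx nPx; apply: contrapT => nMQ; apply: nd2.
  apply: (@dimge_rcons _ _ Q) => //; [exact: loc_prime | exact: prime_sub_loc |].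
  apply: (@dimge_rcons _ _ P) => //; [by move=> h; apply: nPx; exact: h | exact: dimge0].
have [u [k [nPu hu]]] := minover_pow noethB (ext_ideal phi p) mP.
(* [B / P] has dimension one and [u] is nonzero in it, so a power of [a] is a multiple of [u]. *)
have [s [v hsv]] : exists s v, P (phi a ^+ s - u * v).
  have [Mu|nMu] := EM (M u); last first.
    have [_ _ /(_ u nMu)[v uv]] := hM; exists 0%N, v.
    by rewrite expr0 uv subrr; exact: ideal0.
  have [|c [N [nc hN]]] := @minover_pow _ noethB (addx P u) M (addx_ideal u hP).
    apply: minover_maximal; [by auto | by apply: addx_min |].
    move=> Q pQ PQ; apply: (above Q u) => //; last by apply/PQ/addx_self.
    by apply: subset_trans PQ; exact: addx_sub.
  have [r hr _] : addx P u (phi a ^+ N).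
    apply: (loc_sat hM _ nc); [by auto | apply: hN; exact: ideal_powX].
  by exists N, r; rewrite mulrC.
pose al := a ^+ s.+1; pose J := addx p al.
have hJ : is_ideal J by rewrite /J; auto.
have Jm : J `<=` m.
  by apply: addx_min => //; rewrite /al exprS; apply: idealMr.
have [f mf hf] := saturation_element hJ Jm.
have Mal : M (phi al) by apply: ext_mem; apply: Jm; exact: addx_self.
have alQ Q : is_prime Q -> Q (phi al) -> Q (phi a).
  by move=> pQ; rewrite /al rmorphXn; exact: primeX.
(* Only [M] contains [P ^ k] and [al], so they generate an ideal containing some [M ^ N], and [u]
   carries [P ^ k] into [p B]. *)
have [N hN] : exists N, forall x, ideal_pow M N x -> ext phi J (u * x).
  have hPk : is_ideal (addx (ideal_pow P k) (phi al)) by auto.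
  have PkP : ideal_pow P k `<=` P.
    case Ek : k hu => [|k'] hu; last by apply: ideal_mul_subl.
    by case: nPu; apply: pPsub; rewrite -[u]mulr1; exact: hu.
  have [|c [N [nc h]]] := @minover_pow _ noethB _ M hPk.
    apply: minover_maximal => //.
      by apply: addx_min => //; exact: subset_trans PM.
    move=> Q pQ hQ; apply: (above Q (phi a)) => //; last by apply: alQ => //; apply/hQ/addx_self.
    by apply: (@ideal_pow_prime _ Q P k) => //; apply: subset_trans hQ; exact: addx_sub.
  exists N => x hx; have [r hr _] : addx (ideal_pow P k) (phi al) x.
    by apply: (loc_sat hM _ nc); [auto | exact: h].
  have hE := ext_ideal phi J.
  rewrite -(subrK (r * phi al) x) mulrDr; apply: (idealD hE).
    have pJ : p `<=` J by exact: addx_sub.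
    exact: extS pJ _ (hu _ hr).
  apply: (idealMl _ hE); apply: (idealMl _ hE); apply: ext_mem; exact: addx_self.
have [L hL] : exists L, ideal_pow M L `<=` addx P (phi al).
  have [|c [L [nc h]]] := @minover_pow _ noethB (addx P (phi al)) M (addx_ideal _ hP).
    apply: minover_maximal; [by auto | by apply: addx_min |].
    move=> Q pQ hQ; apply: (above Q (phi a)) => //; last by apply: alQ => //; apply/hQ/addx_self.
    by apply: subset_trans hQ; exact: addx_sub.
  by exists L => x /h; apply: (loc_sat hM); auto.
(* [u] lies in the colon of [J B] by [f ^ N], which is extended from [R], so it is approximated by
   some [be] in [J : f ^ N]. By the choice of [f], each element of [m] has a power that carries [be]
   into [J]. *)
have [be hbe] : exists2 be, colon J (f ^+ N) be & ideal_pow M L (u - phi be).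
  apply: (ext_approx phi_dense); first by auto.
  apply: (ext_colon noethR hm phi_inj phi_dense cB) => //; apply: hN.
  by rewrite rmorphXn; apply: ideal_powX; exact: ext_mem.
move=> /hL[r hr _].
(* Modulo [P], [v be = a ^ s w] with [w] a unit, so [al / be] equals [a v / w] and lies in the
   maximal ideal of [B / P]. This is the reason for the exponent [s.+1] in [al]. *)
pose w := 1 - v * r * phi a.
have nMw : ~ M w.
  move=> Mw; case: (hM) => _ + _; apply; rewrite -(subrK (v * r * phi a) 1).
  by apply: (idealD hM') => //; apply: (idealMl _ hM'); exact: Ma.
have hvb : P (v * phi be - phi a ^+ s * w).
  have -> : v * phi be - phi a ^+ s * w =
     - ((phi a ^+ s - u * v) + v * ((u - phi be) - r * phi al)).
    by rewrite /w /al rmorphXn exprSr; ring.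
  apply: (idealN hP); apply: (idealD hP) => //; apply: (idealMl _ hP).
  exact: hr.
have nbe : ~ p be.
  move=> pbe; have : P (phi a ^+ s * w).
    rewrite -(subKr (v * phi be) (phi a ^+ s * w)); apply: (idealB hP) hvb.
    by apply: (idealMl _ hP); apply: pPsub; apply: ext_mem.
  by move=> /(primeM pP)[/(primeX pP)|/PM].
(* With denominators cleared: [F (al / be)] is congruent to [F (0)] modulo [a] in [B / P]. *)
have eval F : exists l c e, homogenized al be l F c /\
    P (v ^+ l * phi c - phi a ^+ (s * l) * (phi F`_0 * w ^+ l + phi a * e)).
  elim/poly_ind: F => [|F c0 [l [d [e [hd he]]]]].
    exists 0%N, 0, 0; split; first exact: homogenized0.
    by rewrite coef0 rmorph0 !(mulr0, mul0r, addr0, subr0); exact: ideal0.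
  exists l.+1, (d * al + be ^+ l.+1 * c0), (v * (phi F`_0 * w ^+ l + phi a * e)).
  split; first exact: (homogenized_horner pp nbe c0 hd).
  rewrite coefD coefMX coefC /= add0r.
  have hpow : P ((v * phi be) ^+ l.+1 - (phi a ^+ s * w) ^+ l.+1).
    by rewrite subrXX; apply: (idealMr _ hP); exact: hvb.
  have -> : v ^+ l.+1 * phi (d * al + be ^+ l.+1 * c0) - phi a ^+ (s * l.+1) *
      (phi c0 * w ^+ l.+1 + phi a * (v * (phi F`_0 * w ^+ l + phi a * e))) =
      v * phi al * (v ^+ l * phi d - phi a ^+ (s * l) * (phi F`_0 * w ^+ l + phi a * e)) +
      phi c0 * ((v * phi be) ^+ l.+1 - (phi a ^+ s * w) ^+ l.+1).
    rewrite /al rmorphD !rmorphM !rmorphXn !exprMn -!exprM mulnS exprD.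
    by rewrite (exprSr (phi a) s) (exprSr v l); ring.
  by apply: (idealD hP); exact: (idealMl _ hP).
set Q1 := ratker p al be; set Q2 := maxpoly m.
have pQ1 : is_prime Q1 by exact: ratker_prime.
have pQ2 : is_prime Q2 by apply: maxpoly_prime; exact: loc_prime.
have hQ1 : is_ideal Q1 by auto. have hQ2 : is_ideal Q2 by auto.
have phiM x : M (phi x) -> m x.
  move=> h; have := @phi_inj 1%N x; rewrite !ideal_pow1 //; exact.
have Q12 : Q1 `<=` Q2.
  move=> F hF; have [l [c [e [hc he]]]] := eval F; have pc := ratkerP pp nbe hc hF.
  have : P (phi a ^+ (s * l) * (phi F`_0 * w ^+ l + phi a * e)).
    rewrite -(subKr (v ^+ l * phi c) (_ * (_ + _))); apply: (idealB hP) => //.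
    by apply: (idealMl _ hP); apply: pPsub; apply: ext_mem.
  move=> /(primeM pP)[/(primeX pP)//|/PM h]; apply: phiM.
  have : M (phi F`_0 * w ^+ l).
    by apply: (@idealDr _ _ _ (phi a * e) hM') => //; exact: (idealMr _ hM').
  by move=> /(primeM (loc_prime hM))[//|/(primeX (loc_prime hM))].
have split0 (F : {poly R}) : exists F1, F = F1 * 'X + (F`_0)%:P.
  elim/poly_ind: F => [|F c _]; first by exists 0; rewrite coef0 mul0r addr0.
  by exists F; rewrite coefD coefMX coefC /= add0r.
have X2 : Q2 'X by rewrite /Q2 /maxpoly /= coefX; exact: ideal0.
(* For [g] in [m], the relation of [g ^ n * be] with [al] modulo [p] is a linear polynomial of [Q1]
   with constant term [g ^ n]; so a prime containing [Q1] and ['X] contains [g]. *)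
have mQ2 : minover (addx Q1 'X) Q2.
  split=> //; first by apply: addx_min.
  move=> Q pQ hQ _ F; rewrite /Q2 /maxpoly /= => mF0.
  have hQ' : is_ideal Q by auto.
  have [F1 ->] := split0 F; apply: (idealD hQ').
    by apply: (idealMl _ hQ'); apply/hQ/addx_self.
  have [n [r' hr' _]] := hf N be F`_0 hbe mF0.
  have : Q (((- r')%:P) * 'X + (F`_0 ^+ n)%:P).
    apply: hQ; apply: addx_sub => //; exists 1%N, (- r' * al + be ^+ 1 * F`_0 ^+ n); split.
      by have -> : - r' * al + be ^+ 1 * F`_0 ^+ n = F`_0 ^+ n * be - r' * al by rewrite expr1; ring.
    by apply: (homogenized_horner pp nbe); exact: homogenized_const.
  move=> hX; apply: (@primeX _ _ _ n) => //; rewrite -rmorphXn.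
  by apply: (idealDl hQ' _ hX); apply: (idealMl _ hQ'); apply/hQ/addx_self.
have noethRX : noetherian {poly R} by exact: hilbert_basis.
have pp0 : is_prime (polyset p) by exact: polyset_prime.
have nlin : ~ polyset p (linear_poly al be).
  move=> /(_ 1%N); rewrite /linear_poly coefB coefCM coefX coefC /= mulr1 subr0.
  exact: nbe.
have s01 : polyset p `<=` Q1 by exact: polyset_sub_ratker.
have n10 : ~ Q1 `<=` polyset p by move=> h; apply: nlin; apply: h; exact: linear_ratker.
have n21 : ~ Q2 `<=` Q1.
  move=> /(_ _ X2) h; have hX : homogenized al be 1 (1%:P * 'X + 0%:P) (1 * al + be ^+ 1 * 0).
    by apply: (homogenized_horner pp nbe); exact: homogenized_const.
  rewrite mul1r addr0 mul1r mulr0 addr0 in hX.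
  by have := ratkerP pp nbe hX h; move/(primeX pp).
have sat2 : saturated_chain (polyset p) Q2 2.
  exists (fun i => match i with 0 => polyset p | 1 => Q1 | _ => Q2 end); split=> //.
    by split=> [[|[|[|i]]]|[|[|i]]].
  case=> [|[|i]] // _ [Q [pQ [h1 h2] [h3 h4]]].
    by apply: h4; exact: (ratker_saturated pp nbe).
  apply: (krull_pit noethRX hQ1 mQ2); apply: (dimge_rcons _ h3 h4) => //.
  by apply: (dimge_rcons _ h1 h2) => //; exact: dimge0.
have constS q q' : is_ideal q -> is_ideal q' -> q `<=` q' -> ~ q' `<=` q ->
    polyset q `<=` polyset q' /\ ~ polyset q' `<=` polyset q.
  move=> hq hq' qq' /nonsubset[x [q'x nqx]]; split; first by move=> F hF i; exact: qq'.
  move=> h; apply: nqx; have := h x%:P; rewrite /polyset /= => h'.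
  have := h' _ 0%N; rewrite coefC /=; apply=> i.
  by rewrite coefC; case: eqP => // _; exact: ideal0.
have [n ln sn] : exists2 n, (3 <= n)%N & saturated_chain (polyset p) Q2 n.
  apply: (saturated_exists noethRX) => //.
  have [q1 [d1' q1m nmq1]] := dimgeS dp2; have [q0 [d0 q01 nq10]] := dimgeS d1'.
  have pq0 := dimge_prime d0; have pq1 := dimge_prime d1'.
  have [a1 a2] := constS q0 q1 (prime_ideal pq0) (prime_ideal pq1) q01 nq10.
  have [b1 b2] := constS q1 m (prime_ideal pq1) hm' q1m nmq1.
  apply: (@dimge_rcons _ _ (polyset m)) => //.
  - by move=> F; exact.
  - move=> /(_ _ X2)/(_ 1%N); rewrite coefX /=; by case: hm.
  apply: (dimge_rcons _ b1 b2); first by apply: polyset_prime; exact: loc_prime.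
  apply: (dimge_rcons _ a1 a2); first exact: polyset_prime.
  apply: dimge0; first exact: polyset_prime.
  by move=> F hF i; exact: (dimge_subset d0).
have [k0 [_ uniq]] := catRX pp0 pQ2 (subset_trans s01 Q12).
by move: ln; rewrite -(uniq _ sn) (uniq _ sat2).
Qed.

(** Induction by cutting with one [y] of [m]: a minimal prime [P1] of [P + y] contracts to a minimal
    prime of [p + y], whose dimension is known since [R] is catenary. For the induction hypothesis
    [P1] has to be minimal over [(p, y) B] and not merely over [P + y]. *)
Theorem ratliff p P l : is_prime p -> minover (ext phi p) P -> dimge p m l -> dimge P M l.
Proof.
elim: l p P => [|l IHl] p P pp mP d.
  have [pP _ _] := mP; apply: dimge0; [exact: loc_prime | exact: prime_sub_loc].
have [pP pPsub minP] := mP; have hP : is_ideal P by auto. have hp : is_ideal p by auto.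
have hE := ext_ideal phi p.
have pE : phi @^-1` P = p by apply: prime_contract noethR hm phi_inj phi_dense cB _ _ pp mP.
have PM : P `<=` M by exact: prime_sub_loc.
have [Q0 [dQ0 Q0m nmQ0]] := dimgeS d.
have nmp : ~ m `<=` p by move=> mp; apply: nmQ0; exact: subset_trans (dimge_subset dQ0).
(* Dimension zero would make [p] maximal, and dimension one is [no_short_component]. Dimension at
   least two is used below to know that [P1] is not [M]. *)
have [d2|nd2] := EM (dimge P M 2); last first.
  have [d1|nd1] := EM (dimge P M 1); last first.
    case: nmp; rewrite -pE => x mx; apply: contrapT => nPx; apply: nd1.
    apply: (@dimge_rcons _ _ P) => //; [exact: loc_prime | | exact: dimge0].
    by move=> h; apply: nPx; apply: (h); apply: ext_mem.
  case: l d {IHl dQ0} => // l d; case: (no_short_component pp mP d1 nd2).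
  exact: dimge_le d.
have [ps [h1 h2]] := finite_minover noethB hE.
have /choice[bad hbad] : forall Q, exists qs : seq (set B),
    (forall q : set B, q \in qs -> is_prime q) /\ (is_prime Q -> forall q : set B, minover (isum P Q) q -> q \in qs).
  move=> Q; have [pQ|npQ] := EM (is_prime Q); last by exists [::].
  have [qs [k1 k2]] := finite_minover noethB (isum_ideal hP (prime_ideal pQ)).
  by exists qs; split=> // q /k1[].
(* The primes other than [M] where [P] begins to meet a component [Pi] of [p B]. If [P1] were not
   minimal over [(p, y) B], it would be minimal over such a sum [P + Pi], and [y] is chosen outside
   the contractions of these primes. *)
pose bads := [seq Q <- flatten [seq bad Q | Q <- ps] | `[< ~ M `<=` Q >]].
have [|y [my hy]] := @prime_avoid0 _ m (p :: [seq phi @^-1` Q | Q <- bads]) hm'.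
  move=> q; rewrite inE => /orP[/eqP -> //|/mapP[Q]].
  rewrite mem_filter => /andP[/asboolP nMQ /flattenP[_ /mapP[Q' _ ->] hQ]] ->.
  split; first by apply: preimage_prime; exact: (hbad Q').1.
  move=> mQ; apply: nMQ; apply: ext_min => //; apply: prime_ideal; exact: (hbad Q').1.
have npy : ~ p y by apply: hy; rewrite mem_head.
have nPy : ~ P (phi y) by move=> h; apply: npy; rewrite -pE.
have hPy : is_ideal (addx P (phi y)) by auto.
have [|P1 mP1 P1M] := minover_exists noethB hPy (loc_prime hM).
  by apply: addx_min => //; exact: ext_mem.
have [pP1 PP1 minP1] := mP1.
have PP1' : P `<=` P1 by apply: subset_trans PP1; exact: addx_sub.
have P1y : P1 (phi y) by apply/PP1/addx_self.
have nP1P : ~ P1 `<=` P by move=> h; apply/nPy/h.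
have hpy : is_ideal (addx p y) by auto.
have mP1' : minover (ext phi (addx p y)) P1.
  rewrite ext_addx //; split=> //.
    by apply: addx_min => //; [auto | exact: subset_trans PP1'].
  move=> P2 pP2 hP2 P21.
  have pP2' : ext phi p `<=` P2 by apply: subset_trans hP2; exact: addx_sub.
  have [PP2|nPP2] := EM (P `<=` P2).
    by apply: minP1 => //; apply: addx_min => //; [auto | apply/hP2/addx_self].
  have [Pi mPi Pi2] := minover_exists noethB hE pP2 pP2'.
  have [pPi pPi' minPi] := mPi.
  have nPiP : ~ Pi `<=` P.
    by move=> h; apply: nPP2; apply: subset_trans Pi2; exact: minP.
  have hs : is_ideal (isum P Pi) by auto.
  have [|P3 mP3 P31] := minover_exists noethB hs pP1.
    by apply: isum_min => //; [auto | exact: subset_trans P21].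
  have [pP3 hP3 _] := mP3.
  have P13 : P1 `<=` P3.
    apply: contrapT => nP13; apply: (krull_pit noethB hP mP1).
    apply: (@dimge_rcons _ _ P3) => //; apply: (@dimge_rcons _ _ P) => //.
    + by apply: subset_trans hP3; apply: isum_l; auto.
    + by move=> h; apply: nPiP; apply: subset_trans h; apply: subset_trans hP3; apply: isum_r; auto.
    + exact: dimge0.
  have E3 : P3 = P1 by apply/seteqP.
  exfalso; apply: (hy (phi @^-1` P1)) => //.
  rewrite inE; apply/orP; right; apply/mapP; exists P1 => //.
  rewrite mem_filter; apply/andP; split.
    apply/asboolP => MP1; apply: (krull_pit noethB hP mP1).
    by have -> : P1 = M by apply/seteqP.
  apply/flattenP; exists (bad Pi); first by apply/mapP; exists Pi => //; exact: h2.
  by apply: (hbad Pi).2 => //; rewrite -E3.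
have mp1 := minover_contract noethR hm phi_inj phi_dense cB hpy mP1'.
set p1 := phi @^-1` P1 in mp1; have [pp1 ppy1 _] := mp1.
have p1m : p1 `<=` m by exact: prime_sub_loc.
have d' : dimge p1 m l := catenary_dim noethR catR pp npy mp1 p1m d.
have mP1'' : minover (ext phi p1) P1.
  split=> //; first by apply: ext_min => //; auto.
  move=> Q pQ hQ QP1; have [_ _ h] := mP1'; apply: h => //.
  by apply: subset_trans hQ; exact: extS.
have dP1 := IHl p1 P1 pp1 mP1'' d'.
apply: dimge_cons dP1 => q pq P1q _; exists P; split=> //; first exact: subset_trans P1q.
by move=> h; apply: nP1P; exact: subset_trans h.
Qed.

End Ratliff.

(** * Localization and the generic formal fibre *)

Definition mulset (B : comPzRingType) (S : set B) := S 1 /\ forall x y, S x -> S y -> S (x * y).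

Section FractionRing.
Variables (B : comPzRingType) (W : {S : set B | mulset S}).
Local Notation S := (sval W).
Local Open Scope quotient_scope.
Implicit Types (a b s u : B) (x y z : B * B).

Let S1 : S 1. Proof. by case: (svalP W). Qed.
Let SM s s' : S s -> S s' -> S (s * s'). Proof. by case: (svalP W) => _; apply. Qed.

(* The junk denominators are read as [1], so that all pairs represent fractions. *)
Definition fden x := if `[< S x.2 >] then x.2 else 1.

Lemma fdenS x : S (fden x). Proof. by rewrite /fden; case: asboolP. Qed.

Lemma fdenE a s : S s -> fden (a, s) = s.
Proof. by move=> hs; rewrite /fden /=; case: asboolP. Qed.

Definition feqv x y := `[< exists2 u, S u & u * (x.1 * fden y - y.1 * fden x) = 0 >].

Lemma feqv_refl : reflexive feqv.
Proof. by move=> x; apply/asboolP; exists 1 => //; rewrite subrr mulr0. Qed.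

Lemma feqv_sym : symmetric feqv.
Proof.
by move=> x y; apply/asboolP/asboolP => -[u hu e]; exists u => //;
   rewrite -[LHS]opprK -mulrN opprB e oppr0.
Qed.

Lemma feqv_trans : transitive feqv.
Proof.
move=> y x z /asboolP[u hu e] /asboolP[v hv e']; apply/asboolP.
exists (u * v * fden y); first by apply: SM; [exact: SM | exact: fdenS].
have -> : u * v * fden y * (x.1 * fden z - z.1 * fden x) =
  v * fden z * (u * (x.1 * fden y - y.1 * fden x)) +
  u * fden x * (v * (y.1 * fden z - z.1 * fden y)) by ring.
by rewrite e e' !mulr0 addr0.
Qed.

Canonical feqv_equiv := EquivRel feqv feqv_refl feqv_sym feqv_trans.

Definition fractions := {eq_quot feqv}.
HB.instance Definition _ := Choice.on fractions.

Definition mkfrac a s : fractions := \pi_fractions (a, s).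

Lemma mkfrac_eq x y : \pi_fractions x = \pi_fractions y <->
  exists2 u, S u & u * (x.1 * fden y - y.1 * fden x) = 0.
Proof.
split; first by move=> /eqP; rewrite eqmodE => /asboolP.
by move=> h; apply/eqP; rewrite eqmodE; apply/asboolP.
Qed.

Lemma mkfracE a s b t : S s -> S t ->
  mkfrac a s = mkfrac b t <-> exists2 u, S u & u * (a * t - b * s) = 0.
Proof. by move=> hs ht; rewrite mkfrac_eq /= !fdenE. Qed.

Lemma mkfracP (t : fractions) : exists a s, S s /\ t = mkfrac a s.
Proof.
exists (repr t).1, (fden (repr t)); split; first exact: fdenS.
rewrite -[LHS]reprK; apply/mkfrac_eq; exists 1 => //=.
by rewrite fdenE ?subrr ?mulr0 //; exact: fdenS.
Qed.

Lemma repr_mkfrac a s : S s -> exists2 u, S u &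
  u * ((repr (mkfrac a s)).1 * s - a * fden (repr (mkfrac a s))) = 0.
Proof.
move=> hs; have : \pi_fractions (repr (mkfrac a s)) = \pi_fractions (a, s) by rewrite reprK.
by move=> /mkfrac_eq /=; rewrite fdenE.
Qed.

Definition fadd (t t' : fractions) : fractions := let x := repr t in let y := repr t' in
  mkfrac (x.1 * fden y + y.1 * fden x) (fden x * fden y).
Definition fmul (t t' : fractions) : fractions := let x := repr t in let y := repr t' in
  mkfrac (x.1 * y.1) (fden x * fden y).
Definition fopp (t : fractions) : fractions := let x := repr t in mkfrac (- x.1) (fden x).

Lemma faddE a s b t : S s -> S t ->
  fadd (mkfrac a s) (mkfrac b t) = mkfrac (a * t + b * s) (s * t).
Proof.
move=> hs ht; have [u hu ex] := repr_mkfrac a hs; have [v hv ey] := repr_mkfrac b ht.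
rewrite /fadd; set x := repr _ in ex *; set y := repr _ in ey *.
have hx := fdenS x; have hy := fdenS y.
apply/mkfracE; [exact: SM | exact: SM |].
exists (u * v); first exact: SM.
have -> : u * v * ((x.1 * fden y + y.1 * fden x) * (s * t) - (a * t + b * s) * (fden x * fden y))
  = v * t * fden y * (u * (x.1 * s - a * fden x)) + u * s * fden x * (v * (y.1 * t - b * fden y)).
  by ring.
by rewrite ex ey !mulr0 addr0.
Qed.

Lemma fmulE a s b t : S s -> S t -> fmul (mkfrac a s) (mkfrac b t) = mkfrac (a * b) (s * t).
Proof.
move=> hs ht; have [u hu ex] := repr_mkfrac a hs; have [v hv ey] := repr_mkfrac b ht.
rewrite /fmul; set x := repr _ in ex *; set y := repr _ in ey *.
have hx := fdenS x; have hy := fdenS y.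
apply/mkfracE; [exact: SM | exact: SM |].
exists (u * v); first exact: SM.
have -> : u * v * (x.1 * y.1 * (s * t) - a * b * (fden x * fden y))
  = v * t * y.1 * (u * (x.1 * s - a * fden x)) + u * a * fden x * (v * (y.1 * t - b * fden y)).
  by ring.
by rewrite ex ey !mulr0 addr0.
Qed.

Lemma foppE a s : S s -> fopp (mkfrac a s) = mkfrac (- a) s.
Proof.
move=> hs; have [u hu ex] := repr_mkfrac a hs; rewrite /fopp; set x := repr _ in ex *.
have hx := fdenS x; apply/mkfracE => //; exists u => //.
have -> : u * (- x.1 * s - - a * fden x) = - (u * (x.1 * s - a * fden x)) by ring.
by rewrite ex oppr0.
Qed.

Let eq_frac a s b t : S s -> S t -> a * t = b * s -> mkfrac a s = mkfrac b t.
Proof. by move=> hs ht e; apply/mkfracE => //; exists 1; rewrite // e subrr mulr0. Qed.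

Lemma faddA : associative fadd.
Proof.
move=> x y z; have [a [s [hs ->]]] := mkfracP x; have [b [t [ht ->]]] := mkfracP y.
have [c [r [hr ->]]] := mkfracP z; rewrite !faddE; try by do ?apply: SM.
by apply: eq_frac; [by do ?apply: SM | by do ?apply: SM | ring].
Qed.

Lemma faddC : commutative fadd.
Proof.
move=> x y; have [a [s [hs ->]]] := mkfracP x; have [b [t [ht ->]]] := mkfracP y.
by rewrite !faddE // addrC (mulrC s).
Qed.

Lemma fadd0 : left_id (mkfrac 0 1) fadd.
Proof. by move=> x; have [a [s [hs ->]]] := mkfracP x; rewrite faddE // mul0r add0r mulr1 mul1r. Qed.

Lemma faddN : left_inverse (mkfrac 0 1) fopp fadd.
Proof.
move=> x; have [a [s [hs ->]]] := mkfracP x; rewrite foppE // faddE //.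
by apply: eq_frac; [exact: SM | | ring].
Qed.

HB.instance Definition _ := GRing.isZmodule.Build fractions faddA faddC fadd0 faddN.

Lemma fmulA : associative fmul.
Proof.
move=> x y z; have [a [s [hs ->]]] := mkfracP x; have [b [t [ht ->]]] := mkfracP y.
have [c [r [hr ->]]] := mkfracP z; rewrite !fmulE; try by do ?apply: SM.
by rewrite !mulrA.
Qed.

Lemma fmulC : commutative fmul.
Proof.
move=> x y; have [a [s [hs ->]]] := mkfracP x; have [b [t [ht ->]]] := mkfracP y.
by rewrite !fmulE // (mulrC a) (mulrC s).
Qed.

Lemma fmul1 : left_id (mkfrac 1 1) fmul.
Proof. by move=> x; have [a [s [hs ->]]] := mkfracP x; rewrite fmulE // !mul1r. Qed.

Lemma fmulD : left_distributive fmul fadd.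
Proof.
move=> x y z; have [a [s [hs ->]]] := mkfracP x; have [b [t [ht ->]]] := mkfracP y.
have [c [r [hr ->]]] := mkfracP z; rewrite !(faddE, fmulE); try by do ?apply: SM.
by apply: eq_frac; [by do ?apply: SM | by do ?apply: SM | ring].
Qed.

HB.instance Definition _ := GRing.Zmodule_isComPzRing.Build fractions fmulA fmulC fmul1 fmulD.

Definition to_fractions a : fractions := mkfrac a 1.

Lemma to_fractions_zmod : zmod_morphism to_fractions.
Proof.
move=> a b; rewrite /to_fractions; apply/esym.
rewrite -[LHS]/(fadd (mkfrac a 1) (fopp (mkfrac b 1))) foppE // faddE //.
by apply: eq_frac; [exact: SM | | ring].
Qed.

Lemma to_fractions_monoid : monoid_morphism to_fractions.
Proof.
split=> // a b; rewrite /to_fractions; apply/esym.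
by rewrite -[LHS]/(fmul (mkfrac a 1) (mkfrac b 1)) fmulE // mulr1.
Qed.

HB.instance Definition _ := GRing.isZmodMorphism.Build B fractions to_fractions to_fractions_zmod.
HB.instance Definition _ :=
  GRing.isMonoidMorphism.Build B fractions to_fractions to_fractions_monoid.

Lemma to_fractions_localization : is_localization S (to_fractions : {rmorphism B -> fractions}).
Proof.
split=> [s hs|t|a].
- exists (mkfrac 1 s); rewrite -[LHS]/(fmul (mkfrac s 1) (mkfrac 1 s)) fmulE //.
  by apply: (@eq_frac _ _ 1 1); [exact: SM | | ring].
- have [a [s [hs ->]]] := mkfracP t; exists a, s; split=> //.
  rewrite -[LHS]/(fmul (mkfrac a s) (mkfrac s 1)) fmulE //.
  by apply: eq_frac; [exact: SM | | ring].
move=> /(mkfracE _ _ S1 S1)[u hu]; rewrite !mulr1 subr0 => e.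
by exists u.
Qed.

End FractionRing.

Lemma localization_exists (B : comPzRingType) (S : set B) : mulset S ->
  exists (C : comPzRingType) (f : {rmorphism B -> C}), is_localization S f.
Proof.
move=> hS; pose W : {S : set B | mulset S} := exist _ S hS.
by exists (fractions W), (@to_fractions B W); exact: (to_fractions_localization W).
Qed.

Lemma rmorphism_of (A D : comPzRingType) (v : A -> D) : zmod_morphism v -> monoid_morphism v ->
  exists w : {rmorphism A -> D}, w =1 v.
Proof.
move=> h1 h2.
pose w : {rmorphism A -> D} := HB.pack v (GRing.isZmodMorphism.Build A D v h1)
  (GRing.isMonoidMorphism.Build A D v h2).
by exists w.
Qed.

Lemma unit_cancel (D : comPzRingType) (s u x y : D) : s * u = 1 -> x * s = y * s -> x = y.
Proof. by move=> su e; rewrite -[x]mulr1 -[y]mulr1 -su !mulrA e. Qed.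

Section LocalizationMorphisms.
Variables (B T : comPzRingType) (S : set B) (f : {rmorphism B -> T}).
Hypotheses (hS : mulset S) (hf : is_localization S f).

Let S1 : S 1. Proof. by case: hS. Qed.
Let SM s s' : S s -> S s' -> S (s * s'). Proof. by case: hS => _; apply. Qed.

Lemma localization_uniq (D : comPzRingType) (w w' : {rmorphism T -> D}) :
  w \o f =1 w' \o f -> w =1 w'.
Proof.
move=> e t; have [hu /(_ t)[a [s [hs ts]]] _] := hf; have [u su] := hu s hs.
apply: (@unit_cancel _ (w (f s)) (w u)); first by rewrite -rmorphM su rmorph1.
rewrite -rmorphM ts; have /= -> := e a; have /= -> := e s.
by rewrite -rmorphM ts.
Qed.

(** The map is defined through its graph, which is single valued by the description of the kernel of
    [f]. *)
Lemma localization_map (D : comPzRingType) (g : {rmorphism B -> D}) :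
  (forall s, S s -> exists u, g s * u = 1) -> exists v : {rmorphism T -> D}, v \o f =1 g.
Proof.
move=> gu; have [_ hfr hker] := hf.
pose graph t x := exists a s, [/\ S s, t * f s = f a & x * g s = g a].
have fun_graph t x x' : graph t x -> graph t x' -> x = x'.
  move=> [a [s [hs ts xs]]] [a' [s' [hs' ts' xs']]].
  have [|u hu e] := hker (a * s' - a' * s).
    by rewrite rmorphB !rmorphM -ts -ts' mulrAC subrr.
  have [y yu] := gu u hu; have [z zs] := gu _ (SM hs hs').
  apply: (unit_cancel zs); apply: (unit_cancel yu).
  have -> : x * g (s * s') * g u = g u * (x * g s * g s') by rewrite rmorphM; ring.
  have -> : x' * g (s * s') * g u = g u * (x' * g s' * g s) by rewrite rmorphM; ring.
  by rewrite xs xs' -!rmorphM; apply/eqP; rewrite -subr_eq0 -rmorphB -mulrBr e rmorph0.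
have /choice[v hv] : forall t, exists x, graph t x.
  move=> t; have [a [s [hs ts]]] := hfr t; have [u su] := gu s hs.
  by exists (g a * u), a, s; split=> //; rewrite mulrAC -mulrA su mulr1.
have [||w hw] := @rmorphism_of _ _ v.
- move=> t t'; apply: (fun_graph (t - t')) => //.
  have [a [s [hs ts xs]]] := hv t; have [a' [s' [hs' ts' xs']]] := hv t'.
  exists (a * s' - a' * s), (s * s'); split; first exact: SM.
    by rewrite rmorphB !rmorphM -ts -ts'; ring.
  by rewrite rmorphB !rmorphM -xs -xs'; ring.
- split; first by apply: (fun_graph 1) => //; exists 1, 1; rewrite !rmorph1 !mulr1.
  move=> t t'; apply: (fun_graph (t * t')) => //.
  have [a [s [hs ts xs]]] := hv t; have [a' [s' [hs' ts' xs']]] := hv t'.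
  exists (a * a'), (s * s'); split; first exact: SM.
    by rewrite !rmorphM -ts -ts'; ring.
  by rewrite !rmorphM -xs -xs'; ring.
exists w => a /=; rewrite hw; apply: (fun_graph (f a)) => //.
by exists a, 1; rewrite !rmorph1 !mulr1.
Qed.

Lemma ext_localization J t : is_ideal J ->
  ext f J t <-> exists b s, [/\ J b, S s & t * f s = f b].
Proof.
move=> hJ; have [hu hfr _] := hf; split; last first.
  move=> [b [s [Jb hs e]]]; have [u su] := hu s hs.
  rewrite -[t]mulr1 -su mulrA e; apply: (idealMr _ (ext_ideal f J)); exact: ext_mem.
apply: (ext_min (P := [set t | exists b s, [/\ J b, S s & t * f s = f b]])).
  split; first by exists 0, 1; split; rewrite ?rmorph0 ?mul0r //; exact: ideal0.
  move=> c x y [b [s [Jb hs e]]] [b' [s' [Jb' hs' e']]].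
  have [a [r [hr er]]] := hfr c.
  exists (a * b * s' + b' * (r * s)), (r * s * s'); split.
  - apply: (idealD hJ); first by apply: (idealMr _ hJ); exact: (idealMl _ hJ).
    exact: (idealMr _ hJ).
  - by apply: SM => //; exact: SM.
  by rewrite rmorphD !rmorphM -e -e' -er; ring.
by move=> b Jb; exists b, 1; split; rewrite ?rmorph1 ?mulr1.
Qed.

Lemma ext_localization_mem J b : is_ideal J ->
  ext f J (f b) <-> exists2 s, S s & J (s * b).
Proof.
move=> hJ; split.
  move=> /(ext_localization _ hJ)[c [s [Jc hs e]]]; have [_ _ hker] := hf.
  have [|u hu eu] := hker (b * s - c); first by rewrite rmorphB rmorphM e subrr.
  exists (u * s); first exact: SM.
  have -> : u * s * b = u * c by apply/eqP; rewrite -subr_eq0 -[X in _ == X]eu; apply/eqP; ring.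
  exact: (idealMl _ hJ).
move=> [s hs h]; apply/(ext_localization _ hJ); exists (s * b), s; split=> //.
by rewrite -rmorphM mulrC.
Qed.

Lemma ext_localization_prime P b : is_prime P -> (forall s, S s -> ~ P s) ->
  ext f P (f b) -> P b.
Proof.
move=> pP hSP /(ext_localization_mem _ (prime_ideal pP))[s hs].
by apply: primeMl => //; exact: hSP.
Qed.

Lemma localization_prime P : is_prime P -> (forall s, S s -> ~ P s) -> is_prime (ext f P).
Proof.
move=> pP hSP; have hP : is_ideal P by auto. have hE := ext_ideal f P.
split=> //; first by rewrite -(rmorph1 f) => /(ext_localization_prime pP hSP); exact: primeN1.
have [_ hfr _] := hf; move=> x y hxy.
have [a [s [hs ea]]] := hfr x; have [b [r [hr eb]]] := hfr y.
have : ext f P (f (a * b)).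
  rewrite rmorphM -ea -eb mulrACA; exact: (idealMr _ hE).
move=> /(ext_localization_prime pP hSP)/(primeM pP)[Pa|Pb]; [left|right].
  by apply/(ext_localization _ hP); exists a, s.
by apply/(ext_localization _ hP); exists b, r.
Qed.

End LocalizationMorphisms.

Lemma prime_mulset (B : comPzRingType) (Q : set B) : is_prime Q -> mulset (~` Q).
Proof. by move=> pQ; split; [exact: primeN1 | move=> x y; exact: primeNM]. Qed.

Lemma local_with_loc (R : comPzRingType) (m : set R) : noetherian R -> local_with m -> loc m.
Proof.
move=> noethR [[hm m1 _] uniq]; split=> // x nmx; apply: contrapT => nx.
have hx : is_ideal (addx [set 0] x) by auto.
have [|J [hJ J1 xJ maxJ]] := @noeth_max _ noethR (fun J => ~ J 1) _ hx.
  by move=> [r /= e _]; apply: nx; exists r; apply/esym/eqP; rewrite -subr_eq0 mulrC; apply/eqP.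
have EJ : J = m.
  apply: uniq; split=> // K hK K1 JK; apply/seteqP; split=> //; exact: maxJ.
by apply: nmx; rewrite -EJ; apply: xJ; exact: addx_self.
Qed.

(** * Depth and height at a regular prime *)

Section RegularDepth.
Variable B : comPzRingType.
Implicit Types (Q a b : set B) (ys : seq B) (y u f : B).

Fixpoint regseq_at Q a ys : Prop :=
  if ys is y :: ys' then (forall f, a (f * y) -> satc Q a f) /\ regseq_at Q (addx a y) ys'
  else True.

Lemma regseq_rcons Q a ys y : regseq_at Q a (rcons ys y) <->
  regseq_at Q a ys /\ (forall f, adj a ys (f * y) -> satc Q (adj a ys) f).
Proof.
elim: ys a => [|x ys IHys] a /=; first by split=> [[h _]|[_ h]]; split.
by split=> [[h1 /IHys[h2 h3]]|[[h1 h2] h3]]; split=> //; apply/IHys.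
Qed.

(* Depth is at most height, in the form needed here: the maximal ideal of the regular
   local ring is generated by a regular sequence [w], so the Koszul homology of [w] modulo
   [ys] vanishes above degree [size ys]; the top degree consists of the socle. *)
Lemma regular_depth Q ys u l : is_prime Q -> regular_at Q -> regseq_at Q [set 0] ys ->
  Q = colon (adj [set 0] ys) u -> dimge [set 0] Q l -> (l <= size ys)%N.
Proof.
move=> pQ [T [g [hg [noethT [n /(local_with_loc noethT) hn [w nw kd]]]]]] hys Qu dQ.
have mQ := prime_mulset pQ; have hQ : is_ideal Q by auto.
have extQ (P : set B) : is_prime P -> P `<=` Q -> is_prime (ext g P) /\ g @^-1` (ext g P) = P.
  move=> pP PQ; have hPQ s : (~` Q) s -> ~ P s by move=> nQs /PQ.
  split; first exact: (localization_prime mQ hg pP hPQ).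
  apply/seteqP; split=> [b|b Pb]; first exact: (ext_localization_prime mQ hg pP hPQ).
  exact: ext_mem.
have En : n = adj [set 0] w by rewrite nw adj_idl.
have nQ : n = ext g Q.
  have [pE EQ] := extQ Q pQ (@subset_refl _ Q); apply/seteqP; split; last exact: prime_sub_loc.
  move=> t nt; have [hu hfr _] := hg; have [b [s [hs ts]]] := hfr t.
  apply/(ext_localization mQ hg _ hQ); exists b, s; split=> //; apply: contrapT => nQb.
  have [v bv] := hu b nQb; have [hn' n1 _] := hn; apply: n1.
  by rewrite -bv -ts; apply: (idealMr _ hn'); exact: (idealMr _ hn').
have lw : (l <= size w)%N.
  rewrite leqNgt; apply/negP => lw; case: kd => _; apply.
  have [c [[hc cS] cl _]] := dQ; have c_mono := chain_mono (conj hc cS).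
  have hcQ i : (i <= l)%N -> is_prime (ext g (c i)) /\ g @^-1` (ext g (c i)) = c i.
    move=> il; apply: extQ; first exact: hc.
    by rewrite -cl; apply: c_mono; rewrite il leqnn.
  exists (fun i => ext g (c i)); split=> [i iw|i iw].
    by apply: (hcQ _ _).1; exact: leq_trans lw.
  have il : (i < l)%N by exact: leq_trans lw.
  have [c1 c2] := cS i il; split; first exact: extS.
  move=> h; apply: c2; rewrite -(hcQ _ il).2 -(hcQ _ (ltnW il)).2 => b; exact: h.
have dn : dimge [set 0] n (size w).
  case: kd => -[c hc] _; have [h1 _] := hc.
  apply: (@dimge_up _ _ (c (size w))); [exact: loc_prime | |].
    by apply: prime_sub_loc => //; exact: h1.
  by exists c; split=> // _ ->; apply: ideal0; apply: prime_ideal; exact: h1.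
have h0 : is_ideal [set 0 : T] by auto.
have reg_w := reg_regperm noethT hn h0 (esym En) dn.
apply: leq_trans lw _; rewrite leqNgt; apply/negP => yw.
have cancel a s t : is_ideal a -> ~ Q s -> ext g a (t * g s) -> ext g a t.
  move=> ha nQs h; have [hu _ _] := hg; have [v sv] := hu s nQs.
  by rewrite -[t]mulr1 -sv mulrA; apply: (idealMr _ (ext_ideal g a)).
have kills : forall ys' a k, is_ideal a -> regseq_at Q a ys' ->
    (forall j, (k < j)%N -> killsH 1 w j (ext g a)) ->
    forall j, (k + size ys' < j)%N -> killsH 1 w j (ext g (adj a ys')).
  elim=> [|y ys' IHys] a k ha /=; first by move=> _ hk j; rewrite addn0; exact: hk.
  move=> [reg1 reg2] hk j; rewrite addnS -addSn; apply: (IHys (addx a y)) => //; first by auto.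
  case=> [//|j'] kj; rewrite ext_addx //; apply: killsH_quotient; last 2 first.
  - exact: hk.
  - by apply: hk; exact: ltnW.
  - exact: ext_ideal.
  move=> t /(ext_localization mQ hg _ ha)[b [s [ab nQs e]]].
  have [_ hfr _] := hg; have [b' [r [nQr e']]] := hfr t.
  have : ext g a (g (b' * y)).
    rewrite rmorphM -e' mulrAC; apply: (idealMr _ (ext_ideal g a)).
    by apply: (cancel _ s) => //; rewrite e; apply: ext_mem; exact: ab.
  move=> /(ext_localization_mem mQ hg _ ha)[c nQc]; rewrite mulrA => /reg1[d nQd acb].
  apply: (cancel _ r) => //; rewrite e'; apply/(ext_localization_mem mQ hg _ ha).
  by exists (d * c); [exact: primeNM | rewrite -mulrA].
have hys0 : is_ideal (adj [set 0] ys) by auto.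
have ks : kseq 1 [set 0] w.
  by apply/kseqP => w1 x w2 ew f; rewrite mul1r; apply: (reg_w w1 x w2); rewrite ew.
have gu : ext g (adj [set 0] ys) (g u).
  apply: (@killsH_top _ w); first exact: ext_ideal.
    apply: (kills ys [set 0] 0%N) => //.
    move=> j j0; rewrite (ext_adj g [::]) /= -(expr1n _ (size w)).
    by apply: killsH_kseq => //; [by move=> y; exact: adj_mem | rewrite -{1}(add0n (size w)) ltn_add2r].
  move=> x xw; have : ext g Q x by rewrite -nQ En; exact: adj_mem.
  move=> /(ext_localization mQ hg _ hQ)[b [s [Qb nQs e]]].
  apply: (cancel _ s) => //; rewrite -mulrA e -rmorphM mulrC; apply: ext_mem.
  by move: Qb; rewrite Qu.
have [s nQs] := (ext_localization_mem mQ hg _ hys0).1 gu.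
by move=> h; apply: nQs; rewrite Qu.
Qed.

End RegularDepth.

(** * The generic formal fibre as a ring of fractions *)

Lemma fraction_localization (R : idomainType) :
  is_localization [set r : R | r != 0] (@tofrac R : {rmorphism R -> {fraction R}}).
Proof.
split=> [s /= s0|t|a /= /eqP].
- by exists (tofrac s)^-1; rewrite divff // tofrac_eq0.
- elim/quotW: t => x; exists \n_x, \d_x; split; first exact: denom_ratioP.
  have tofracE a : tofrac a = \pi_{fraction R}%qT (Ratio a 1) by unlock FracField.tofrac.
  apply: etrans (congr1 (FracField.mul _) (tofracE _)) (etrans _ (esym (tofracE _))).
  apply: etrans (esym (FracField.pi_mul _ _)) _.
  apply/eqP; rewrite eqmodE /= FracField.equivfE.
  rewrite /FracField.mulf !numden_Ratio ?mulr1 ?mul1r ?oner_neq0 ?denom_ratioP //.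
  by rewrite mulrC.
by rewrite tofrac_eq0 => /eqP ->; exists 1; rewrite /= ?oner_neq0 ?mulr0.
Qed.

Lemma localization_at_units (R A : comPzRingType) (m : set R) (f : {rmorphism R -> A}) :
  loc m -> is_localization (~` m) f -> injective f /\ forall t, exists a, t = f a.
Proof.
move=> [_ _ hm] [_ hfr hker]; split=> [a b e|t].
  have [|s /hm[u su] hs] := hker (a - b); first by rewrite rmorphB e subrr.
  by apply/eqP; rewrite -subr_eq0 -[a - b]mul1r -su mulrAC hs mul0r.
have [a [s [/hm[u su] ts]]] := hfr t; exists (a * u).
by rewrite rmorphM -ts -mulrA -rmorphM su rmorph1 mulr1.
Qed.

Lemma regular_at_localization (B T : comPzRingType) (S Q : set B) (i : {rmorphism B -> T}) :
  mulset S -> is_localization S i -> is_prime Q -> (forall s, S s -> ~ Q s) ->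
  regular_at (ext i Q) -> regular_at Q.
Proof.
move=> hS hi pQ SQ [T' [k [hk reg]]]; have hQ : is_ideal Q by auto.
have pP := localization_prime hS hi pQ SQ.
exists T', (k \o i : {rmorphism B -> T'}); split=> //; have [hu hfr hker] := hk; split=> /=.
- by move=> s nQs; apply: hu => h; apply: nQs; exact: (ext_localization_prime hS hi pQ SQ).
- have [iu ifr _] := hi; move=> t'; have [t2 [t [nPt e]]] := hfr t'.
  have [b [s [hs es]]] := ifr t; have [b2 [s2 [hs2 es2]]] := ifr t2.
  exists (b2 * s), (b * s2); split.
    apply: primeNM => //; last exact: SQ.
    by move=> Qb; apply: nPt; apply/(ext_localization hS hi _ hQ); exists b, s.
  rewrite !rmorphM -es -es2 !rmorphM -e; ring.
move=> a /hker[t nPt]; have [_ ifr iker] := hi; have [b [s [hs es]]] := ifr t => e.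
have [|r hr e'] := iker (b * a); first by rewrite rmorphM -es mulrAC e mul0r.
exists (r * b); last by rewrite -mulrA.
apply: primeNM => //; first exact: SQ.
by move=> Qb; apply: nPt; apply/(ext_localization hS hi _ hQ); exists b, s.
Qed.

Lemma ext_comp (R A B : comPzRingType) (f : {rmorphism R -> A}) (g : {rmorphism A -> B})
  (J : set R) : ext g (ext f J) = ext (g \o f : {rmorphism R -> B}) J.
Proof.
apply/seteqP; split; last by apply: ext_min; [exact: ext_ideal | move=> a Ja; do 2 apply: ext_mem].
apply: ext_min; first exact: ext_ideal.
apply: ext_min; first by apply: preimage_ideal; exact: ext_ideal.
move=> a Ja; rewrite /preimage /=.
exact: (@ext_mem _ _ (g \o f : {rmorphism R -> B}) _ _ Ja).
Qed.

Lemma ext_powE (R A : comPzRingType) (f : {rmorphism R -> A}) (m : set R) n :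
  ext f (ideal_pow m n) = ideal_pow (ext f m) n.
Proof.
apply/seteqP; split; last exact: ext_pow.
apply: ext_min; first exact: ideal_pow_ideal.
by move=> a ha; rewrite /preimage /=; exact: phi_pow.
Qed.

Lemma ext_bijective (R A : comPzRingType) (f : {rmorphism R -> A}) (J : set R) a :
  injective f -> (forall t, exists a, t = f a) -> is_ideal J -> ext f J (f a) -> J a.
Proof.
move=> fI fS hJ h; have [b Jb /fI <- //] : exists2 b, J b & f b = f a.
apply: (ext_min (P := [set t | exists2 b, J b & f b = t])) h => [|b Jb]; last by exists b.
split; first by exists 0; [exact: ideal0 | exact: rmorph0].
move=> c x y [b Jb <-] [d Jd <-]; have [e ->] := fS c.
by exists (e * b + d); [exact: hJ.2 | rewrite rmorphD rmorphM].
Qed.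

(** As [R] is local, its localization at [m] is [R] itself. The fibre [T] over the field of
    fractions [L] is compared with the ring of fractions [C] of [B] whose denominators come from
    nonzero elements of [R]: their universal properties give maps both ways, and [T] is therefore
    that localization. A prime of [B] meeting [R] in zero survives in [T], with the same local
    ring. *)
Lemma generic_fibre (R : idomainType) (m : set R) : noetherian R -> loc m -> G_ring R ->
  exists (B : comPzRingType) (phi : {rmorphism R -> B}),
    [/\ forall n a, ideal_pow (ext phi m) n (phi a) -> ideal_pow m n a,
        forall n b, exists a, ideal_pow (ext phi m) n (b - phi a),
        complete_for (ext phi m) (ideal_pow (ext phi m))
      & forall Q, is_prime Q -> (forall r, Q (phi r) -> r = 0) -> regular_at Q].
Proof.
move=> noethR hm G; have [A [f [mA [B [g [hf lA compl reg]]]]]] := G m (loc_prime hm).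
have [fI fS] := localization_at_units hm hf; have hm' : is_ideal m by case: hm.
have EmA : ext f m = mA.
  have unitA t : ~ ext f m t -> exists u, t * u = 1.
    have [a ->] := fS t => nma; have [_ _ hu] := hm; have [|u au] := hu a.
      by move=> ma; apply: nma; exact: ext_mem.
    by exists (f u); rewrite -rmorphM au rmorph1.
  have nE1 : ~ ext f m 1.
    by rewrite -(rmorph1 f) => /(ext_bijective fI fS hm'); case: hm.
  case: lA => _; apply; split=> //; first exact: ext_ideal.
  move=> J hJ J1 EJ; apply/seteqP; split=> // t Jt; apply: contrapT => /unitA[u tu].
  by apply: J1; rewrite -tu; exact: idealMr.
pose phi : {rmorphism R -> B} := g \o f.
have EM n : idl (g @` ideal_pow mA n) = ideal_pow (ext phi m) n.
  by rewrite -EmA -ext_powE -/(ext g _) ext_comp ext_powE.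
case: compl => sep lim dense inj.
exists B, phi; split.
- move=> n a; rewrite -EM => /inj; rewrite -EmA -ext_powE.
  by apply: ext_bijective.
- by move=> n b; have [t] := dense n b; have [a ->] := fS t; rewrite EM => h; exists a.
- split=> //.
    move=> x hx; suff : [set 0] x by [].
    by rewrite -sep => n _; rewrite EM.
  move=> t ht; have [|y hy] := lim (fun n => \sum_(i < n) t i).
    by move=> n; rewrite big_ord_recr /= addrAC subrr add0r EM.
  by exists y => n; rewrite -EM.
move=> Q pQ Q0; pose L := {fraction R}; pose tf : {rmorphism R -> L} := @tofrac R.
have nz_mul : mulset [set r : R | r != 0].
  by split=> [|x y /= x0 y0]; [exact: oner_neq0 | rewrite mulf_neq0].
have tf_loc : is_localization [set r : R | r != 0] tf by exact: fraction_localization.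
have [h hE] : exists h : {rmorphism A -> L}, h \o f =1 tf.
  apply: (localization_map (prime_mulset (loc_prime hm)) hf) => s nms.
  have [_ _ /(_ s nms)[u su]] := hm; exists (tf u).
  by rewrite -rmorphM su rmorph1.
have [|T [i [j [[comm univ] [_ regT]]]]] := reg L h.
  exists [:: 1] => x; exists (fun=> x); split; last by rewrite big_ord1 mulr1.
  move=> _; have [_ hfr _] := tf_loc; have [a [s [s0 e]]] := hfr x.
  exists (f a), (f s); have /= -> := hE a; have /= -> := hE s.
  by rewrite -e mulfK // tofrac_eq0.
pose S : set B := phi @` [set r | r != 0].
have hS : mulset S.
  split; first by exists 1; [exact: oner_neq0 | rewrite rmorph1].
  by move=> _ _ [r r0 <-] [s s0 <-]; exists (r * s); rewrite ?rmorphM //= mulf_neq0.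
have ijE r : i (phi r) = j (tf r) by have /= -> := comm (f r); have /= -> := hE r.
have [C [iota hC]] := localization_exists hS; have [Cu Cfr Cker] := hC.
have [v vE] : exists v : {rmorphism L -> C}, v \o tf =1 (iota \o phi).
  by apply: (localization_map nz_mul tf_loc) => r r0; apply: Cu; exists r.
have [|[w [wi wj]] _] := univ C iota v.
  by move=> a /=; have [r ->] := fS a; have /= -> := hE r; have /= -> := vE r.
have iu s : S s -> exists u, i s * u = 1.
  move=> [r r0 <-]; exists (j (tf r)^-1); rewrite ijE -rmorphM divff ?rmorph1 //.
  by rewrite tofrac_eq0.
have [rho rhoE] := localization_map hS hC iu.
have rw : rho \o w =1 idfun.
  have [_] := univ T i j comm; apply => [b|x] /=.
    by have /= -> := wi b; exact: rhoE.
  have /= -> := wj x; apply: (localization_uniq tf_loc (w := rho \o v) (w' := j)) => r /=.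
  by have /= -> := vE r; have /= -> := rhoE (phi r); exact: ijE.
have hi : is_localization S i.
  split=> // [t|a ia].
    have [b [s [hs e]]] := Cfr (w t); exists b, s; split=> //.
    have /= <- := rhoE b; rewrite -e rmorphM; congr (_ * _); first exact: esym (rw t).
    exact: esym (rhoE s).
  by apply: Cker; have /= <- := wi a; rewrite ia rmorph0.
have SQ s : S s -> ~ Q s by move=> [r /= r0 <-] /Q0 e; rewrite e eqxx in r0.
apply: (regular_at_localization hS hi pQ SQ); apply: regT.
exact: (localization_prime hS hi pQ SQ).
Qed.

(** * Uniform annihilators of Koszul homology *)

Section UniformKilling.
Variables (B : comPzRingType) (noethB : noetherian B) (M : set B) (p : nat).
Hypotheses (hM : loc M) (cB : complete_for M (ideal_pow M)).
Hypotheses (prime_p : prime p) (charp : p%:R = 0 :> B).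
Implicit Types (P Q a K : set B) (z w x ys : seq B) (y b c u f : B) (t : seq nat).

Lemma sop_powers x t : size t = size x -> minover (adj [set 0] x) M ->
  exists N, forall y, M y -> adj [set 0] (pw x t) (y ^+ N).
Proof.
move=> st mx; have h0 : is_ideal [set 0 : B] by auto.
have hJ := adj_ideal (pw x t) h0; set J := adj _ _ in hJ *.
have [J1|nJ1] := EM (J 1); first by exists 0%N => y _; rewrite expr0.
have [_ xM minM] := mx.
have mJ : minover J M.
  split=> [||Q pQ JQ QM]; [exact: loc_prime | exact: loc_sub|].
  apply: minM => //; apply: adj_min => //; first by auto.
    by move=> _ /= ->; apply: ideal0; auto.
  move=> y yx; pose i := index y x; have ix : (i < size x)%N by rewrite index_mem.
  have : Q (y ^+ nth 0%N t i).
    apply: JQ; apply: adj_mem => //; apply/mapP; exists (y, nth 0%N t i) => //.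
    have -> : (y, nth 0%N t i) = nth (0, 0%N) (zip x t) i by rewrite nth_zip // nth_index.
    by apply: mem_nth; rewrite size_zip st minnn.
  exact: primeX.
have [c [N [nc h]]] := minover_pow noethB hJ mJ; exists N => y My.
by apply: (loc_sat hM hJ nc); apply: h; exact: ideal_powX.
Qed.

Lemma size_pw x t : size t = size x -> size (pw x t) = size x.
Proof. by move=> st; rewrite size_map size_zip st minnn. Qed.

Variable x : seq B.
Hypothesis mx : minover (adj [set 0] x) M.

(** [b ^ size z] does not depend on [t]: only the exponent [N] that brings [z ^ N] into [(x ^ t)]
    does, and [b] serves for every exponent. The range of degrees comes from [size z], which is at
    least [r]. *)
Lemma killsH_prime Q r : is_prime Q -> dimge Q M r -> exists2 b, ~ Q b &
  forall t j, size t = size x -> (size x < j + r)%N -> killsH b (pw x t) j Q.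
Proof.
move=> pQ dQ; have hQ : is_ideal Q by auto.
have [z [zM mz dz]] := sop_exists noethB hQ (loc_prime hM) (dimge_subset dQ).
have [b nb hb] := colon_killer noethB hM cB prime_p charp pQ mz dz.
exists (b ^+ size z); first exact: primeNX.
move=> t j st jr; have [N hN] := sop_powers st mx.
have su : size (nseq (size z) N) = size z by rewrite size_nseq.
rewrite -(size_pw su); apply: killsH_kseq => //; last first.
  rewrite !size_pw //; apply: leq_trans jr _; rewrite leq_add2l.
  exact: (krull_height noethB hQ mz dQ).
move=> _ /mapP[[y k] /= yk ->].
have [yz ->] : y \in z /\ k = N.
  have := map_f fst yk; rewrite -/(unzip1 _) unzip1_zip ?su // => yz; split=> //.
  by have := map_f snd yk; rewrite -/(unzip2 _) unzip2_zip ?su // => /nseqP[].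
apply: (@adj_subset _ [set 0] _ (pw x t)) (hN y (zM y yz)) => //.
by move=> _ /= ->; exact: ideal0.
Qed.

(** A filtration of [B / a] with prime quotients, by Noetherian induction through [killsH_ext].
    Minimality is assumed only if [a] is inside [P], so that the hypothesis passes to [a : u] and
    [a + u]; an ideal that leaves [P] supplies a multiplier outside [P] by itself. *)
Lemma killsH_minover a P r : is_ideal a -> is_prime P -> dimge P M r ->
  (a `<=` P -> minover a P) -> exists2 b, ~ P b &
  forall t j, size t = size x -> (size x < j + r)%N -> killsH b (pw x t) j a.
Proof.
move=> ha pP dP; elim/noeth_ind: a / ha; first exact: noethB.
move=> a ha IH mP; have [aP|/nonsubset[b [ab nPb]]] := EM (a `<=` P); last first.
  by exists b => // t j _ _; exact: killsH_full.
have [_ _ minP] := mP aP.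
have larger a' : a `<=` a' -> a' `<=` P -> minover a' P.
  by move=> aa' a'P; split=> // Q pQ a'Q QP; apply: minP => //; exact: subset_trans a'Q.
have [pa|npa] := EM (is_prime a).
  have E : a = P by apply/seteqP; split=> //; exact: minP.
  by rewrite E; exact: killsH_prime.
have [u [v [auv nau nav]]] : exists u v, [/\ a (u * v), ~ a u & ~ a v].
  apply: contrapT => no; apply: npa; split=> // [a1|u v auv].
    by apply: (primeN1 pP); exact: aP.
  apply: contrapT => nuv; apply: no; exists u, v; split=> // h; apply: nuv; by [left|right].
have [||b nb hb] := IH (colon a u) (colon_ideal u ha) (colon_sub u ha).
- by move=> /(_ v) h; apply: nav; apply: h; rewrite /colon /= mulrC.
- by apply: larger; exact: colon_sub.
have [||c nc hc] := IH (addx a u) (addx_ideal u ha) (addx_sub u ha).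
- by move=> h; apply: nau; apply: h; exact: addx_self.
- by apply: larger; exact: addx_sub.
exists (b * c); first exact: primeNM.
by move=> t j st jr; apply: killsH_ext => //; [exact: hb | exact: hc].
Qed.

Lemma satc_regX P a y n f : is_prime P -> is_ideal a -> (forall f, a (f * y) -> satc P a f) ->
  a (f * y ^+ n) -> satc P a f.
Proof.
move=> pP ha reg; elim: n f => [|n IHn] f; first by rewrite expr0 mulr1; exact: satc_sub.
rewrite exprSr mulrA => /reg[s ns]; rewrite mulrA => /IHn h.
exact: (satcK pP ns).
Qed.

(** A minimal prime of the preceding elements inside [Q] cannot contain [y], which is regular at
    [P]; so each element adds a step to the chain. *)
Lemma regseq_height P ys Q : is_prime P -> regseq_at P [set 0] ys -> is_prime Q -> Q `<=` P ->
  (forall y, y \in ys -> Q y) -> dimge [set 0] Q (size ys).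
Proof.
move=> pP; have h0 : is_ideal [set 0 : B] by auto.
elim/last_ind: ys Q => [|ys y IHys] Q.
  by move=> _ pQ _ _; apply: dimge0 => // _ /= ->; apply: ideal0; auto.
move=> /regseq_rcons[reg ry] pQ QP ysQ; have ha := adj_ideal ys h0.
have yQ (v : B) : v \in ys -> Q v by move=> zys; apply: ysQ; rewrite mem_rcons inE zys orbT.
have aQ : adj [set 0] ys `<=` Q.
  by apply: adj_min => //; [auto | move=> _ /= ->; apply: ideal0; auto].
have [Q' mQ' Q'Q] := minover_exists noethB ha pQ aQ; have [pQ' aQ' _] := mQ'.
rewrite size_rcons; apply: (@dimge_rcons _ _ Q') => //.
  move=> QQ'; have [c [n [nc hc]]] := minover_pow noethB ha mQ'.
  have /(satc_regX pP ha ry)[s nPs] : adj [set 0] ys (c * y ^+ n).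
    by apply: hc; apply: ideal_powX; apply: QQ'; apply: ysQ; rewrite mem_rcons mem_head.
  move=> /aQ'/(primeM pQ')[Q's|//]; by apply: nPs; apply: QP; exact: Q'Q.
apply: IHys => //; first exact: subset_trans QP.
by move=> v zys; apply: aQ'; exact: adj_mem.
Qed.

Lemma regseq_atS P Q a ys : P `<=` Q -> regseq_at Q a ys -> regseq_at P a ys.
Proof.
move=> PQ; elim: ys a => //= y ys IHys a [h1 h2]; split; last exact: IHys.
by move=> f /h1[c nQc hc]; exists c => // /PQ.
Qed.

Variable S : set B.
Hypothesis fibre_dim : forall Q, is_prime Q -> (forall s, S s -> ~ Q s) ->
  exists e r, [/\ dimge [set 0] Q e, dimge Q M r & (size x <= e + r)%N].
Hypothesis fibre_regular : forall Q, is_prime Q -> (forall s, S s -> ~ Q s) -> regular_at Q.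

Lemma killsH_regseq n ys Q : is_prime Q -> (forall s, S s -> ~ Q s) ->
  (size x <= n + size ys)%N -> regseq_at Q [set 0] ys ->
  exists2 b, ~ Q b & forall t j, size t = size x -> (size ys < j)%N ->
    killsH b (pw x t) j (adj [set 0] ys).
Proof.
have h0 : is_ideal [set 0 : B] by auto.
elim: n ys Q => [|n IHn] ys Q pQ SQ sn reg.
  exists 1; first exact: primeN1.
  by move=> t j st sj; apply: killsH_large; rewrite size_pw //; exact: leq_ltn_trans sj.
have ha := adj_ideal ys h0; set a := adj [set 0] ys in ha *.
pose K : set B := [set b | forall t j, size t = size x -> (size ys < j)%N -> killsH b (pw x t) j a].
have hK : is_ideal K.
  split=> [t j _ _|b c d Kc Kd t j st sj]; first exact: ideal0 (killsH_ideal _ _ ha).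
  by have [_] := killsH_ideal (pw x t) j ha; apply; [exact: Kc | exact: Kd].
apply: contrapT => no; have KQ : K `<=` Q.
  by move=> b Kb; apply: contrapT => nQb; apply: no; exists b.
have [P mP PQ] := minover_exists noethB hK pQ KQ; have [pP KP _] := mP.
have SP s : S s -> ~ P s by move=> /SQ nQs /PQ.
have aP : a `<=` P by apply: subset_trans KP => b ab t j _ _; exact: killsH_full.
have regP := regseq_atS PQ reg.
suff [b nPb Kb] : exists2 b, ~ P b & K b by apply/nPb/KP.
(* In the associated case the height [e] of [P] is at most [size ys], while every prime inside [P]
   over [a] has at least that height; so [P] is minimal over [a]. The degrees [j > size ys] satisfy
   [size x <= e + r < j + r], as [killsH_minover] requires. *)
have [[u Pu]|nassoc] := EM (exists u, P = colon a u).
  have [e [r [he hr xer]]] := fibre_dim pP SP.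
  have depth l : dimge [set 0] P l -> (l <= size ys)%N.
    exact: (regular_depth pP (fibre_regular pP SP) regP Pu).
  have [|b nb hb] := killsH_minover ha pP hr; last first.
    exists b => // t j st sj; apply: hb => //; apply: leq_ltn_trans xer _.
    by rewrite ltn_add2r; exact: leq_ltn_trans (depth _ he) sj.
  move=> _; split=> // q pq aq qP; apply: contrapT => nPq.
  suff /depth : dimge [set 0] P (size ys).+1 by rewrite ltnn.
  apply: (@dimge_rcons _ _ q) => //; apply: (regseq_height pP regP) => //.
  by move=> y yys; apply: aq; exact: adj_mem.
have [ps hps] := finite_assoc noethB ha.
have [|y [Py hy]] := @prime_avoid0 _ P [seq q <- ps | `[< is_prime q /\ ~ P `<=` q >]]
  (prime_ideal pP).
  by move=> q; rewrite mem_filter => /andP[/asboolP].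
have regy f : a (f * y) -> satc P a f.
  move=> afy; apply: contrapT => /(assoc_prime_at noethB ha pP)[c [pc cP]].
  have [Pc|nPc] := EM (P `<=` colon a (c * f)).
    by apply: nassoc; exists (c * f); apply/seteqP.
  apply: (hy (colon a (c * f))).
    by rewrite mem_filter hps // andbT; apply/asboolP.
  by rewrite /colon /= mulrC -mulrA; exact: (idealMl _ ha).
have [c [k [nPc hc]]] := minover_pow noethB hK mP.
(* [killsH_torsion] requires that the new element itself kill the homology for all [t]. Since [P] is
   minimal over [K], the multiple [c * y ^+ k] is in [K], and it is still regular at [P] because [c]
   is outside [P]. *)
pose y' := c * y ^+ k; have Ky' : K y' by apply: hc; exact: ideal_powX.
have regy' f : a (f * y') -> satc P a f.
  rewrite /y' mulrA => /(satc_regX pP ha regy).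
  by rewrite mulrC; exact: satcK.
have [b nPb hb] : exists2 b, ~ P b & forall t j, size t = size x ->
    (size (rcons ys y') < j)%N -> killsH b (pw x t) j (adj [set 0] (rcons ys y')).
  by apply: IHn => //; [rewrite size_rcons addnS -addSn | apply/regseq_rcons].
have [g Eg] := noeth_fg noethB (colon_ideal y' ha).
have [|s nPs hs] := @common_denominator _ P a g pP ha.
  by move=> f fg; apply: regy'; change (colon a y' f); rewrite Eg; exact: adj_mem.
exists (s * b); first exact: primeNM.
move=> t j st sj; apply: (@killsH_torsion _ _ _ _ y') => //; first exact: Ky'.
  by move=> u au; apply: hs; rewrite -Eg.
by rewrite -adj_rcons; apply: hb => //; rewrite size_rcons.
Qed.

Theorem killsH_generic : S 1 -> (forall s s', S s -> S s' -> S (s * s')) ->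
  exists2 s, S s & forall t j, size t = size x -> (0 < j)%N -> killsH s (pw x t) j [set 0].
Proof.
move=> S1 SM; have h0 : is_ideal [set 0 : B] by auto.
pose K : set B := [set b | forall t j, size t = size x -> (0 < j)%N -> killsH b (pw x t) j [set 0]].
have hK : is_ideal K.
  split=> [t j _ _|b c d Kc Kd t j st sj]; first exact: ideal0 (killsH_ideal _ _ h0).
  by have [_] := killsH_ideal (pw x t) j h0; apply; [exact: Kc | exact: Kd].
apply: contrapT => no; have [|Q [pQ KQ QS]] := prime_avoiding noethB hK S1 SM.
  by move=> b Kb Sb; apply: no; exists b.
have SQ s : S s -> ~ Q s by move=> Ss /QS.
have [b nQb hb] := @killsH_regseq (size x) [::] Q pQ SQ (leq_addr _ _) Logic.I.
by apply: nQb; apply: KQ.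
Qed.

End UniformKilling.

(** * Descent of the annihilator to [R] *)

Lemma adj_perm (B : comPzRingType) (a : set B) s1 s2 y : is_ideal a ->
  adj a (s1 ++ y :: s2) = addx (adj a (s1 ++ s2)) y.
Proof.
move=> ha; rewrite -adj_rcons; apply: eq_adj => // z.
by rewrite mem_rcons inE !mem_cat inE; case: (z == y); rewrite ?orbT.
Qed.

(* The colons are those of the first Koszul homology, and they descend from the completion
   since [J B \cap R = J]. *)
Theorem parameter_colon_killer (R : idomainType) (m : set R) (p : nat) (x : seq R) :
  p \in [pchar R] -> noetherian R -> loc m -> G_ring R -> catenary R -> catenary {poly R} ->
  minover (adj [set 0] x) m -> dimge [set 0] m (size x) ->
  exists2 c : R, c != 0 & forall x1 y x2, x = x1 ++ y :: x2 ->
    forall t1 t2 k u, size t1 = size x1 -> size t2 = size x2 ->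
    adj [set 0] (pw x1 t1 ++ pw x2 t2) (u * y ^+ k) ->
    adj [set 0] (pw x1 t1 ++ pw x2 t2) (c * u).
Proof.
move=> charRp noethR hm GR catR catRX mx dx.
have [B [phi [phi_inj phi_dense cB regQ]]] := generic_fibre noethR hm GR.
have hM := completion_loc hm phi_inj phi_dense cB; set M := ext phi m in cB phi_inj phi_dense hM.
have noethB := completion_noetherian noethR hm phi_inj phi_dense cB.
have h0 : is_ideal [set 0 : R] by auto. have h0B : is_ideal [set 0 : B] by auto.
have ext0 : ext phi [set 0] = [set 0] := ext_adj phi [::].
have charp : p%:R = 0 :> B by rewrite -(rmorph_nat phi) (pcharf0 charRp) rmorph0.
have prime_p := pcharf_prime charRp.
have prime0 : is_prime [set 0 : R].
  split=> //=; first by apply/eqP/oner_neq0.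
  by move=> a b /= /eqP; rewrite mulf_eq0 => /orP[] /eqP; [left | right].
have dim s : minover (adj [set 0] s) m -> minover (adj [set 0] (map phi s)) M.
  move=> [_ sm min]; rewrite -ext_adj; split; [exact: loc_prime | exact: extS |].
  move=> Q pQ sQ QM; apply: ext_min; first by auto.
  apply: min; first exact: preimage_prime.
    by move=> a ha; apply: sQ; exact: ext_mem.
  by apply: prime_sub_loc => //; exact: preimage_prime.
pose S : set B := phi @` [set r | r != 0].
have SQ Q : (forall s, S s -> ~ Q s) -> forall r, Q (phi r) -> r = 0.
  by move=> h r Qr; apply/eqP/negPn/negP => r0; apply: (h (phi r)) => //; exists r.
have fibre_dim Q : is_prime Q -> (forall s, S s -> ~ Q s) ->
    exists e r, [/\ dimge [set 0] Q e, dimge Q M r & (size (map phi x) <= e + r)%N].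
  move=> pQ _; have [|P mP PQ] := minover_exists noethB h0B pQ.
    by move=> _ /= ->; apply: ideal0; auto.
  have [pP _ _] := mP; have dP : dimge P M (size x).
    by apply: (ratliff noethR hm phi_inj phi_dense cB catR catRX prime0) => //; rewrite ext0.
  have [e [r [h1 h2 h3]]] := complete_dim noethB hM cB prime_p charp pP pQ PQ dP.
  exists e, r; rewrite size_map; split=> //; apply: dimge_sub h1.
  by move=> _ /= ->; apply: ideal0; auto.
have kill s : size s = size x -> minover (adj [set 0] s) m -> exists2 c : R, c != 0 &
    forall t j, size t = size s -> (0 < j)%N -> killsH (phi c) (pw (map phi s) t) j [set 0].
  move=> ss ms; have [||||_ [c c0 <-] hc] := @killsH_generic _ noethB M p hM cB prime_p charp _ (dim s ms) S.
  - by rewrite size_map ss -(size_map phi).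
  - by move=> Q pQ /SQ; exact: regQ.
  - by exists 1; [exact: oner_neq0 | rewrite rmorph1].
  - by move=> _ _ [r r0 <-] [r' r0' <-]; exists (r * r'); rewrite ?rmorphM //= mulf_neq0.
  by exists c => // t j st; apply: hc; rewrite size_map.
have kill_at i : exists2 c : R, c != 0 & forall x1 y x2, x = x1 ++ y :: x2 -> size x1 = i ->
    forall t1 t2 k u, size t1 = size x1 -> size t2 = size x2 ->
    adj [set 0] (pw x1 t1 ++ pw x2 t2) (u * y ^+ k) ->
    adj [set 0] (pw x1 t1 ++ pw x2 t2) (c * u).
  have [ix|xi] := ltnP i (size x); last first.
    exists 1 => [|x1 y x2 ex sx1]; first exact: oner_neq0.
    by move: xi; rewrite ex size_cat /= sx1 -addSnnS leqNgt leq_addr.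
  (* The parameter to be cancelled is moved to the front, as [killsH1_colon] expects. Each position
     gets its own annihilator; their product serves for all. *)
  pose s := nth 0 x i :: (take i x ++ drop i.+1 x).
  have xE : x = take i x ++ nth 0 x i :: drop i.+1 x by rewrite -drop_nth // cat_take_drop.
  have sx : size s = size x by rewrite [in RHS]xE /s /= !size_cat /= addnS.
  have [|c c0 hc] := kill s sx.
    have -> : adj [set 0] s = adj [set 0] x; last by [].
    apply: eq_adj => // z; rewrite [in RHS]xE /s !(inE, mem_cat).
    by case: (z == _); rewrite ?orbT.
  exists c => // x1 y x2 ex sx1 t1 t2 k u st1 st2.
  have [Ex1 Ey Ex2] : [/\ take i x = x1, nth 0 x i = y & drop i.+1 x = x2].
    rewrite ex -sx1; split; first by rewrite take_size_cat.
      by rewrite nth_cat ltnn subnn.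
    by rewrite -cat_rcons drop_size_cat // size_rcons.
  move: hc; rewrite /s Ex1 Ey Ex2 => hc h.
  apply: (ext_contract noethR hm phi_inj phi_dense (adj_ideal _ h0)).
  have := hc (k :: (t1 ++ t2)) 1%N; rewrite /= !size_cat st1 st2 => /(_ erefl isT).
  rewrite {1}/pw /= -/(pw _ _) => hk.
  have Epw : pw (map phi (x1 ++ x2)) (t1 ++ t2) = map phi (pw x1 t1 ++ pw x2 t2).
    by rewrite /pw map_cat zip_cat ?size_map // !map_cat -!/(pw _ _) !map_pw.
  rewrite Epw in hk; rewrite ext_adj rmorphM; apply: (killsH1_colon h0B hk).
  by rewrite -rmorphXn -rmorphM -ext_adj; exact: ext_mem.
have /choice[cs hcs] : forall i, exists c : R, c != 0 /\ forall x1 y x2, x = x1 ++ y :: x2 ->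
    size x1 = i -> forall t1 t2 k u, size t1 = size x1 -> size t2 = size x2 ->
    adj [set 0] (pw x1 t1 ++ pw x2 t2) (u * y ^+ k) ->
    adj [set 0] (pw x1 t1 ++ pw x2 t2) (c * u).
  by move=> i; have [c c0 hc] := kill_at i; exists c.
exists (\prod_(i < size x) cs i) => [|x1 y x2 ex t1 t2 k u st1 st2 h].
  by apply/prodf_neq0 => i _; exact: (hcs i).1.
have ix : (size x1 < size x)%N by rewrite ex size_cat /= -addSnnS leq_addr.
rewrite (bigD1 (Ordinal ix)) //= -mulrA mulrCA; apply: (idealMl _ (adj_ideal _ h0)).
exact: ((hcs (size x1)).2 _ _ _ ex erefl _ _ k).
Qed.

(** * Tight closure *)

Section Monomials.
Variable R : comPzRingType.
Implicit Types (a J : set R) (s : seq R) (t u v : seq nat) (x y r c : R).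

Fixpoint monomial s u : R :=
  match s, u with y :: s', k :: u' => y ^+ k * monomial s' u' | _, _ => 1 end.

Lemma monomial_incr s u i : size u = size s -> (i < size s)%N ->
  monomial s (incr_nth u i) = nth 0 s i * monomial s u.
Proof.
elim: s u i => [|y s IHs] [|k u] [|i] //= [su] si; first by rewrite exprS mulrA.
by rewrite IHs // mulrCA.
Qed.

Lemma sumn_incr_nth u i : sumn (incr_nth u i) = (sumn u).+1.
Proof.
elim: u i => [|k u IHu] [|i] //=; last by rewrite IHu addnS.
by rewrite sumn_ncons.
Qed.

Lemma monomialX s u q : size u = size s ->
  monomial s u ^+ q = monomial s (map (muln^~ q) u).
Proof.
elim: s u => [|y s IHs] [|k u] //=; first by rewrite expr1n.
by move=> [su]; rewrite exprMn exprM IHs.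
Qed.

Lemma monomial_adj a s t v i : is_ideal a -> size t = size s -> size v = size s ->
  (i < size s)%N -> (nth 0%N t i <= nth 0%N v i)%N -> adj a (pw s t) (monomial s v).
Proof.
move=> ha; elim: s t v i a ha => [|y s IHs] [|k t] [|l v] [|i] a ha //= [st] [sv] si tv.
  rewrite -(subnK tv) exprD mulrAC; apply: idealMl; first by apply: adj_ideal; auto.
  apply: adj_sub; [by auto | exact: addx_self].
apply: idealMl; first by apply: adj_ideal; auto.
by apply: (IHs _ _ i) => //; auto.
Qed.

Lemma exceed u v : size u = size v -> (sumn u <= sumn v)%N -> u <> v ->
  exists2 i, (i < size u)%N & (nth 0 u i < nth 0 v i)%N.
Proof.
move=> suv le uv; apply: contrapT => no; apply: uv.
have {no} h i : (i < size u)%N -> (nth 0 v i <= nth 0 u i)%N.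
  by move=> iu; rewrite leqNgt; apply/negP => lt; apply: no; exists i.
suff : (sumn v <= sumn u)%N /\ (sumn u <= sumn v -> u = v)%N by case=> _; apply.
move=> {le}; elim: u v suv h => [|k u IHu] [|l v] //= [suv] h.
have lk := h 0%N isT; have [|h1 h2] := IHu v suv; first by move=> i; exact: (h i.+1).
split; first exact: leq_add.
move=> e; have ekl : k = l by move: lk => /=; lia.
by rewrite ekl h2 //; lia.
Qed.

(** The coefficients are indexed by [E] and not by the values of [F], which may coincide; later the
    coefficient of a single exponent is isolated. *)
Lemma adj_map_sum (T : eqType) (E : seq T) (F : T -> R) x : uniq E ->
  adj [set 0] (map F E) x -> exists r : T -> R, x = \sum_(u <- E) r u * F u.
Proof.
move=> uE; pose G : set R := [set x | exists r : T -> R, x = \sum_(u <- E) r u * F u].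
apply: (@adj_min _ _ G).
- split; first by exists (fun=> 0); rewrite big1 // => w _; rewrite mul0r.
  move=> a _ _ [r ->] [r' ->]; exists (fun w => a * r w + r' w).
  by rewrite mulr_sumr -big_split /=; apply: eq_bigr => w _; rewrite mulrDl mulrA.
- by move=> _ /= ->; exists (fun=> 0); rewrite big1 // => w _; rewrite mul0r.
move=> _ /mapP[u uin ->]; exists (fun w => (w == u)%:R).
rewrite (bigD1_seq u) //= eqxx mul1r big1 ?addr0 // => w /negPf ->.
by rewrite mul0r.
Qed.

Variable s : seq R.
Local Notation h := (size s).

Definition exponents n : seq (h.-tuple 'I_n.+1) :=
  [seq w : h.-tuple 'I_n.+1 <- enum {: h.-tuple 'I_n.+1} | sumn (map val (w : seq 'I_n.+1)) == n].

Definition monomials n := [seq monomial s (map val (w : seq 'I_n.+1)) | w : h.-tuple 'I_n.+1 <- exponents n].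

Lemma monomials_mem n u : size u = h -> sumn u = n -> monomial s u \in monomials n.
Proof.
move=> su un; have eu : map val (map (@inord n) u) = u.
  rewrite -map_comp -[RHS]map_id; apply/eq_in_map => k ku /=; rewrite inordK // ltnS -un.
  elim: u ku {su un} => //= l u IHu; rewrite inE => /orP[/eqP ->|/IHu]; first exact: leq_addr.
  by move=> /leq_trans; apply; exact: leq_addl.
have st : size (map (@inord n) u) == h by rewrite size_map su.
apply/mapP; exists (Tuple st); last by rewrite /= eu.
by rewrite mem_filter mem_enum andbT /= eu un.
Qed.

Lemma ideal_pow_monomials n : ideal_pow (adj [set 0] s) n = adj [set 0] (monomials n).
Proof.
have h0 : is_ideal [set 0 : R] by auto.
have hA k : is_ideal (adj [set 0] (monomials k)) by auto.
apply/seteqP; split.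
  elim: n => [|n IHn] x.
    move=> _; apply: ideal_full => //; apply: adj_mem => //.
    have -> : 1 = monomial s (nseq h 0%N) by elim: s => //= y s' <-; rewrite expr0 mulr1.
    by apply: monomials_mem; rewrite ?size_nseq // sumn_nseq.
  apply: ideal_mul_min => // {}x y hx /IHn hy.
  suff sub : adj [set 0] s `<=` colon (adj [set 0] (monomials n.+1)) y by exact: sub.
  apply: adj_min; [by auto | by move=> _ /= ->; apply: ideal0; auto |] => z zs.
  suff sub : adj [set 0] (monomials n) `<=` colon (adj [set 0] (monomials n.+1)) z.
    by rewrite /colon /= mulrC; exact: sub.
  apply: adj_min; [by auto | by move=> _ /= ->; apply: ideal0; auto |] => _ /mapP[u uin ->].
  move: uin; rewrite mem_filter => /andP[/eqP un _].
  have iz : (index z s < h)%N by rewrite index_mem.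
  have su : size (map val u) = h by rewrite size_map size_tuple.
  rewrite /colon /= mulrC -{1}(nth_index 0 zs) -monomial_incr //; apply: adj_mem => //.
  apply: monomials_mem; last by rewrite sumn_incr_nth un.
  by rewrite size_incr_nth su iz.
apply: adj_min; [exact: ideal_pow_ideal | by move=> _ /= ->; apply: ideal0; exact: ideal_pow_ideal |].
move=> _ /mapP[u uin ->]; move: uin; rewrite mem_filter => /andP[/eqP un _].
have : size (map val u) = h by rewrite size_map size_tuple.
rewrite -[X in ideal_pow _ X _]un {un}; move: (map val u) => v.
have gen J s' : (forall y, y \in s' -> J y) -> size v = size s' ->
    ideal_pow J (sumn v) (monomial s' v).
  elim: s' v => [|y s' IHs] [|k v] //= sJ [sv].
  apply: ideal_powM; first by apply: ideal_powX; apply: sJ; rewrite mem_head.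
  by apply: IHs => // z zs; apply: sJ; rewrite inE zs orbT.
by apply: gen => y; exact: adj_mem.
Qed.

(* Each generator [y] is cancelled in turn from a relation
   [x * y ^ k * ... - r * y ^ (k + q)] modulo powers of the others, at the cost of a factor [c]. *)
Lemma cancel_monomial c q :
  (forall s1 y s2, s = s1 ++ y :: s2 -> forall t1 t2 k (z : R), size t1 = size s1 -> size t2 = size s2 ->
    adj [set 0] (pw s1 t1 ++ pw s2 t2) (z * y ^+ k) ->
    adj [set 0] (pw s1 t1 ++ pw s2 t2) (c * z)) ->
  forall u x, size u = h -> adj [set 0] (pw s (map (addn^~ q) u)) (x * monomial s u) ->
  adj [set 0] (pw s (nseq h q)) (c ^+ h * x).
Proof.
move=> hc; have h0 : is_ideal [set 0 : R] by auto.
suff peel s2 : forall s1 t1 u x, s = s1 ++ s2 -> size t1 = size s1 -> size u = size s2 ->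
    adj [set 0] (pw s1 t1 ++ pw s2 (map (addn^~ q) u)) (x * monomial s2 u) ->
    adj [set 0] (pw s1 t1 ++ pw s2 (nseq (size s2) q)) (c ^+ size s2 * x).
  by move=> u x su hx; apply: (peel s [::] [::] u).
elim: s2 => [|y s2 IHs] s1 t1 [|k u] x es st1 su //=.
  by rewrite mulr1 mul1r.
rewrite {1}/pw /= -/(pw _ _); case: su => su.
rewrite adj_perm // => -[r hr _].
have ha : is_ideal (adj [set 0] (pw s1 t1 ++ pw s2 (map (addn^~ q) u))) by auto.
have hx : adj [set 0] (pw s1 t1 ++ pw s2 (map (addn^~ q) u))
    (c * (x * monomial s2 u - r * y ^+ q)).
  apply: (hc _ _ _ es _ _ k) => //; first by rewrite size_map.
  have -> : (x * monomial s2 u - r * y ^+ q) * y ^+ k =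
     x * (y ^+ k * monomial s2 u) - r * y ^+ (k + q) by rewrite exprD; ring.
  exact: hr.
have Ecat t2 : pw (rcons s1 y) (rcons t1 q) ++ pw s2 t2 = pw s1 t1 ++ y ^+ q :: pw s2 t2.
  by rewrite /pw -!cats1 zip_cat // map_cat -catA.
rewrite exprSr -mulrA; have := IHs (rcons s1 y) (rcons t1 q) u (c * x).
rewrite cat_rcons !size_rcons st1 !Ecat; move=> /(_ es erefl su); apply.
rewrite adj_perm //; exists (c * r) => //.
by have -> : c * x * monomial s2 u - c * r * y ^+ q = c * (x * monomial s2 u - r * y ^+ q) by ring.
Qed.

End Monomials.

(** * Coefficients of elements in the tight closure of a power *)

Section TightClosure.
Variables (R : idomainType) (p : nat).
Hypotheses (charRp : p \in [pchar R]) (noethR : noetherian R).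
Implicit Types (I J : set R) (s : seq R) (x y c r : R).

Lemma off_minimal_domain c : off_minimal_primes c <-> c != 0.
Proof.
have prime0 : is_prime [set 0 : R].
  split=> /=; [by auto | by apply/eqP/oner_neq0 |].
  by move=> a b /= /eqP; rewrite mulf_eq0 => /orP[] /eqP; [left | right].
split=> [h|c0 P [pP minP] Pc].
  apply/eqP; apply: (h [set 0]); split=> // Q pQ Q0; apply/seteqP; split=> // _ /= ->.
  by apply: ideal0; auto.
suff E : [set 0] = P by move: c0; rewrite -E in Pc; rewrite Pc eqxx.
by apply: minP => // _ /= ->; apply: ideal0; auto.
Qed.

Lemma frob_pow_ideal e J : is_ideal J -> is_ideal (frob_pow (p ^ e) J).
Proof.
by move=> /(noethR)[s ->]; rewrite frob_powE //; exact: idl_ideal.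
Qed.

Lemma frobenius_iterD e x y : (x + y) ^+ (p ^ e) = x ^+ (p ^ e) + y ^+ (p ^ e).
Proof.
apply: exprDn_pchar; rewrite pnatX (eq_pnat _ (pcharf_eq charRp)).
by rewrite pnat_id ?(pcharf_prime charRp).
Qed.

Lemma q_gt0 e : (0 < p ^ e)%N.
Proof. by rewrite expn_gt0 prime_gt0 // (pcharf_prime charRp). Qed.

Lemma frobenius_sum e (T : Type) (E : seq T) (F : T -> R) :
  (\sum_(i <- E) F i) ^+ (p ^ e) = \sum_(i <- E) F i ^+ (p ^ e).
Proof.
elim/big_ind2: _ => // [|x y z t <- <-]; first by rewrite expr0n gtn_eqF // q_gt0.
exact: frobenius_iterD.
Qed.

Lemma frob_pow_mem e J x : is_ideal J -> J x -> frob_pow (p ^ e) J (x ^+ (p ^ e)).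
Proof.
move=> hJ; have hF := frob_pow_ideal e hJ.
suff sub : J `<=` [set z | frob_pow (p ^ e) J (z ^+ (p ^ e))] by exact: sub.
have [s Es] := noethR hJ; rewrite [X in X `<=` _]Es; apply: idl_min.
  split=> [|a y z hy hz] /=; first by rewrite expr0n gtn_eqF ?q_gt0 //; exact: ideal0.
  rewrite frobenius_iterD exprMn; apply: (idealD hF) => //; exact: (idealMl _ hF).
by move=> z zs; exists s => //; apply: idl_sub; exists z.
Qed.

Lemma frob_pow_min e J K : is_ideal J -> is_ideal K ->
  (forall x, J x -> K (x ^+ (p ^ e))) -> frob_pow (p ^ e) J `<=` K.
Proof.
move=> hJ hK JK; have [s Es] := noethR hJ; rewrite Es frob_powE //.
by apply: idl_min => // _ [x xs <-]; apply: JK; rewrite Es; exact: idl_sub.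
Qed.

Lemma tight_closure_ideal J : is_ideal J -> is_ideal (tight_closure p J).
Proof.
move=> hJ; split=> [|a x y [c c0 [e hc]] [d d0 [e' hd]]].
  exists 1; first by apply/off_minimal_domain/oner_neq0.
  by exists 0%N => e _; rewrite expr0n gtn_eqF ?q_gt0 // mulr0; apply: ideal0; exact: frob_pow_ideal.
exists (c * d).
  by apply/off_minimal_domain; rewrite mulf_neq0 //; exact/off_minimal_domain.
exists (maxn e e') => k; rewrite geq_max => /andP[/hc h1 /hd h2].
have hF := frob_pow_ideal k hJ; rewrite frobenius_iterD exprMn.
have -> : c * d * (a ^+ (p ^ k) * x ^+ (p ^ k) + y ^+ (p ^ k)) =
  d * a ^+ (p ^ k) * (c * x ^+ (p ^ k)) + c * (d * y ^+ (p ^ k)) by ring.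
by apply: (idealD hF); exact: (idealMl _ hF).
Qed.

Lemma tight_closure_powM I n x y : is_ideal I -> ideal_pow I n x -> tight_closure p I y ->
  tight_closure p (ideal_pow I n.+1) (x * y).
Proof.
move=> hI hx [c c0 [e0 hc]]; exists c => //; exists e0 => e /hc hy.
have hF := frob_pow_ideal e (ideal_pow_ideal I n.+1).
have sub : frob_pow (p ^ e) I `<=` colon (frob_pow (p ^ e) (ideal_pow I n.+1)) (x ^+ (p ^ e)).
  apply: frob_pow_min => //; first by auto.
  move=> z Iz; rewrite /colon /= -exprMn.
  apply: (@frob_pow_mem e (ideal_pow I n.+1)); first exact: ideal_pow_ideal.
  exact: ideal_mulM.
have := sub _ hy; rewrite /colon /=.
by have -> : c * y ^+ (p ^ e) * x ^+ (p ^ e) = c * (x * y) ^+ (p ^ e) by rewrite exprMn; ring.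
Qed.

(* The relations among powers of the generators are trivial up to [c], so that each
   coefficient of [x] in the monomials of degree [n] is isolated. *)
Lemma tight_closure_pow_sub s c n x : c != 0 ->
  (forall s1 y s2, s = s1 ++ y :: s2 -> forall t1 t2 k z, size t1 = size s1 -> size t2 = size s2 ->
    adj [set 0] (pw s1 t1 ++ pw s2 t2) (z * y ^+ k) ->
    adj [set 0] (pw s1 t1 ++ pw s2 t2) (c * z)) ->
  ideal_pow (adj [set 0] s) n x -> tight_closure p (ideal_pow (adj [set 0] s) n.+1) x ->
  ideal_mul (ideal_pow (adj [set 0] s) n) (tight_closure p (adj [set 0] s)) x.
Proof.
move=> c0 hc hx [d d0 [e0 hd]]; have h0 : is_ideal [set 0 : R] by auto.
have uE : uniq (exponents s n) by rewrite filter_uniq // enum_uniq.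
have hx' := hx; rewrite ideal_pow_monomials in hx'.
have [r rE] := adj_map_sum uE hx'.
rewrite rE big_seq; apply: (ideal_sum _ (ideal_mul_ideal _ _)) => u uin.
have [su un] : size (map val u) = size s /\ sumn (map val u) = n.
  by move: uin; rewrite mem_filter size_map size_tuple => /andP[/eqP].
rewrite mulrC; apply: ideal_mulM.
  rewrite ideal_pow_monomials; apply: adj_mem => //; exact: monomials_mem.
exists (c ^+ size s * d).
  by apply/off_minimal_domain; rewrite mulf_neq0 ?expf_neq0 //; apply/off_minimal_domain.
exists e0 => e /hd; set q := (p ^ e)%N => hq.
(* [J] is generated by the powers [s_i ^ (q u_i + q)]. It contains the [q]-th power of any monomial
   with some exponent above that of [u], thus of every monomial of degree at least [n] other than
   [u] itself: both the other terms of [x] and the generators of the next power of the ideal. *)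
pose J := adj [set 0] (pw s (map (addn^~ q) (map (muln^~ q) (map val u)))).
have hJ : is_ideal J by exact: adj_ideal.
have q0 : (0 < q)%N by exact: q_gt0.
have st : size (map (addn^~ q) (map (muln^~ q) (map val u))) = size s.
  by rewrite !size_map size_tuple.
have inJ v : size v = size s -> (n <= sumn v)%N -> map val u <> v -> J (monomial s v ^+ q).
  move=> sv nv uv; rewrite monomialX //; have [||i iu lt] := exceed _ _ uv.
  - by rewrite sv su.
  - by rewrite un.
  have is' : (i < size s)%N by move: iu; rewrite su.
  apply: (monomial_adj (i := i)) => //; first by rewrite size_map.
  rewrite (nth_map 0%N) ?size_map -?(size_map val) //.
  rewrite (nth_map 0%N) // (nth_map 0%N) ?sv //.
  by rewrite -mulSnr leq_mul2r lt orbT.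
have hxq : J (d * x ^+ q).
  move: hq; apply: (frob_pow_min (ideal_pow_ideal _ _) hJ) => z.
  rewrite ideal_pow_monomials => /(adj_map_sum _)[|r' ->].
    by rewrite filter_uniq // enum_uniq.
  rewrite frobenius_sum big_seq; apply: (ideal_sum _ hJ) => v.
  rewrite mem_filter => /andP[/eqP vn _]; rewrite exprMn; apply: (idealMl _ hJ).
  have sv : size (map val v) = size s by rewrite size_map size_tuple.
  apply: inJ => //; first by rewrite vn.
  by move=> uv; move: vn; rewrite -uv un => /eqP; rewrite -[X in X == _]addn0 -addn1 eqn_add2l.
have hru : J (d * r u ^+ q * monomial s (map (muln^~ q) (map val u))).
  have Ex : d * r u ^+ q * monomial s (map (muln^~ q) (map val u)) =
     d * x ^+ q - \sum_(v <- exponents s n | v != u) d * (r v * monomial s (map val v)) ^+ q.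
    rewrite rE frobenius_sum (bigD1_seq u) //= mulrDr mulr_sumr addrK exprMn mulrA.
    by rewrite monomialX.
  rewrite Ex; apply: (idealB hJ) => //; rewrite big_seq_cond; apply: (ideal_sum _ hJ) => v.
  rewrite mem_filter => /andP[/andP[/eqP vn _] vu]; rewrite exprMn mulrA; apply: (idealMl _ hJ).
  apply: inJ; [by rewrite size_map size_tuple | by rewrite vn |].
  by move=> e'; case/eqP: vu; apply: val_inj; apply: (inj_map val_inj).
have su' : size (map (muln^~ q) (map val u)) = size s by rewrite size_map su.
have := cancel_monomial hc su' hru; rewrite mulrA.
apply: adj_min; [by apply: frob_pow_ideal; exact: adj_ideal | |].
  by move=> _ /= ->; apply: ideal0; apply: frob_pow_ideal; exact: adj_ideal.
move=> _ /mapP[[y k] yk ->] /=.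
have := map_f fst yk; rewrite -/(unzip1 _) unzip1_zip ?size_nseq // => ys.
have := map_f snd yk; rewrite -/(unzip2 _) unzip2_zip ?size_nseq // => /nseqP[/= -> _].
by apply: frob_pow_mem; [exact: adj_ideal | exact: adj_mem].
Qed.

End TightClosure.

(** * Excellence, parameter ideals and the conclusion *)

Lemma excellent_catenary (R : idomainType) : excellent R -> catenary R /\ catenary {poly R}.
Proof.
move=> [_ ucat _ _]; split.
  apply: (ucat R (idfun : {rmorphism R -> R})); exists [::].
  apply/seteqP; split=> // x _ T [_ h]; apply: h; left; by exists x.
apply: (ucat {poly R} (polyC : {rmorphism R -> {poly R}})); exists [:: 'X].
apply/seteqP; split=> // F _ T [[T1 TB TM] h].
have TP G : T G -> G \in mem T by rewrite inE.
have Tc c : c%:P \in mem T by apply: TP; apply: h; left; exists c.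
have TX : 'X \in mem T by apply: TP; apply: h; right; rewrite /= mem_head.
apply: set_mem; elim/poly_ind: F => [|F c TF]; first by rewrite -(subrr 1) TB.
by rewrite -[c%:P]opprK TB ?TM // -sub0r TB // -(subrr 1) TB.
Qed.

(** Every prime over the ideal has height at least [size s], so a chain witnessing the length of [w]
    modulo the ideal is prolonged downwards by [size s] steps. *)
Lemma parameter_system (R : comPzRingType) (m : set R) (s : seq R) : noetherian R -> loc m ->
  has_height (idl [set` s]) (size s) -> exists w,
    [/\ minover (adj [set 0] (s ++ w)) m, dimge [set 0] m (size (s ++ w))
      & forall y, y \in w -> m y].
Proof.
move=> noethR hm; rewrite adj_idl => -[ht [P [pP sP _]]].
have h0 : is_ideal [set 0 : R] by auto.
have sm := subset_trans sP (prime_sub_loc hm pP).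
have [w [wm mw dw]] := sop_exists noethR (adj_ideal s h0) (loc_prime hm) sm.
exists w; split=> //; first by rewrite adj_cat.
rewrite size_cat; apply: dimge_trans dw => q pq sq _; have [c hc cq] := ht q pq sq.
exists c; split=> // _ /= ->; apply: ideal0; apply: prime_ideal.
by case: hc => h _; exact: h.
Qed.

Theorem theorem1p3 (p : nat) (R : idomainType) (m I : set R)
  (charRp : p \in [pchar R]) (noethR : noetherian R) (localR : local_with m)
  (excR : excellent R) (paramI : is_parameter_ideal I) (n : nat) :
  ideal_pow I n `&` tight_closure p (ideal_pow I n.+1) =
  ideal_mul (ideal_pow I n) (tight_closure p I).
Proof.
have hm := local_with_loc noethR localR; have hm' : is_ideal m by case: hm.
have [catR catRX] := excellent_catenary excR.
have [s Is hts] := paramI; rewrite Is in hts.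
have h0 : is_ideal [set 0 : R] by auto.
have hI : is_ideal I by rewrite Is; exact: idl_ideal.
apply/seteqP; split=> [x [xI xI']|]; last first.
  apply: ideal_mul_min => [|x y hx hy]; first apply: setI_ideal.
  - exact: ideal_pow_ideal.
  - by apply: tight_closure_ideal => //; exact: ideal_pow_ideal.
  by split; [exact: (idealMr _ (ideal_pow_ideal _ _)) | exact: tight_closure_powM].
have [w [mw dw wm]] := parameter_system noethR hm hts.
have GR : G_ring R by case: excR.
have [c c0 hc] := parameter_colon_killer charRp noethR hm GR catR catRX mw dw.
rewrite Is adj_idl in xI xI' *.
apply: (tight_closure_pow_sub charRp noethR c0) => // s1 y s2 es t1 t2 k z st1 st2 hz.
(* The colon property is known for the full system [s ++ w]. The additional parameters are given the
   exponent [N], so that they contribute only elements of [m ^ N], and Krull's intersection theorem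
   removes them. *)
apply: (krull_intersection noethR hm (adj_ideal _ h0)) => N.
have sN : size (t2 ++ nseq (size w) N) = size (s2 ++ w) by rewrite !size_cat st2 size_nseq.
have Epw : pw (s2 ++ w) (t2 ++ nseq (size w) N) = pw s2 t2 ++ pw w (nseq (size w) N).
  by rewrite /pw zip_cat // map_cat.
have := hc s1 y (s2 ++ w) _ t1 (t2 ++ nseq (size w) N) k z st1 sN.
rewrite es -catA => /(_ erefl); rewrite Epw catA adj_cat => h.
have : adj (adj [set 0] (pw s1 t1 ++ pw s2 t2)) (pw w (nseq (size w) N)) (c * z).
  apply: h; apply: adj_sub => //; exact: adj_ideal.
apply: adj_min; [by apply: isum_ideal; [exact: adj_ideal | exact: ideal_pow_ideal] | |].
  by apply: isum_l; exact: ideal_pow_ideal.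
move=> _ /mapP[[v l] vl ->] /=; apply: isum_r; first exact: adj_ideal.
have := map_f fst vl; rewrite -/(unzip1 _) unzip1_zip ?size_nseq // => vw.
have := map_f snd vl; rewrite -/(unzip2 _) unzip2_zip ?size_nseq // => /nseqP[/= -> _].
by apply: ideal_powX; exact: wm.
Qed.
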